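(* Let $J_0>0$ and let $X$ be a bounded real random variable with $\mathbb EX=0$ and $v=\operatorname{Var}(X)$. For real $\varepsilon$ with $|\varepsilon|$ small enough that $J_0+\varepsilon X\ge J_0/2$ almost surely, let the edges of $\mathbb Z^2$ carry i.i.d. bond strengths $J_e=J_0+\varepsilon X_e$, with $X_e$ i.i.d. copies of $X$, and let $T_{\mathrm{alg}}(\varepsilon)=1/\beta_{\mathrm{alg}}(\varepsilon)$ be the algebraic-phase temperature of the averaged XY model with couplings $\beta J_e$. Put $T_0=J_0/\beta_{\mathrm{BKT}}$. Then there is a finite constant $C$, depending on $J_0$ and the law of $X$, such that, for all sufficiently small $|\varepsilon|$, $$T_{\mathrm{alg}}(\varepsilon)\ge T_0-\frac{v}{J_0}\varepsilon^2-C|\varepsilon|^3.$$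
   Context: XY model. Let $\mathbb T=\mathbb R/(2\pi\mathbb Z)$. For a finite graph $G=(V,E)$ and couplings $K_e\ge0$, the XY Gibbs measure with free boundary conditions is $$d\mu_{G,K}(\theta)=\frac1{Z_{G,K}}\exp\Bigl(\sum_{e=\{u,v\}\in E}K_e\cos(\theta_u-\theta_v)\Bigr)\prod_{v\in V}\frac{d\theta_v}{2\pi},\qquad\theta\in\mathbb T^V.$$ Averaged correlation. With random couplings $K_e=\beta J_e$ on the nearest-neighbor edges of $\mathbb Z^2$, let $F_\varepsilon(\beta;x,y)$ be the limit, as the box $[-R,R]^2\cap\mathbb Z^2$ (free boundary conditions) increases to $\mathbb Z^2$, of the disorder expectation of the finite-volume Gibbs expectation of $\cos(\theta_x-\theta_y)$ (each Gibbs expectation is normalized before averaging); it exists by Ginibre monotonicity. Algebraic threshold. $$\beta_{\mathrm{alg}}(\varepsilon)=\inf\bigl\{\beta\ge0:\ \exists\,c>0,\ s\in[0,\infty)\text{ with }F_\varepsilon(\beta;0,x)\ge c(1+|x|)^{-s}\text{ for every }x\in\mathbb Z^2\setminus\{0\}\bigr\},\quad\inf\varnothing=\infty.$$ Clean critical point. $\beta_{\mathrm{BKT}}\in(0,\infty)$ is the critical inverse temperature of the clean XY model (all couplings equal to $\beta$) on $\mathbb Z^2$: the supremum of the $\beta\ge0$ for which the free infinite-volume two-point function $\langle\cos(\theta_0-\theta_x)\rangle_\beta$ decays exponentially in $|x|$. By the known exponential/algebraic dichotomy it equals the infimum of the $\beta\ge0$ for which this two-point function is at least $c(1+|x|)^{-s}$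 for all $x\ne0$, for some $c>0$, $s\in[0,\infty)$. *)

(* Defs.v *)
From HB Require Import structures.
From mathcomp Require Import all_boot all_order all_algebra.
From mathcomp Require Import all_classical all_reals all_analysis.

Set Implicit Arguments.
Unset Strict Implicit.
Unset Printing Implicit Defensive.

Import Order.TTheory GRing.Theory Num.Theory.
Import numFieldNormedType.Exports.

Local Open Scope classical_set_scope.
Local Open Scope ring_scope.

(* A finite graph is given by the lists [vs] of its vertices and [es] of its
   edges (both without repetition); [ends e] is the pair of endpoints of e. *)
Section XYmodel.
Context {R : realType} {V : eqType} {E : Type}.
Variable ends : E -> V * V.

(* Integral of f against the product over v in vs of dtheta_v / (2 pi), the
   circle being parametrized by [0, 2 pi]; the coordinates of theta outside vs
   are left unchanged. *)
Fixpoint torus_integral (vs : seq V) (f : (V -> R) -> R) (theta : V -> R) : R :=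
  if vs is v :: vs' then
    (2 * pi)^-1 * \int[lebesgue_measure]_(t in `[0, 2 * pi])
      torus_integral vs' f [eta theta with v |-> t]
  else f theta.

Definition xy_energy (es : seq E) (K : E -> R) (theta : V -> R) : R :=
  \sum_(e <- es) K e * cos (theta (ends e).1 - theta (ends e).2).

Definition xy_partition (vs : seq V) (es : seq E) (K : E -> R) : R :=
  torus_integral vs (fun theta => expR (xy_energy es K theta)) (fun=> 0).

Definition xy_expectation (vs : seq V) (es : seq E) (K : E -> R)
    (f : (V -> R) -> R) : R :=
  torus_integral vs (fun theta => f theta * expR (xy_energy es K theta))
    (fun=> 0) / xy_partition vs es K.

End XYmodel.

Definition site : Type := (int * int)%type.

(* [(x, false)] is the edge {x, x + (1, 0)}, [(x, true)] the edge
   {x, x + (0, 1)}: every nearest-neighbor edge of Z^2 occurs exactly once. *)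
Definition bond : Type := (site * bool)%type.

Definition bond_ends (e : bond) : site * site :=
  (e.1, if e.2 then (e.1.1, e.1.2 + 1) else (e.1.1 + 1, e.1.2)).

Definition box (n : nat) : seq site :=
  let side := [seq i%:Z - n%:Z | i <- iota 0 (2 * n).+1] in
  [seq (i, j) | i <- side, j <- side].

Definition box_bonds (n : nat) : seq bond :=
  [seq e <- [seq (x, b) | x <- box n, b <- [:: false; true]]
     | (bond_ends e).2 \in box n].

Section Lattice.
Context {R : realType}.

Definition site_norm (x : site) : R :=
  Num.sqrt (x.1%:~R ^+ 2 + x.2%:~R ^+ 2).

Definition box_correlation (n : nat) (K : bond -> R) (x y : site) : R :=
  xy_expectation bond_ends (box n) (box_bonds n) K
    (fun theta => cos (theta x - theta y)).

Definition clean_correlation (beta : R) (x y : site) : R :=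
  limn (fun n => box_correlation n (fun=> beta) x y).

Definition averaged_correlation d (T : measurableType d) (P : probability T R)
    (J : bond -> T -> R) (beta : R) (x y : site) : R :=
  limn (fun n => fine
    'E_P[fun w => box_correlation n (fun e => beta * J e w) x y]).

Definition exponential_decay (g : site -> R) : Prop :=
  exists A m : R, 0 < m /\ forall x, `|g x| <= A * expR (- m * site_norm x).

Definition algebraic_lower_bound (g : site -> R) : Prop :=
  exists c s : R, [/\ 0 < c, 0 <= s &
    forall x, x != (0, 0) -> c * (1 + site_norm x) `^ (- s) <= g x].

Definition beta_BKT : \bar R := ereal_sup [set beta%:E | beta in
  [set beta : R | 0 <= beta /\ exponential_decay (clean_correlation beta (0, 0))]].

Definition beta_alg d (T : measurableType d) (P : probability T R)
    (J : bond -> T -> R) : \bar R := ereal_inf [set beta%:E | beta in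
  [set beta : R | 0 <= beta /\
    algebraic_lower_bound (averaged_correlation P J beta (0, 0))]].

(* Extended-real inverse: 0^-1 = +oo and +oo^-1 = 0. *)
Definition T_alg d (T : measurableType d) (P : probability T R)
    (J : bond -> T -> R) : \bar R := ((beta_alg P J)^-1)%E.

Definition T_clean (J0 : R) : \bar R := (J0%:E / beta_BKT)%E.

End Lattice.

Definition mutually_independent {R : realType} {I : eqType} d
    (T : measurableType d) (P : probability T R) (X : I -> {RV P >-> R}) : Prop :=
  forall (s : seq I) (B : I -> set R), uniq s ->
    (forall i, measurable (B i)) ->
    P (\bigcap_(i in [set` s]) (X i @^-1` B i)) =
      (\prod_(i <- s) P (X i @^-1` B i))%E.

Definition same_law {R : realType} d d' (T : measurableType d)
    (T' : measurableType d') (P : probability T R) (Q : probability T' R)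
    (X : {RV P >-> R}) (Y : {RV Q >-> R}) : Prop :=
  forall B : set R, measurable B -> distribution P X B = distribution Q Y B.

Definition iid_copies {R : realType} {I : eqType} d d' (T : measurableType d)
    (T' : measurableType d') (P : probability T R) (Q : probability T' R)
    (X : {RV P >-> R}) (Y : I -> {RV Q >-> R}) : Prop :=
  mutually_independent Y /\ forall i, same_law X (Y i).

(* Main.v *)
Require Import Defs.
From HB Require Import structures.
From mathcomp Require Import all_boot all_order all_algebra.
From mathcomp Require Import all_classical all_reals all_analysis.
From mathcomp Require Import measurable_realfun.
From mathcomp Require Import zify ring lra.

Import Order.TTheory GRing.Theory Num.Theory.
Import numFieldNormedType.Exports.

Local Open Scope classical_set_scope.
Local Open Scope ring_scope.

(** The averaged model is bounded below by a clean model with a slightly smaller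
    coupling, and the clean model is algebraic as soon as its two-point function
    does not decay exponentially.

    Comparison. Let g(k) be the mean of O = cos (theta_x - theta_y) as a function
    of the coupling k of one bond, and c the cosine of that bond. Writing <f; h>
    for a covariance, g' = <O; c> and
      g'' + 2 g' = <O; c^2> + 2 (1 - <c>) <O; c>,
    which is nonnegative by Ginibre's inequality. Since d/du with u = exp (- 2 k)
    is - exp (2 k) / 2 d/dk, this says that g is a convex nonincreasing function
    of u. By Jensen's inequality an independent random coupling K may be replaced
    by any constant b >= 0 with exp (- 2 b) >= E exp (- 2 K) without increasing
    the mean of O; doing so bond after bond gives [box_correlation_jensen] and
    [averaged_correlation_ge]. For K = beta (J0 + eps X), with X centered,
    b may be taken as
      beta J0 - beta^2 eps^2 v - 4 beta^3 M^3 |eps|^3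
    up to an arbitrarily small loss ([cell_exp_moment], [beta_alg_le]). Asking
    that b exceed the clean threshold J0 / T0 and solving for 1 / beta gives the
    expansion of the temperature ([threshold_expansion]).

    Dichotomy. Let g now be the two-point function of the clean model. The Ward
    identity of the rotation of all spins of a box gives the Simon inequality
    [clean_correlation_simon]: g (y) is at most a sum over the bonds uv leaving
    the box of beta / 2 times g (u) G (v, y). If on the boundary of one box of
    side of order k all values g (u) were below a small multiple of k^-2, its
    iteration would give exponential decay. Otherwise every such boundary carries
    a site with g of order at least k^-2, and the chain inequality
    G (x, y) G (y, z) / 2 <= G (x, z) together with the symmetries of the lattice
    spreads this bound to all sites at the price of a larger exponent
    ([clean_algebraic_lower_bound]).

    Correlation inequalities. All of them are proved for clock models, where the
    spins take N equally spaced values and means are finite sums, and then pass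
    to the limit N -> oo ([xy_expectation_cvg]). Ginibre's change of variables
    needs N odd. The chain and Simon inequalities need a quarter turn, hence N
    divisible by four; the rotation in the Ward identity is then by one step of
    the clock, with an error that vanishes in the limit. *)

Set Implicit Arguments.
Unset Strict Implicit.
Unset Printing Implicit Defensive.

(** * Positivity of products of generators *)

Section Cone.
Context {R : realType} {Om : finType} {I : Type}.
Variable gen : I -> Om -> R.

(** Ginibre's positivity of a density: every product of generators has a
    nonnegative integral. *)
Definition monomial_pos (f : Om -> R) : Prop :=
  forall l : seq I, 0 <= \sum_w f w * \prod_(i <- l) gen i w.

(** Positivity through multiplication by [g], rather than through an expansion
    of [g] in the generators: closure under products, sums and limits, and
    thus under the exponential, is then immediate. *)
Definition pos_mult (g : Om -> R) : Prop :=
  forall f, monomial_pos f -> monomial_pos (fun w => f w * g w).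

Lemma pos_multE g h : g =1 h -> pos_mult g -> pos_mult h.
Proof. by move=> /funext ->. Qed.

Lemma pos_mult_gen i : pos_mult (gen i).
Proof.
move=> f fP l; have := fP (i :: l).
by under eq_bigr do rewrite big_cons mulrA.
Qed.

Lemma pos_multM g h : pos_mult g -> pos_mult h ->
  pos_mult (fun w => g w * h w).
Proof.
move=> gP hP f fP; have := hP _ (gP _ fP); congr monomial_pos.
by apply/funext => w; rewrite mulrA.
Qed.

Lemma pos_multD g h : pos_mult g -> pos_mult h ->
  pos_mult (fun w => g w + h w).
Proof.
move=> gP hP f fP l; have := addr_ge0 (gP _ fP l) (hP _ fP l).
by rewrite -big_split/=; under eq_bigr do rewrite -mulrDl -mulrDr.
Qed.

Lemma pos_mult_cst c : 0 <= c -> pos_mult (fun=> c).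
Proof.
move=> c0 f fP l; have := mulr_ge0 c0 (fP l).
rewrite mulr_sumr; congr (0 <= _); apply: eq_bigr => w _.
by rewrite mulrA (mulrC c).
Qed.

Lemma pos_multX g n : pos_mult g -> pos_mult (fun w => g w ^+ n).
Proof.
move=> gP; elim: n => [|n IH].
  by apply: pos_multE (pos_mult_cst ler01) => w; rewrite expr0.
by apply: pos_multE (pos_multM gP IH) => w; rewrite exprS.
Qed.

Lemma pos_mult_sum (J : Type) (s : seq J) (g : J -> Om -> R) :
  (forall j, pos_mult (g j)) -> pos_mult (fun w => \sum_(j <- s) g j w).
Proof.
move=> gP; elim: s => [|j s IH].
  by apply: pos_multE (pos_mult_cst (lexx 0)) => w; rewrite big_nil.
by apply: pos_multE (pos_multD (gP j) IH) => w; rewrite big_cons.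
Qed.

Lemma pos_mult_lim (u : nat -> Om -> R) g :
  (forall n, pos_mult (u n)) -> (forall w, u n w @[n --> \oo] --> g w) ->
  pos_mult g.
Proof.
move=> uP ug f fP l.
apply: (@cvgr_to_ge _ \oo _ _
   (fun n => \sum_w f w * u n w * \prod_(i <- l) gen i w)); last first.
  by near=> n; exact: uP.
apply: cvg_big => [|w _]; first exact: add_continuous.
apply: cvgM; last exact: cvg_cst.
by apply: cvgM => //; exact: cvg_cst.
Unshelve. all: by end_near. Qed.

Lemma pos_mult_exp g : pos_mult g -> pos_mult (fun w => expR (g w)).
Proof.
move=> gP; apply: (@pos_mult_lim (fun n w => series (exp_coeff (g w)) n)).
  move=> n; apply: pos_multE (pos_mult_sum _ _) => [w|j].
    exact: erefl.
  apply: (pos_multM (pos_multX j gP) (pos_mult_cst _)).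
  by rewrite invr_ge0.
by move=> w; exact: is_cvg_series_exp_coeff.
Qed.

Lemma pos_mult_ge0 g : monomial_pos (fun=> 1) -> pos_mult g ->
  0 <= \sum_w g w.
Proof.
move=> base gP; have := gP _ base [::].
by under eq_bigr do rewrite big_nil mulr1 mul1r.
Qed.

End Cone.

Section SitePositivity.
Context {R : realType} {W D : finType} {J : Type}.
Variable h : J -> D -> R.
Hypothesis h_pos : forall l : seq J, 0 <= \sum_d \prod_(j <- l) h j d.

(** A product over sites factorizes, so that moments of a single spin
    decide. *)
Lemma site_product_pos (l : seq (W * J)) :
  0 <= \sum_(w : {ffun W -> D}) \prod_(i <- l) h i.2 (w i.1).
Proof.
have E (w : {ffun W -> D}) : \prod_(i <- l) h i.2 (w i.1) =
    \prod_x \prod_(j <- [seq i.2 | i <- l & i.1 == x]) h j (w x).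
  have F i : h i.2 (w i.1) = \prod_(x | x == i.1) h i.2 (w x).
    by rewrite big_pred1_eq.
  under eq_bigr do rewrite F.
  rewrite (exchange_big_dep xpredT)//=; apply: eq_bigr => x _.
  rewrite big_map big_filter; apply: eq_bigl => i.
  by rewrite /= eq_sym.
under eq_bigr do rewrite E.
rewrite -(bigA_distr_bigA (fun x d =>
  \prod_(j <- [seq i.2 | i <- l & i.1 == x]) h j d)).
by apply: prodr_ge0 => x _; exact: h_pos.
Qed.

End SitePositivity.

(** * Spins on the circle of N-th roots of unity *)

Section Spins.
Context {R : realType} {n : nat}.
Implicit Types k l : 'I_n.+1.

Definition spin_angle (k : nat) : R := 2 * pi * k%:R / n.+1%:R.
Definition spin_cos k : R := cos (spin_angle k).
Definition spin_sin k : R := sin (spin_angle k).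

(** Indices add modulo n.+1, angles without reduction. *)
Lemma spin_angleD k l : exists m : nat,
  spin_angle k + spin_angle l = spin_angle (k + l)%R + (pi *+ 2) *+ m.
Proof.
exists ((k + l) %/ n.+1)%N.
rewrite /spin_angle -mulrDl -mulrDr -natrD {1}(divn_eq (k + l) n.+1) /=.
rewrite natrD natrM -[(pi *+ 2) *+ _]mulr_natr -[pi *+ 2]mulr_natr.
by field; rewrite nat1r pnatr_eq0.
Qed.

Lemma spin_cosD k l :
  spin_cos (k + l) = spin_cos k * spin_cos l - spin_sin k * spin_sin l.
Proof.
have [m E] := spin_angleD k l.
by rewrite /spin_cos -cosD E (periodicn (@cosD2pi R)).
Qed.

Lemma spin_sinD k l :
  spin_sin (k + l) = spin_sin k * spin_cos l + spin_cos k * spin_sin l.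
Proof.
have [m E] := spin_angleD k l.
by rewrite /spin_sin -sinD E (periodicn (@sinD2pi R)).
Qed.

Lemma spin_cos0 : spin_cos 0 = 1.
Proof. by rewrite /spin_cos /spin_angle mulr0 mul0r cos0. Qed.

Lemma spin_sin0 : spin_sin 0 = 0.
Proof. by rewrite /spin_sin /spin_angle mulr0 mul0r sin0. Qed.

Lemma spin_cos2Dsin2 k : spin_cos k ^+ 2 + spin_sin k ^+ 2 = 1.
Proof. exact: cos2Dsin2. Qed.

(** The addition formulas determine the spin at [- k], which is thus obtained
    without computing the index of the opposite element. *)
Lemma spin_oppE k : spin_cos (- k) = spin_cos k /\ spin_sin (- k) = - spin_sin k.
Proof.
have := spin_cosD k (- k); have := spin_sinD k (- k).
rewrite subrr spin_cos0 spin_sin0; have := spin_cos2Dsin2 k.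
move: (spin_cos k) (spin_sin k) (spin_cos (- k)) (spin_sin (- k)).
move=> a b c d ab E1 E2; split.
  rewrite -[c]mul1r -ab.
  rewrite (_ : _ * c = a * (a * c - b * d) + b * (b * c + a * d)); last by ring.
  by rewrite -E1 -E2; ring.
rewrite -[d]mul1r -ab.
rewrite (_ : _ * d = a * (b * c + a * d) - b * (a * c - b * d)); last by ring.
by rewrite -E1 -E2; ring.
Qed.

Lemma spin_cosN k : spin_cos (- k) = spin_cos k.
Proof. by have [] := spin_oppE k. Qed.
Lemma spin_sinN k : spin_sin (- k) = - spin_sin k.
Proof. by have [] := spin_oppE k. Qed.

Lemma spin_cosB k l :
  spin_cos (k - l) = spin_cos k * spin_cos l + spin_sin k * spin_sin l.
Proof. by rewrite spin_cosD spin_cosN spin_sinN mulrN opprK. Qed.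

Lemma spin_sinB k l :
  spin_sin (k - l) = spin_sin k * spin_cos l - spin_cos k * spin_sin l.
Proof. by rewrite spin_sinD spin_cosN spin_sinN mulrN. Qed.

Lemma spin_cos_le1 k : `|spin_cos k| <= 1.
Proof. by rewrite ler_norml cos_geN1 cos_le1. Qed.

Lemma spin_sin_le1 k : `|spin_sin k| <= 1.
Proof. by rewrite ler_norml sin_geN1 sin_le1. Qed.

End Spins.

(** * Duplicated systems and Ginibre generators *)

Section Duplication.
Context {R : realType} {Om : finType} {I : Type}.
Variable gen : I -> Om * Om -> R.
Implicit Types (f g u : Om -> R) (b : bool).

(** Ginibre's duplication: the sum and the difference of two copies of [f] are
    positive multipliers. Positivity of differences survives products because
    f2 g2 - f1 g1 is half of (f2 + f1) (g2 - g1) + (f2 - f1) (g2 + g1). The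
    flag [b] is the sign with which the difference is taken, so that two
    functions are positively correlated when their flags agree and negatively
    otherwise. *)
Definition dup_pos b f : Prop :=
  pos_mult gen (fun p => f p.2 + f p.1) /\
  pos_mult gen (fun p => (-1) ^+ b * (f p.2 - f p.1)).

Lemma dup_posE b f g : f =1 g -> dup_pos b f -> dup_pos b g.
Proof. by move=> /funext ->. Qed.

Lemma dup_pos_cst b (c : R) : 0 <= c -> dup_pos b (fun=> c).
Proof.
move=> c0; split; first exact/pos_mult_cst/addr_ge0.
by apply: pos_multE (pos_mult_cst (lexx 0)) => p /=; rewrite subrr mulr0.
Qed.

Lemma dup_posD b f g : dup_pos b f -> dup_pos b g ->
  dup_pos b (fun w => f w + g w).
Proof.
move=> [f1 f2] [g1 g2]; split.
  by apply: pos_multE (pos_multD f1 g1) => p /=; ring.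
by apply: pos_multE (pos_multD f2 g2) => p /=; ring.
Qed.

Lemma dup_posM b f g : dup_pos b f -> dup_pos b g ->
  dup_pos b (fun w => f w * g w).
Proof.
move=> [f1 f2] [g1 g2].
have h : 0 <= (2^-1 : R) by rewrite invr_ge0.
split.
  apply: pos_multE (pos_multM (pos_mult_cst h)
    (pos_multD (pos_multM f1 g1) (pos_multM f2 g2))) => p /=.
  rewrite mulrACA -expr2 sqrr_sign.
  by field.
apply: pos_multE (pos_multM (pos_mult_cst h)
  (pos_multD (pos_multM f1 g2) (pos_multM f2 g1))) => p /=.
by field.
Qed.

Lemma dup_posX b f k : dup_pos b f -> dup_pos b (fun w => f w ^+ k).
Proof.
move=> fP; elim: k => [|k IH].
  by apply: dup_posE (dup_pos_cst b ler01) => w; rewrite expr0.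
by apply: dup_posE (dup_posM fP IH) => w; rewrite exprS.
Qed.

Lemma dup_posZ b (c : R) f : 0 <= c -> dup_pos b f ->
  dup_pos b (fun w => c * f w).
Proof. by move=> c0; apply: dup_posM; exact: dup_pos_cst. Qed.

Lemma dup_pos_sum b (J : Type) (s : seq J) (f : J -> Om -> R) :
  (forall j, dup_pos b (f j)) -> dup_pos b (fun w => \sum_(j <- s) f j w).
Proof.
move=> fP; elim: s => [|j s IH].
  by apply: dup_posE (dup_pos_cst b (lexx 0)) => w; rewrite big_nil.
by apply: dup_posE (dup_posD (fP j) IH) => w; rewrite big_cons.
Qed.

Lemma dup_pos_exp b f : dup_pos b f -> dup_pos b (fun w => expR (f w)).
Proof.
move=> fP.
have sP k : dup_pos b (fun w => series (exp_coeff (f w)) k).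
  apply: dup_posE (dup_pos_sum _ _) => [w|j]; first exact: erefl.
  by apply: dup_posM (dup_posX j fP) (dup_pos_cst _ _); rewrite invr_ge0.
have sE w : series (exp_coeff (f w)) k @[k --> \oo] --> expR (f w).
  exact: is_cvg_series_exp_coeff.
split.
  apply: (@pos_mult_lim _ _ _ _ (fun k p => series (exp_coeff (f p.2)) k +
    series (exp_coeff (f p.1)) k)) => [k|p]; first by have [] := sP k.
  exact: cvgD.
apply: (@pos_mult_lim _ _ _ _ (fun k p => (-1) ^+ b *
  (series (exp_coeff (f p.2)) k - series (exp_coeff (f p.1)) k))) => [k|p].
  by have [] := sP k.
by apply: cvgM; [exact: cvg_cst|exact: cvgB].
Qed.

Lemma sum_dup f g : \sum_(p : Om * Om) f p.1 * g p.2 =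
  (\sum_w f w) * (\sum_w g w).
Proof. by rewrite big_distrlr/= pair_bigA. Qed.

(** Two independent copies turn a covariance into the mean of a product of
    differences. *)
Lemma covariance_dup u f g :
  (\sum_w f w * g w * u w) * (\sum_w u w) -
  (\sum_w f w * u w) * (\sum_w g w * u w) =
  2^-1 * \sum_p (f p.2 - f p.1) * (g p.2 - g p.1) * (u p.1 * u p.2).
Proof.
under [X in _ = _ * X]eq_bigr => p _.
  rewrite (_ : _ * _ = u p.1 * (f p.2 * g p.2 * u p.2)
    + (f p.1 * g p.1 * u p.1) * u p.2
    - ((f p.1 * u p.1) * (g p.2 * u p.2) + (g p.1 * u p.1) * (f p.2 * u p.2)));
    last by ring.
  over.
rewrite sumrB !big_split/= (sum_dup u (fun w => f w * g w * u w))
  (sum_dup (fun w => f w * g w * u w) u)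
  (sum_dup (fun w => f w * u w) (fun w => g w * u w))
  (sum_dup (fun w => g w * u w) (fun w => f w * u w)).
by field.
Qed.

Lemma dup_pos_covariance b1 b2 u f g : monomial_pos gen (fun=> 1) ->
  pos_mult gen (fun p => u p.1 * u p.2) -> dup_pos b1 f -> dup_pos b2 g ->
  0 <= (-1) ^+ b1 * (-1) ^+ b2 * ((\sum_w f w * g w * u w) * (\sum_w u w) -
    (\sum_w f w * u w) * (\sum_w g w * u w)).
Proof.
move=> base uP [_ fP] [_ gP]; rewrite covariance_dup mulrCA.
apply: mulr_ge0; first by rewrite invr_ge0.
rewrite mulr_sumr; apply: le_trans (pos_mult_ge0 base
  (pos_multM (pos_multM fP gP) uP)) _.
by apply: ler_sum => p _; rewrite le_eqVlt -!mulrA; apply/orP; left; apply/eqP; ring.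
Qed.

End Duplication.

Lemma both_inj (T U : Type) (f : T -> U) : injective f ->
  injective (fun p : T * T => (f p.1, f p.2)).
Proof.
move=> f_inj [x1 x2] [y1 y2] /= E.
by have /f_inj -> := congr1 fst E; have /f_inj -> := congr1 snd E.
Qed.

Section GinibreGenerators.
Context {R : realType} {W : finType} {n : nat}.
Notation cfg := {ffun W -> 'I_n.+1}.

Definition bond_cos (e : W * W) (w : cfg) : R := spin_cos (n := n) (w e.1 - w e.2).

(** The two copies enter through the sum and the difference of their cosines,
    the latter with the sign of cos (A - B) - cos (A + B) = 2 sin A sin B. *)
Definition ginibre_gen (i : (W * W) * bool) (p : cfg * cfg) : R :=
  (-1) ^+ i.2 * (bond_cos i.1 p.2 + (-1) ^+ i.2 * bond_cos i.1 p.1).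

(** Ginibre's change of variables (p1, p2) |-> (p1 - p2, p1 + p2) writes each
    generator as twice the product of one and the same function at p1 and at
    p2, so that the sum of a product of generators is a square. It is a
    bijection when doubling is injective, that is when the order of the clock
    is odd. *)
Lemma ginibre_gen_pos : injective (fun k : 'I_n.+1 => k + k) ->
  monomial_pos ginibre_gen (fun=> 1).
Proof.
move=> dbl_inj l.
have phi_inj : injective (fun p : cfg * cfg => (p.1 - p.2, p.1 + p.2)).
  move=> [a1 a2] [b1 b2] /= [] /ffunP E1 /ffunP E2.
  have E x : a1 x = b1 x.
    apply: dbl_inj; have := E1 x; have := E2 x; rewrite !ffunE => F2 F1.
    by rewrite -{1}(subrK (a2 x) (a1 x)) F1 -addrA [a2 x + _]addrC F2 addrA addrAC subrK.
  congr pair; apply/ffunP => x; first exact: E.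
  by have := E2 x; rewrite !ffunE E => /addrI.
rewrite (reindex_inj phi_inj)/=.
pose F (i : (W * W) * bool) (w : cfg) : R :=
  if i.2 then spin_sin (n := n) (w i.1.1 - w i.1.2)
  else spin_cos (n := n) (w i.1.1 - w i.1.2).
have E i p : ginibre_gen i (p.1 - p.2, p.1 + p.2) = 2 * F i p.1 * F i p.2.
  rewrite /ginibre_gen /bond_cos /F /= !ffunE.
  rewrite (_ : p.1 i.1.1 + _ - _ =
    (p.1 i.1.1 - p.1 i.1.2) + (p.2 i.1.1 - p.2 i.1.2)); last first.
    by rewrite opprD addrACA.
  rewrite (_ : p.1 i.1.1 - _ - _ =
    (p.1 i.1.1 - p.1 i.1.2) - (p.2 i.1.1 - p.2 i.1.2)); last first.
    by rewrite !opprD opprK addrACA.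
  move: (p.1 i.1.1 - p.1 i.1.2) (p.2 i.1.1 - p.2 i.1.2) => A B.
  by case: i.2 => /=; rewrite ?expr1 ?expr0 spin_cosD spin_cosB; ring.
under eq_bigr => p _.
  rewrite mul1r (eq_bigr _ (fun i _ => E i p)) big_split/=. over.
rewrite /= -[X in 0 <= X]/(\sum_p (fun w => \prod_(i <- l) (2 * F i w)) p.1 *
  (fun w => \prod_(i <- l) F i w) p.2) sum_dup.
under eq_bigr do rewrite big_split/=.
rewrite -mulr_sumr -mulrA -expr2 mulr_ge0 ?sqr_ge0//.
by apply: prodr_ge0.
Qed.

End GinibreGenerators.

Section ComponentGenerators.
Context {R : realType} {W : finType} {n : nat}.
Notation cfg := {ffun W -> 'I_n.+1}.
(* A quarter turn, present when the order is divisible by four. *)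
Variable q : 'I_n.+1.
Hypothesis q_cos : spin_cos (R := R) (n := n) q = 0.
Hypothesis q_sin : spin_sin (R := R) (n := n) q = 1.

Definition component (b : bool) (k : 'I_n.+1) : R :=
  if b then spin_sin (n := n) k else spin_cos (n := n) k.

(** The reflection of the circle in its vertical axis. *)
Lemma half_turn k : spin_cos (R := R) (n := n) (q + q - k) = - spin_cos (n := n) k /\
  spin_sin (R := R) (n := n) (q + q - k) = spin_sin (n := n) k.
Proof.
rewrite spin_cosB spin_sinB spin_cosD spin_sinD q_cos q_sin.
by split; ring.
Qed.

(** Each of the two reflections of the circle changes the sign of one
    component, so only moments with even exponents survive, and these are
    nonnegative. *)
Lemma component_sum_pos (l : seq bool) :
  0 <= \sum_k \prod_(b <- l) component b k.
Proof.
have E k : \prod_(b <- l) component b k =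
    spin_cos (n := n) k ^+ count_mem false l * spin_sin (n := n) k ^+ count_mem true l.
  elim: l => [|[] l IH]; rewrite ?big_nil ?big_cons/= ?mul1r//.
  - by rewrite IH add0n add1n exprS; ring.
  - by rewrite IH add0n add1n exprS; ring.
under eq_bigr do rewrite E.
(* The sum over [k] only depends on the numbers of cosines and of sines. *)
move: (count_mem false l) (count_mem true l) E => c s _.
have zero (x : R) : x = - x -> 0 <= x by move=> h; lra.
case: (boolP (odd s)) => s_odd.
  apply: zero; rewrite [LHS](reindex_inj (@oppr_inj _)) -sumrN.
  apply: eq_bigr => k _.
  by rewrite spin_cosN spin_sinN exprNn -signr_odd s_odd expr1; ring.
case: (boolP (odd c)) => c_odd.
  apply: zero; rewrite [LHS](reindex_inj (@subrI _ (q + q))) -sumrN.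
  apply: eq_bigr => k _; have [-> ->] := half_turn k.
  by rewrite exprNn -signr_odd c_odd expr1; ring.
by apply: sumr_ge0 => k _; apply: mulr_ge0; apply: exprn_even_ge0.
Qed.

(** The sign makes the difference of two copies positive for cosines and
    negative for sines: a field that favors one axis favors it at the expense
    of the other. *)
Definition component_pair (j : bool * bool) (p : 'I_n.+1 * 'I_n.+1) : R :=
  (-1) ^+ (j.1 && j.2) * (component j.1 p.2 + (-1) ^+ j.2 * component j.1 p.1).

(** The two reflections and the exchange of the copies make a moment vanish
    unless its four exponents have the same parity. When they are all odd, the
    factor that is not a square is (C y^2 - C x^2) (S x^2 - S y^2), which is
    one after all because C^2 + S^2 = 1. *)
Lemma component_pair_sum_pos (l : seq (bool * bool)) :
  0 <= \sum_p \prod_(j <- l) component_pair j p.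
Proof.
pose C k := spin_cos (R := R) (n := n) k.
pose S k := spin_sin (R := R) (n := n) k.
have E p : \prod_(j <- l) component_pair j p =
    (C p.2 + C p.1) ^+ count_mem (false, false) l *
    (C p.2 - C p.1) ^+ count_mem (false, true) l *
    ((S p.2 + S p.1) ^+ count_mem (true, false) l *
     (S p.1 - S p.2) ^+ count_mem (true, true) l).
  elim: l => [|[[] []] l IH];
    rewrite ?big_nil ?big_cons/= ?mul1r// IH /component_pair /component /=;
    by rewrite /C /S ?add0n ?add1n ?expr1 ?expr0 ?[_ ^+ _.+1]exprS; ring.
under eq_bigr do rewrite E.
move: (count_mem (false, false) l) (count_mem (false, true) l)
  (count_mem (true, false) l) (count_mem (true, true) l) E => a b c d _.
have zero (x : R) : x = - x -> 0 <= x by move=> h; lra.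
have flip (u v : R) i j : odd (i + j) ->
    (- u) ^+ i * (- v) ^+ j = - (u ^+ i * v ^+ j).
  move=> ij; rewrite [(- u) ^+ _]exprNn [(- v) ^+ _]exprNn mulrACA -exprD.
  by rewrite -signr_odd ij expr1 mulN1r.
case: (boolP (odd (c + d))) => cd.
  apply: zero; rewrite [LHS](reindex_inj
    (h := fun p : 'I_n.+1 * 'I_n.+1 => (- p.1, - p.2))); last first.
    exact: (both_inj (@oppr_inj _)).
  rewrite -sumrN; apply: eq_bigr => -[x y] _ /=.
  rewrite /C /S !spin_cosN !spin_sinN -!opprD.
  by rewrite flip// mulrN.
case: (boolP (odd (a + b))) => ab.
  apply: zero; rewrite [LHS](reindex_inj
    (h := fun p : 'I_n.+1 * 'I_n.+1 => (q + q - p.1, q + q - p.2))); last first.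
    exact: (both_inj (@subrI _ (q + q))).
  rewrite -sumrN; apply: eq_bigr => -[x y] _ /=; rewrite /C /S.
  have [-> ->] := half_turn x; have [-> ->] := half_turn y.
  by rewrite -!opprD flip// mulNr.
case: (boolP (odd (b + d))) => bd.
  apply: zero; rewrite [LHS](reindex_inj
    (h := fun p : 'I_n.+1 * 'I_n.+1 => (p.2, p.1))); last first.
    by move=> [x1 x2] [y1 y2] [] -> ->.
  rewrite -sumrN; apply: eq_bigr => -[x y] _ /=.
  rewrite [C x + C y]addrC [S x + S y]addrC -[C x - C y]opprB -[S y - S x]opprB.
  by rewrite mulrACA flip// mulrN mulrACA.
apply: sumr_ge0 => -[x y] _ /=.
have ev (z : R) k : z ^+ k = z ^+ odd k * (z ^+ k./2) ^+ 2.
  by rewrite -exprM -exprD muln2 odd_double_half.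
rewrite (ev _ a) (ev _ b) (ev _ c) (ev _ d).
have [-> [-> ->]] : odd a = odd b /\ odd c = odd b /\ odd d = odd b.
  by move: cd ab bd; rewrite !oddD; case: (odd a); case: (odd b); case: (odd c); case: (odd d).
case: (odd b); rewrite ?expr1 ?expr0.
  have e : C x ^+ 2 - C y ^+ 2 = S y ^+ 2 - S x ^+ 2.
    by have := spin_cos2Dsin2 (R := R) (n := n) x; have := spin_cos2Dsin2 (R := R) (n := n) y; rewrite -/(C x) -/(C y) -/(S x) -/(S y); lra.
  move: (_ ^+ a./2) (_ ^+ b./2) (_ ^+ c./2) (_ ^+ d./2) => A B C' D.
  rewrite (_ : _ * _ = ((C x ^+ 2 - C y ^+ 2) * A * B * C' * D) ^+ 2) ?sqr_ge0//.
  rewrite [RHS]expr2 {2}e; ring.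
by rewrite !mul1r; apply: mulr_ge0; apply: mulr_ge0; exact: sqr_ge0.
Qed.

End ComponentGenerators.

(** * Convexity of a tilted mean *)

Section Calculus.
Context {R : realType}.
Implicit Types (f df : R -> R) (a b : R).

Lemma is_derive_bigsum (J : Type) (s : seq J) (h : J -> R -> R) (dh : J -> R) (x : R) :
  (forall j, is_derive x 1 (h j) (dh j)) ->
  is_derive x 1 (fun y => \sum_(j <- s) h j y) (\sum_(j <- s) dh j).
Proof.
move=> hP; elim: s => [|j s IH].
  rewrite big_nil (_ : (fun _ => _) = cst 0); first exact: is_derive_cst.
  by apply/funext => y; rewrite big_nil.
rewrite big_cons (_ : (fun _ => _) = h j + (fun y => \sum_(j <- s) h j y)).
  exact: is_deriveD.
by apply/funext => y; rewrite big_cons.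
Qed.

Lemma derive_mean_value f df a b : (forall x : R, is_derive x 1 f (df x)) ->
  a <= b -> exists2 c, a <= c <= b & f b - f a = df c * (b - a).
Proof.
move=> fP ab; have [|c] := MVT_segment (f := f) (df := df) ab (fun x _ => fP x).
  apply: derivable_within_continuous => x _.
  by have [] := fP x.
by rewrite in_itv/= => ? ?; exists c.
Qed.

Lemma derive_nondecreasing f df a b : (forall x : R, is_derive x 1 f (df x)) ->
  (forall x, a <= x <= b -> 0 <= df x) -> a <= b -> f a <= f b.
Proof.
move=> fP df0 ab; have [c cab E] := derive_mean_value fP ab.
by rewrite -subr_ge0 E mulr_ge0 ?subr_ge0// df0.
Qed.

Lemma cos_lipschitz a b : `|cos a - cos b| <= `|a - b|.
Proof.
wlog ba : a b / b <= a => [hw|].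
  have [/hw//|/ltW/hw] := leP b a.
  by rewrite distrC [`|b - a|]distrC.
have [c _ ->] := derive_mean_value (f := cos) (df := fun x => - sin x) (@is_derive_cos R) ba.
by rewrite normrM normrN ler_piMl// ler_norml sin_geN1 sin_le1.
Qed.

Lemma cos_ge_half a : 0 <= a <= 2^-1 -> 2^-1 <= cos a.
Proof.
move=> /andP[a0 a1]; have := cos_lipschitz a 0.
by rewrite cos0 subr0 (ger0_norm a0) ler_norml => /andP[]; lra.
Qed.

Lemma sin_ge_half a : 0 <= a <= 2^-1 -> a / 2 <= sin a.
Proof.
move=> /andP[a0 a1].
have [c /andP[c0 ca]] := derive_mean_value (@is_derive_sin R) a0.
rewrite sin0 !subr0 => ->; rewrite mulrC ler_wpM2r// cos_ge_half// c0/=.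
exact: le_trans ca a1.
Qed.

Lemma expR_quadratic a : `|a| <= 2^-1 -> 0 <= expR a - 1 - a <= 2 * a ^+ 2.
Proof.
rewrite ler_norml => /andP[a1 a2]; apply/andP; split.
  by have := expR_ge1Dx a; lra.
have h := expR_ge1Dx (- a); have e := expRxMexpNx_1 a.
have p := expR_gt0 a.
have h1 : expR a * (1 - a) <= 1 by rewrite -[leRHS]e ler_wpM2l// ltW.
nra.
Qed.

End Calculus.

Section Tilting.
Context {R : realType} {Om : finType}.
Variables (c u : Om -> R) (w0 : Om).
Hypothesis u_gt0 : forall w, 0 < u w.
Hypothesis c_le1 : forall w, c w <= 1.

(** The parameter [k] is the coupling of a bond with cosine [c]; the weight
    [u] collects the other bonds. *)
Definition tilted_sum (f : Om -> R) (k : R) : R :=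
  \sum_w f w * (u w * expR (k * c w)).

Lemma is_derive_tilted_sum f (k : R) :
  is_derive k 1 (tilted_sum f) (tilted_sum (fun w => f w * c w) k).
Proof.
apply: is_derive_bigsum => w.
have e : is_derive k 1 (fun y : R => y * c w) (c w).
  rewrite (_ : (fun _ => _) = (fun y : R => y) * cst (c w))//.
  apply: is_derive_eq.
  by rewrite /= scaler0 add0r /GRing.scale/= mulr1.
rewrite (_ : (fun y => _) = cst (f w * u w) * (expR \o (fun y : R => y * c w))).
  apply: is_derive_eq.
  by rewrite /= scaler0 addr0 /GRing.scale/=; ring.
by apply/funext => y /=; rewrite mulrA.
Qed.

Lemma tilted_sum1_gt0 k : 0 < tilted_sum (fun=> 1) k.
Proof.
rewrite /tilted_sum (bigD1 w0)//= mul1r; apply: ltr_pwDl.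
  by rewrite mulr_gt0// expR_gt0.
by apply: sumr_ge0 => w _; rewrite mul1r mulr_ge0// ?expR_ge0// ltW.
Qed.

Definition tilted_mean (f : Om -> R) k := tilted_sum f k / tilted_sum (fun=> 1) k.

Definition tilted_cov (f g : Om -> R) (k : R) : R :=
  tilted_sum (fun w => f w * g w) k * tilted_sum (fun=> 1) k -
  tilted_sum f k * tilted_sum g k.

Lemma is_derive_tilted_mean f (k : R) : is_derive k 1 (tilted_mean f)
  (tilted_cov f c k / tilted_sum (fun=> 1) k ^+ 2).
Proof.
have z0 : tilted_sum (fun=> 1) k != 0 by rewrite gt_eqF// tilted_sum1_gt0.
have df := is_derive_tilted_sum f k; have dz := is_derive_tilted_sum (fun=> 1) k.
have dv := is_deriveV z0 dz.
apply: (is_derive_eq (is_deriveM df dv)).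
rewrite /tilted_cov /GRing.scale/=.
have -> : tilted_sum (fun w => 1 * c w) k = tilted_sum c k.
  by apply: eq_bigr => w _; rewrite mul1r.
by field.
Qed.

(** Up to the factor - 1 / 2, the derivative of the tilted mean with respect
    to exp (- 2 k). *)
Definition scaled_slope f k : R :=
  expR (k *+ 2) * (tilted_cov f c k / tilted_sum (fun=> 1) k ^+ 2).

(** The factor exp (2 k) is what completes - 2 <c> <f; c>, which comes from
    the derivative of the covariance, to 2 (1 - <c>) <f; c>: only covariances
    with nonnegative coefficients remain when c <= 1. *)
Lemma is_derive_scaled_slope f (k : R) : is_derive k 1 (scaled_slope f)
  (expR (k *+ 2) / tilted_sum (fun=> 1) k ^+ 2 *
   (tilted_cov f (fun w => c w ^+ 2) k +
    2 * tilted_cov f c k * (1 - tilted_mean c k))).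
Proof.
have z0 : tilted_sum (fun=> 1) k != 0 by rewrite gt_eqF// tilted_sum1_gt0.
have z20 : tilted_sum (fun=> 1) k ^+ 2 != 0 by rewrite expf_neq0.
have dz := is_derive_tilted_sum (fun=> 1) k.
have d1 := is_derive_tilted_sum (fun w => f w * c w) k.
have d2 := is_derive_tilted_sum f k.
have d3 := is_derive_tilted_sum c k.
have dN := is_deriveB (is_deriveM d1 dz) (is_deriveM d2 d3).
have dz2 : is_derive k 1 (fun y => tilted_sum (fun=> 1) y ^+ 2)
   (2 * tilted_sum (fun=> 1) k * tilted_sum (fun w => 1 * c w) k).
  rewrite (_ : (fun y => _) = tilted_sum (fun=> 1) * tilted_sum (fun=> 1)).
    by apply: (is_derive_eq (is_deriveM dz dz)); rewrite /GRing.scale/=; ring.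
  by apply/funext => y; rewrite expr2.
have dv := is_deriveV (f := fun y => tilted_sum (fun=> 1) y ^+ 2) z20 dz2.
have de : is_derive k 1 (fun y : R => expR (y *+ 2)) (2 * expR (k *+ 2)).
  rewrite (_ : (fun y => _) = expR \o ((fun y : R => y) + (fun y : R => y))).
    apply: is_derive_eq.
    by rewrite /= mulr2n; ring.
  by apply/funext => y /=; rewrite mulr2n.
apply: (is_derive_eq (is_deriveM de (is_deriveM dN dv))).
have -> : tilted_sum (fun w => 1 * c w) k = tilted_sum c k.
  by apply: eq_bigr => w _; rewrite mul1r.
rewrite /tilted_mean /tilted_cov !fctE /GRing.scale/=.
have -> : tilted_sum (fun w => f w * c w * c w) k =
          tilted_sum (fun w => f w * c w ^+ 2) k.
  by apply: eq_bigr => w _; ring.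
have -> : tilted_sum (fun w => c w * c w) k =
          tilted_sum (fun w => c w ^+ 2) k.
  by apply: eq_bigr => w _; ring.
by field.
Qed.

Lemma tilted_mean_le1 k : tilted_mean c k <= 1.
Proof.
rewrite ler_pdivrMr ?tilted_sum1_gt0// mul1r; apply: ler_sum => w _.
by rewrite ler_pM2r// mulr_gt0// expR_gt0.
Qed.

Variable f : Om -> R.
Hypothesis cov1 : forall k : R, 0 <= k -> 0 <= tilted_cov f c k.
Hypothesis cov2 : forall k : R, 0 <= k -> 0 <= tilted_cov f (fun w => c w ^+ 2) k.

Lemma scaled_slope_nondecreasing (a b : R) : 0 <= a -> a <= b ->
  scaled_slope f a <= scaled_slope f b.
Proof.
move=> a0 ab; apply: (derive_nondecreasing (is_derive_scaled_slope f)) ab.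
move=> x /andP[ax _]; have x0 := le_trans a0 ax.
apply: mulr_ge0; first by rewrite divr_ge0 ?expR_ge0// sqr_ge0.
apply: addr_ge0; first exact: cov2.
rewrite mulr_ge0// ?subr_ge0 ?tilted_mean_le1//.
by rewrite mulr_ge0// cov1.
Qed.

(** In the variable exp (- 2 k) the mean is convex and lies above its
    tangents. *)
Lemma tilted_mean_tangent (a b : R) : 0 <= a -> 0 <= b ->
  tilted_mean f b + scaled_slope f b * (expR (- b *+ 2) - expR (- a *+ 2)) / 2
  <= tilted_mean f a.
Proof.
move=> a0 b0; rewrite -subr_ge0.
pose F y := tilted_mean f y + scaled_slope f b * expR (- y *+ 2) / 2.
have dF (y : R) : is_derive y 1 F (expR (- y *+ 2) * (scaled_slope f y - scaled_slope f b)).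
  have de : is_derive y (1 : R) (fun y : R => expR (- y *+ 2)) (- 2 * expR (- y *+ 2)).
    rewrite (_ : (fun y => _) = expR \o (- (fun y : R => y) + - (fun y : R => y))).
      apply: is_derive_eq.
      by rewrite /= mulr2n; ring.
    by apply/funext => z /=; rewrite mulr2n.
  rewrite (_ : F = tilted_mean f + cst (scaled_slope f b / 2) * (fun y : R => expR (- y *+ 2))).
    apply: is_derive_eq.
      by apply: is_deriveD (is_derive_tilted_mean f y) (is_deriveM _ de).
    rewrite /= scaler0 addr0 /GRing.scale/=.
    have -> : tilted_cov f c y / tilted_sum (fun=> 1) y ^+ 2 =
              expR (- y *+ 2) * scaled_slope f y.
      by rewrite /scaled_slope mulrA -expRD -mulrnDl addNr mul0rn expR0 mul1r.
    by field.
  by apply/funext => z /=; rewrite /F mulrAC.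
(* Up to a constant [F] is the gap to the tangent; its derivative at y has the
   sign of y - b. *)
suff : F b <= F a by rewrite /F; lra.
have [ab|/ltW ba] := leP a b.
  have [x /andP[ax xb] E] := derive_mean_value dF ab.
  rewrite -subr_le0 E mulr_le0_ge0 ?subr_ge0// mulr_ge0_le0 ?expR_ge0//.
  by rewrite subr_le0 scaled_slope_nondecreasing// (le_trans a0).
have [x /andP[bx xa] E] := derive_mean_value dF ba.
rewrite -subr_ge0 E mulr_ge0 ?subr_ge0// mulr_ge0 ?expR_ge0//.
by rewrite subr_ge0 scaled_slope_nondecreasing.
Qed.

(** Average the tangent at [b]; its slope in exp (- 2 k) is nonpositive, which
    is why an inequality between the exponential moments is enough. *)
Lemma tilted_mean_jensen (J : finType) (p a : J -> R) (b : R) :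
  (forall j, 0 <= p j) -> \sum_j p j = 1 -> (forall j, 0 <= a j) -> 0 <= b ->
  \sum_j p j * expR (- a j *+ 2) <= expR (- b *+ 2) ->
  tilted_mean f b <= \sum_j p j * tilted_mean f (a j).
Proof.
move=> p0 p1 a0 b0 pb.
apply: le_trans (_ : \sum_j p j * (tilted_mean f b + scaled_slope f b *
   (expR (- b *+ 2) - expR (- a j *+ 2)) / 2) <= _); last first.
  by apply: ler_sum => j _; apply: ler_wpM2l => //; exact: tilted_mean_tangent.
rewrite (_ : \sum_j _ = tilted_mean f b * \sum_j p j + scaled_slope f b / 2 *
  (expR (- b *+ 2) * \sum_j p j - \sum_j p j * expR (- a j *+ 2))); last first.
  rewrite !mulr_sumr -sumrB mulr_sumr -big_split/=.
  by apply: eq_bigr => j _; ring.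
rewrite p1 !mulr1 lerDl mulr_ge0 ?subr_ge0// divr_ge0//.
by rewrite mulr_ge0 ?expR_ge0// divr_ge0 ?sqr_ge0// cov1.
Qed.

End Tilting.

(** * Gibbs means on a finite set and the clock model *)

Section GibbsMean.
Context {R : realType} {Om : finType}.
Variable w0 : Om.
Implicit Types (H f g : Om -> R).

Definition gibbs_mean H f : R :=
  (\sum_w f w * expR (H w)) / \sum_w expR (H w).

Lemma gibbs_sum_gt0 H : 0 < \sum_w expR (H w).
Proof.
rewrite (bigD1 w0)//= ltr_pwDl ?expR_gt0//.
by apply: sumr_ge0 => w _; exact: expR_ge0.
Qed.

Lemma gibbs_sum_neq0 H : \sum_w expR (H w) != 0.
Proof. by rewrite gt_eqF// gibbs_sum_gt0. Qed.

Lemma eq_gibbs_mean H H' f f' : H =1 H' -> f =1 f' ->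
  gibbs_mean H f = gibbs_mean H' f'.
Proof. by move=> /funext -> /funext ->. Qed.

Lemma gibbs_meanD H f g :
  gibbs_mean H (fun w => f w + g w) = gibbs_mean H f + gibbs_mean H g.
Proof.
rewrite -mulrDl -big_split/=; congr (_ / _).
by apply: eq_bigr => w _; rewrite mulrDl.
Qed.

Lemma gibbs_meanZ H a f :
  gibbs_mean H (fun w => a * f w) = a * gibbs_mean H f.
Proof.
rewrite [RHS]mulrA mulr_sumr; congr (_ / _).
by apply: eq_bigr => w _; rewrite mulrA.
Qed.

Lemma gibbs_meanB H f g :
  gibbs_mean H (fun w => f w - g w) = gibbs_mean H f - gibbs_mean H g.
Proof.
rewrite -[- gibbs_mean _ _]mulN1r -gibbs_meanZ -gibbs_meanD.
by apply: eq_gibbs_mean => // w; rewrite mulN1r.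
Qed.

Lemma gibbs_mean_sum H (J : Type) (s : seq J) (F : J -> Om -> R) :
  gibbs_mean H (fun w => \sum_(j <- s) F j w) =
  \sum_(j <- s) gibbs_mean H (F j).
Proof.
elim: s => [|j s IH].
  rewrite big_nil /gibbs_mean big1 ?mul0r// => w _.
  by rewrite big_nil mul0r.
rewrite big_cons -IH -gibbs_meanD.
by apply: eq_gibbs_mean => // w; rewrite big_cons.
Qed.

Lemma gibbs_mean_cst H a : gibbs_mean H (fun=> a) = a.
Proof. by rewrite /gibbs_mean -mulr_sumr mulfK// gibbs_sum_neq0. Qed.

Lemma le_gibbs_mean H f g : (forall w, f w <= g w) ->
  gibbs_mean H f <= gibbs_mean H g.
Proof.
move=> fg; rewrite ler_pM2r ?invr_gt0 ?gibbs_sum_gt0//.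
by apply: ler_sum => w _; rewrite ler_pM2r ?expR_gt0.
Qed.

Lemma gibbs_mean_norm_le H f a : (forall w, `|f w| <= a) ->
  `|gibbs_mean H f| <= a.
Proof.
move=> fa; rewrite ler_norml -{1}(gibbs_mean_cst H (- a)) -{2}(gibbs_mean_cst H a).
by apply/andP; split; apply: le_gibbs_mean => w; have := fa w; rewrite ler_norml => /andP[].
Qed.

Lemma gibbs_mean_reindex H f (h : Om -> Om) : injective h ->
  gibbs_mean H f = gibbs_mean (H \o h) (f \o h).
Proof.
by move=> h_inj; rewrite /gibbs_mean (reindex_inj h_inj)/=
   [X in _ / X](reindex_inj h_inj).
Qed.

Section DupGibbs.
Context {I : Type} (gen : I -> Om * Om -> R).
Hypothesis base : monomial_pos gen (fun=> 1).
Variable H : Om -> R.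
Hypothesis weight : pos_mult gen (fun p => H p.1 + H p.2).

Let weightE : pos_mult gen (fun p => expR (H p.1) * expR (H p.2)).
Proof. by apply: pos_multE (pos_mult_exp weight) => p; rewrite expRD. Qed.

Lemma gibbs_mean_ge0 b f : dup_pos gen b f -> 0 <= gibbs_mean H f.
Proof.
move=> [fP _]; rewrite divr_ge0 ?(ltW (gibbs_sum_gt0 H))//.
have := pos_mult_ge0 base (pos_multM fP weightE).
under eq_bigr => p _.
  rewrite (_ : _ * _ = expR (H p.1) * (f p.2 * expR (H p.2)) +
    (f p.1 * expR (H p.1)) * expR (H p.2)); last by ring.
  over.
rewrite big_split/= (sum_dup (fun w => expR (H w)) (fun w => f w * expR (H w)))
  (sum_dup (fun w => f w * expR (H w)) (fun w => expR (H w))).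
by rewrite [X in X + _]mulrC -mulr2n pmulrn_lge0// pmulr_lge0// gibbs_sum_gt0.
Qed.

Lemma gibbs_covariance b1 b2 f g : dup_pos gen b1 f -> dup_pos gen b2 g ->
  0 <= (-1) ^+ b1 * (-1) ^+ b2 *
    (gibbs_mean H (fun w => f w * g w) - gibbs_mean H f * gibbs_mean H g).
Proof.
move=> fP gP; have := dup_pos_covariance (u := fun w => expR (H w)) base weightE fP gP.
set s := (-1) ^+ b1 * (-1) ^+ b2; rewrite /gibbs_mean.
have := gibbs_sum_gt0 H; set Z := \sum_w expR (H w) => Z0 h.
rewrite (_ : s * _ = (s * ((\sum_w f w * g w * expR (H w)) * Z -
   (\sum_w f w * expR (H w)) * (\sum_w g w * expR (H w)))) / Z ^+ 2).
  by rewrite divr_ge0// sqr_ge0.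
by field; rewrite gt_eqF.
Qed.

(** The difference has the sign of the covariance of [f] and exp [Hd]. *)
Lemma gibbs_mean_tilt b f Hd : dup_pos gen b f -> dup_pos gen b Hd ->
  gibbs_mean H f <= gibbs_mean (fun w => H w + Hd w) f.
Proof.
move=> fP dP; have := dup_pos_covariance (u := fun w => expR (H w)) base weightE fP (dup_pos_exp dP).
rewrite -expr2 sqrr_sign mul1r subr_ge0 => h.
rewrite /gibbs_mean.
have E (g : Om -> R) : \sum_w g w * expR (H w + Hd w) =
    \sum_w g w * expR (Hd w) * expR (H w).
  by apply: eq_bigr => w _; rewrite expRD; ring.
rewrite E.
have -> : \sum_w expR (H w + Hd w) = \sum_w expR (Hd w) * expR (H w).
  by apply: eq_bigr => w _; rewrite expRD mulrC.
rewrite ler_pdivrMr ?gibbs_sum_gt0// mulrAC ler_pdivlMr//.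
rewrite (bigD1 w0)//= ltr_pwDl ?mulr_gt0 ?expR_gt0//.
by apply: sumr_ge0 => w _; rewrite mulr_ge0 ?expR_ge0.
Qed.

End DupGibbs.
End GibbsMean.

Section ClockModel.
Context {R : realType} {W : finType} {n : nat}.
Notation cfg := {ffun W -> 'I_n.+1}.
Notation bcos := (@bond_cos R W n).
Implicit Types (l : seq ((W * W) * R)) (e : W * W) (w : cfg).

(** Couplings are attached to a list of bonds in which repetitions are
    allowed: adding couplings is concatenation. *)
Definition clock_energy l w : R := \sum_(i <- l) i.2 * bcos i.1 w.

Definition clock_corr l e : R := gibbs_mean (clock_energy l) (bcos e).

Definition nonneg_couplings l := forall i, i \in l -> 0 <= i.2.

Lemma clock_energy_cat l l' w :
  clock_energy (l ++ l') w = clock_energy l w + clock_energy l' w.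
Proof. exact: big_cat. Qed.

Lemma clock_energy_cons i l w :
  clock_energy (i :: l) w = i.2 * bcos i.1 w + clock_energy l w.
Proof. exact: big_cons. Qed.

Lemma nonneg_couplings_cons i l : nonneg_couplings (i :: l) ->
  0 <= i.2 /\ nonneg_couplings l.
Proof.
move=> h; split; first by apply: h; rewrite mem_head.
by move=> j jl; apply: h; rewrite inE jl orbT.
Qed.

Lemma clock_energy_ind (P : (cfg -> R) -> Prop) l :
  (forall f, P f -> forall e K, 0 <= K -> P (fun w => K * bcos e w + f w)) ->
  P (fun=> 0) -> nonneg_couplings l -> P (clock_energy l).
Proof.
move=> step P0; elim: l => [_|i l IH /nonneg_couplings_cons[i0 /IH hl]].
  rewrite (_ : clock_energy [::] = fun=> 0)//.
  by apply/funext => w; exact: big_nil.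
rewrite (_ : clock_energy (i :: l) = fun w => i.2 * bcos i.1 w + clock_energy l w).
  exact: step.
by apply/funext => w; exact: clock_energy_cons.
Qed.

Let w0 : cfg := [ffun=> ord0].

Lemma bond_cos_le1 e w : `|bcos e w| <= 1.
Proof. exact: spin_cos_le1. Qed.

Lemma bond_cosC e w : bcos (e.2, e.1) w = bcos e w.
Proof. by rewrite /bond_cos /= -spin_cosN opprB. Qed.

Lemma clock_corr_norm_le1 l e : `|clock_corr l e| <= 1.
Proof. exact: (gibbs_mean_norm_le w0 _ (bond_cos_le1 e)). Qed.

Lemma eq_clock_corr l l' e : clock_energy l =1 clock_energy l' ->
  clock_corr l e = clock_corr l' e.
Proof. by move=> E; exact: eq_gibbs_mean. Qed.

Section Ginibre.
Hypothesis odd_order : injective (fun k : 'I_n.+1 => k + k).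
Let base : monomial_pos (@ginibre_gen R W n) (fun=> 1) := ginibre_gen_pos odd_order.

Lemma dup_pos_bond_cos e : dup_pos (@ginibre_gen R W n) true (bcos e).
Proof.
split.
  apply: pos_multE (@pos_mult_gen _ _ _ (@ginibre_gen R W n) (e, false)) => p.
  by rewrite /ginibre_gen /= expr0 !mul1r.
apply: pos_multE (@pos_mult_gen _ _ _ (@ginibre_gen R W n) (e, true)) => p.
by rewrite /ginibre_gen /= expr1; ring.
Qed.

Lemma dup_pos_clock_energy l : nonneg_couplings l ->
  dup_pos (@ginibre_gen R W n) true (clock_energy l).
Proof.
apply: clock_energy_ind => [f fP e K K0|]; last exact: dup_pos_cst.
exact: dup_posD (dup_posZ K0 (dup_pos_bond_cos e)) fP.
Qed.

Let energy_weight l : nonneg_couplings l -> pos_mult (@ginibre_gen R W n)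
  (fun p => clock_energy l p.1 + clock_energy l p.2).
Proof.
by move=> /dup_pos_clock_energy[h _]; apply: pos_multE h => p; rewrite addrC.
Qed.

Lemma clock_corr_ge0 l e : nonneg_couplings l -> 0 <= clock_corr l e.
Proof.
by move=> l0; exact: (gibbs_mean_ge0 w0 base (energy_weight l0) (dup_pos_bond_cos e)).
Qed.

Lemma clock_corr_mono l l' e : nonneg_couplings l -> nonneg_couplings l' ->
  clock_corr l e <= clock_corr (l ++ l') e.
Proof.
move=> l0 l'0; apply: le_trans (gibbs_mean_tilt w0 base (energy_weight l0)
  (dup_pos_bond_cos e) (dup_pos_clock_energy l'0)) _.
rewrite le_eqVlt; apply/orP; left; apply/eqP.
by apply: eq_gibbs_mean => // w; rewrite clock_energy_cat.
Qed.

(** The two covariances required for convexity are Ginibre's inequality for a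
    bond cosine against another one and against its square. *)
Lemma clock_corr_jensen (J : finType) (p a : J -> R) (b : R) l e e0 :
  nonneg_couplings l ->
  (forall j, 0 <= p j) -> \sum_j p j = 1 -> (forall j, 0 <= a j) -> 0 <= b ->
  \sum_j p j * expR (- a j *+ 2) <= expR (- b *+ 2) ->
  clock_corr ((e0, b) :: l) e <= \sum_j p j * clock_corr ((e0, a j) :: l) e.
Proof.
move=> l0 p0 p1 a0 b0 pb.
have E k : clock_corr ((e0, k) :: l) e =
    tilted_mean (bcos e0) (fun w => expR (clock_energy l w)) (bcos e) k.
  rewrite /clock_corr /gibbs_mean /tilted_mean /tilted_sum; congr (_ / _).
    by apply: eq_bigr => w _; rewrite clock_energy_cons expRD [X in _ = _ * X]mulrC.
  by apply: eq_bigr => w _; rewrite clock_energy_cons expRD mul1r mulrC.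
rewrite E; under eq_bigr do rewrite E.
have covE k g : 0 <= k -> dup_pos (@ginibre_gen R W n) true g ->
  0 <= tilted_cov (bcos e0) (fun w => expR (clock_energy l w)) (bcos e) g k.
  move=> k0 gP; have := dup_pos_covariance (u := fun w => expR (k * bcos e0 w + clock_energy l w)) base (pos_multE _
    (pos_mult_exp (energy_weight (l := (e0, k) :: l) _))) (dup_pos_bond_cos e) gP.
  rewrite -expr2 sqrr_sign mul1r.
  rewrite /tilted_cov /tilted_sum.
  have F (h : cfg -> R) : \sum_w h w * expR (k * bcos e0 w + clock_energy l w) =
      \sum_w h w * (expR (clock_energy l w) * expR (k * bcos e0 w)).
    by apply: eq_bigr => w _; rewrite expRD [expR (k * _) * _]mulrC.
  rewrite !F => h.
  rewrite (_ : \sum_w 1 * _ = \sum_w expR (k * bcos e0 w + clock_energy l w)).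
    apply: h => [p'|i]; first by rewrite -expRD !clock_energy_cons.
    by rewrite inE => /orP[/eqP ->//|/l0].
  by apply: eq_bigr => w _; rewrite mul1r expRD mulrC.
apply: (tilted_mean_jensen w0) => //.
- by move=> w; exact: expR_gt0.
- by move=> w; have := bond_cos_le1 e0 w; rewrite ler_norml => /andP[].
- by move=> k k0; apply: covE => //; exact: dup_pos_bond_cos.
- by move=> k k0; apply: covE => //; exact/dup_posX/dup_pos_bond_cos.
Qed.

End Ginibre.

End ClockModel.

(** * Component inequalities, chain inequality and Simon inequality *)

Section ComponentInequalities.
Context {R : realType} {W : finType} {n : nat}.
Notation cfg := {ffun W -> 'I_n.+1}.
Notation bcos := (@bond_cos R W n).
Implicit Types (l : seq ((W * W) * R)) (e : W * W) (w : cfg).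
Variable q : 'I_n.+1.
Hypothesis q_cos : spin_cos (R := R) (n := n) q = 0.
Hypothesis q_sin : spin_sin (R := R) (n := n) q = 1.

Let w0 : cfg := [ffun=> ord0].

Definition spin_comp (b : bool) (x : W) (w : cfg) : R := component b (w x).
Arguments spin_comp : simpl never.

Lemma bond_cosE x y w : bcos (x, y) w =
  spin_comp false x w * spin_comp false y w + spin_comp true x w * spin_comp true y w.
Proof. by rewrite /bond_cos spin_cosB. Qed.

Definition comp_gen (i : W * bool) (w : cfg) : R := spin_comp i.2 i.1 w.

Lemma comp_gen_pos : monomial_pos comp_gen (fun=> 1).
Proof.
move=> l; under eq_bigr do rewrite mul1r.
exact: (site_product_pos (component_sum_pos q_cos q_sin)).
Qed.

Lemma pos_mult_comp b x : pos_mult comp_gen (spin_comp b x).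
Proof. exact: (@pos_mult_gen _ _ _ comp_gen (x, b)). Qed.

(** A bond cosine is a positive combination of products of components, hence
    so is the expansion of the Gibbs weight. *)
Lemma gibbs_mean_comp_ge0 l f : nonneg_couplings l -> pos_mult comp_gen f ->
  0 <= gibbs_mean (clock_energy l) f.
Proof.
move=> l0 fP; rewrite divr_ge0 ?(ltW (gibbs_sum_gt0 w0 _))//.
apply: (pos_mult_ge0 comp_gen_pos); apply: (pos_multM fP); apply: pos_mult_exp.
apply: clock_energy_ind l0 => [g gP [x y] K K0|]; last exact: pos_mult_cst.
apply: pos_multD gP; apply: pos_multM (pos_mult_cst K0) _.
apply: pos_multE (pos_multD (pos_multM (pos_mult_comp false x) (pos_mult_comp false y))
  (pos_multM (pos_mult_comp true x) (pos_mult_comp true y))) => w.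
by rewrite bond_cosE.
Qed.

Definition comp_pair_gen (i : W * (bool * bool)) (p : cfg * cfg) : R :=
  component_pair i.2 (p.1 i.1, p.2 i.1).

Lemma comp_pair_gen_pos : monomial_pos comp_pair_gen (fun=> 1).
Proof.
move=> l; under eq_bigr do rewrite mul1r.
have := site_product_pos (W := W) (component_pair_sum_pos q_cos q_sin) l.
pose h (p : cfg * cfg) : {ffun W -> 'I_n.+1 * 'I_n.+1} := [ffun x => (p.1 x, p.2 x)].
rewrite (reindex h); last first.
  exists (fun v : {ffun W -> 'I_n.+1 * 'I_n.+1} =>
    ([ffun x => (v x).1], [ffun x => (v x).2])) => [[a b] _|v _].
    by congr pair; apply/ffunP => x; rewrite !ffunE.
  by apply/ffunP => x; rewrite !ffunE; case: (v x).
congr (_ <= _); apply: eq_bigr => p _; apply: eq_bigr => i _.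
by rewrite /comp_pair_gen ffunE.
Qed.

Lemma dup_pos_comp b x : dup_pos comp_pair_gen b (spin_comp b x).
Proof.
split.
  apply: pos_multE (@pos_mult_gen _ _ _ comp_pair_gen (x, (b, false))) => p.
  by rewrite /comp_pair_gen /component_pair /= andbF expr0 !mul1r.
apply: pos_multE (@pos_mult_gen _ _ _ comp_pair_gen (x, (b, true))) => p.
by rewrite /comp_pair_gen /component_pair /= andbT expr1 mulN1r.
Qed.

Lemma comp_energy_weight l : nonneg_couplings l -> pos_mult comp_pair_gen
  (fun p => clock_energy l p.1 + clock_energy l p.2).
Proof.
move=> l0; apply: (@clock_energy_ind _ _ _
  (fun f => pos_mult comp_pair_gen (fun p => f p.1 + f p.2))) l0 => [f fP [x y] K K0|].
  have [hc _] := dup_posM (dup_pos_comp false x) (dup_pos_comp false y).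
  have [hs _] := dup_posM (dup_pos_comp true x) (dup_pos_comp true y).
  apply: pos_multE (pos_multD (pos_multM (pos_mult_cst K0) (pos_multD hc hs)) fP) => p /=.
  by rewrite !bond_cosE /spin_comp /component; ring.
by apply: pos_multE (pos_mult_cst (lexx 0)) => p; rewrite addr0.
Qed.

Section Means.
Variable l : seq ((W * W) * R).
Hypothesis l0 : nonneg_couplings l.
Let M := gibbs_mean (clock_energy (n := n) l).

Definition turn (w : cfg) : cfg := [ffun x => w x + q].

Lemma turn_inj : injective turn.
Proof.
by move=> a b /ffunP E; apply/ffunP => x; have := E x; rewrite !ffunE => /addIr.
Qed.

Lemma comp_turn b x w : spin_comp b x (turn w) = if b then spin_comp false x w else - spin_comp true x w.
Proof.
rewrite /spin_comp /component ffunE spin_sinD spin_cosD q_cos q_sin.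
by case: b; ring.
Qed.

Lemma clock_energy_turn w : clock_energy l (turn w) = clock_energy l w.
Proof.
apply: eq_bigr => i _; congr (_ * _).
by rewrite /bond_cos !ffunE opprD addrACA subrr addr0.
Qed.

(** By rotation invariance the two components share the correlation
    equally. *)
Lemma mean_comp_comp b x y : M (fun w => spin_comp b x w * spin_comp b y w) =
  clock_corr (n := n) l (x, y) / 2.
Proof.
have E : M (fun w => spin_comp true x w * spin_comp true y w) =
         M (fun w => spin_comp false x w * spin_comp false y w).
  rewrite /M (gibbs_mean_reindex _ _ turn_inj).
  apply: eq_gibbs_mean => w /=; first exact: clock_energy_turn.
  by rewrite !comp_turn.
have : clock_corr (n := n) l (x, y) = M (fun w => spin_comp false x w * spin_comp false y w) +
    M (fun w => spin_comp true x w * spin_comp true y w).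
  by rewrite -gibbs_meanD; apply: eq_gibbs_mean => // w; rewrite bond_cosE.
by case: b; lra.
Qed.

(** The product of two components of type [b] has flag [b], so that equal
    components are positively correlated and different ones negatively. *)
Lemma mean_same_component b x1 x2 y1 y2 :
  clock_corr (n := n) l (x1, x2) * clock_corr (n := n) l (y1, y2) / 4 <=
  M (fun w => (spin_comp b x1 w * spin_comp b x2 w) * (spin_comp b y1 w * spin_comp b y2 w)).
Proof.
have := gibbs_covariance w0 comp_pair_gen_pos (comp_energy_weight l0)
  (dup_posM (dup_pos_comp b x1) (dup_pos_comp b x2))
  (dup_posM (dup_pos_comp b y1) (dup_pos_comp b y2)).
rewrite -expr2 sqrr_sign mul1r -/M !mean_comp_comp; lra.
Qed.

Lemma mean_opposite_component b x1 x2 y1 y2 :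
  M (fun w => (spin_comp b x1 w * spin_comp b x2 w) * (spin_comp (~~ b) y1 w * spin_comp (~~ b) y2 w)) <=
  clock_corr (n := n) l (x1, x2) * clock_corr (n := n) l (y1, y2) / 4.
Proof.
have := gibbs_covariance w0 comp_pair_gen_pos (comp_energy_weight l0)
  (dup_posM (dup_pos_comp b x1) (dup_pos_comp b x2))
  (dup_posM (dup_pos_comp (~~ b) y1) (dup_pos_comp (~~ b) y2)).
rewrite -/M !mean_comp_comp -signr_addb; case: b => /=; rewrite expr1; lra.
Qed.

(** Insert cos^2 + sin^2 = 1 at y between the cosines at x and at z. The part
    with cos^2 is bounded below by the correlation of equal components, the
    part with sin^2 is nonnegative. *)
Lemma clock_corr_chain x y z :
  clock_corr (n := n) l (x, y) * clock_corr (n := n) l (y, z) / 2 <= clock_corr (n := n) l (x, z).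
Proof.
have h1 := mean_same_component false x y y z.
have h2 : 0 <= M (fun w => spin_comp false x w * spin_comp false z w * (spin_comp true y w * spin_comp true y w)).
  apply: gibbs_mean_comp_ge0 => //.
  by apply: pos_multM; apply: pos_multM; exact: pos_mult_comp.
have : M (fun w => spin_comp false x w * spin_comp false z w) =
    M (fun w => (spin_comp false x w * spin_comp false y w) * (spin_comp false y w * spin_comp false z w)) +
    M (fun w => spin_comp false x w * spin_comp false z w * (spin_comp true y w * spin_comp true y w)).
  rewrite -gibbs_meanD; apply: eq_gibbs_mean => // w.
  rewrite -[LHS]mulr1 -(spin_cos2Dsin2 (w y)) /spin_comp /component; ring.
rewrite mean_comp_comp; lra.
Qed.

Definition bond_sin e w : R := spin_sin (n := n) (w e.1 - w e.2).

(** Four products of components appear when the sines are expanded. Two of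
    them pair different components and are bounded by products of
    correlations; the other two have negative sign and nonnegative mean. *)
Lemma mean_sin_sin_le x y u v :
  M (fun w => bond_sin (x, y) w * bond_sin (u, v) w) <=
  clock_corr (n := n) l (x, u) * clock_corr (n := n) l (v, y) / 2.
Proof.
have h1 := mean_opposite_component true x u v y.
have h2 := mean_opposite_component false x u v y.
have h3 : 0 <= M (fun w => (spin_comp true x w * spin_comp true v w) * (spin_comp false y w * spin_comp false u w)).
  by apply: gibbs_mean_comp_ge0 => //; apply: pos_multM; apply: pos_multM; exact: pos_mult_comp.
have h4 : 0 <= M (fun w => (spin_comp false x w * spin_comp false v w) * (spin_comp true y w * spin_comp true u w)).
  by apply: gibbs_mean_comp_ge0 => //; apply: pos_multM; apply: pos_multM; exact: pos_mult_comp.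
have : M (fun w => bond_sin (x, y) w * bond_sin (u, v) w) =
  (M (fun w => (spin_comp true x w * spin_comp true u w) * (spin_comp false v w * spin_comp false y w)) +
   M (fun w => (spin_comp false x w * spin_comp false u w) * (spin_comp true v w * spin_comp true y w))) -
  (M (fun w => (spin_comp true x w * spin_comp true v w) * (spin_comp false y w * spin_comp false u w)) +
   M (fun w => (spin_comp false x w * spin_comp false v w) * (spin_comp true y w * spin_comp true u w))).
  rewrite -!gibbs_meanD -gibbs_meanB; apply: eq_gibbs_mean => // w.
  by rewrite /bond_sin /= !spin_sinB /spin_comp /component; ring.
rewrite /= in h1 h2; lra.
Qed.

(** The energy is even under the reflection of all the spins. *)
Lemma mean_odd f : (forall w, f (- w) = - f w) -> M f = 0.
Proof.
move=> fN; have : M f = M (fun w => -1 * f w).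
  rewrite /M (gibbs_mean_reindex _ _ (h := fun w : cfg => - w) (@oppr_inj _)).
  apply: eq_gibbs_mean => w /=; last by rewrite fN mulN1r.
  apply: eq_bigr => i _; congr (_ * _).
  by rewrite /bond_cos !ffunE -opprD spin_cosN.
rewrite /M gibbs_meanZ; lra.
Qed.

End Means.

Section Simon.
Variables (l : seq ((W * W) * R)) (S : pred W) (x y : W).
Hypothesis l0 : nonneg_couplings l.
Hypothesis xS : S x.
Hypothesis yS : ~~ S y.
Let M := gibbs_mean (clock_energy (n := n) l).

Definition cut_bonds := [seq i <- l | S i.1.1 != S i.1.2].
Definition outward (e : W * W) : W * W := if S e.1 then e else (e.2, e.1).

Variables (r : 'I_n.+1) (phi : R).
Hypothesis r_cos : spin_cos (R := R) (n := n) r = cos phi.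
Hypothesis r_sin : spin_sin (R := R) (n := n) r = sin phi.
Hypothesis phi_gt0 : 0 < phi.
Hypothesis phi_le : phi <= 2^-1.

Let Kt := \sum_(i <- cut_bonds) i.2.

Definition rotate_in (w : cfg) : cfg := [ffun z => if S z then w z + r else w z].

Lemma rotate_in_inj : injective rotate_in.
Proof.
move=> a b /ffunP E; apply/ffunP => z; have := E z; rewrite !ffunE.
by case: (S z) => // /addIr.
Qed.

Definition energy_shift (w : cfg) : R := \sum_(i <- cut_bonds)
  i.2 * ((cos phi - 1) * bcos (outward i.1) w - sin phi * bond_sin (outward i.1) w).

Lemma clock_energy_rotate_in w :
  clock_energy l (rotate_in w) = clock_energy l w + energy_shift w.
Proof.
rewrite /energy_shift /cut_bonds big_filter big_mkcond -big_split/=.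
apply: eq_bigr => -[[u v] K] _ /=; rewrite /outward /bond_cos /bond_sin /= !ffunE.
case: (S u); case: (S v) => /=; rewrite ?addr0//.
- by rewrite opprD addrACA subrr addr0.
- by rewrite [w u + r - w v]addrAC (spin_cosD (w u - w v) r) r_cos r_sin; ring.
- have -> : spin_cos (n := n) (w u - (w v + r)) = spin_cos (n := n) (w v - w u + r) :> R.
    by rewrite -spin_cosN opprB addrAC.
  have -> : spin_cos (n := n) (w u - w v) = spin_cos (n := n) (w v - w u) :> R.
    by rewrite -spin_cosN opprB.
  by rewrite (spin_cosD (w v - w u) r) r_cos r_sin; ring.
Qed.

Lemma energy_shift_le w : `|energy_shift w| <= phi * Kt.
Proof.
rewrite /Kt mulr_sumr; apply: le_trans (ler_norm_sum _ _ _) _.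
rewrite !big_seq; apply: ler_sum => i; rewrite mem_filter => /andP[_ il].
have i0 := l0 il; rewrite normrM (ger0_norm i0) mulrC ler_wpM2r//.
set e := outward i.1.
have -> : (cos phi - 1) * bcos e w - sin phi * bond_sin e w =
    cos (spin_angle (n := n) (w e.1 - w e.2)%R + phi) -
    cos (spin_angle (n := n) (w e.1 - w e.2)%R).
  by rewrite cosD /bond_cos /bond_sin /spin_cos /spin_sin; ring.
apply: le_trans (cos_lipschitz _ _) _.
by rewrite addrAC subrr add0r gtr0_norm.
Qed.

(** Ward identity: the mean of sin (theta_x - theta_y) vanishes, and it is
    computed here after the rotation of the spins in [S]. *)
Lemma rotation_identity :
  cos phi * M (fun w => bond_sin (x, y) w * expR (energy_shift w)) +
  sin phi * M (fun w => bcos (x, y) w * expR (energy_shift w)) = 0.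
Proof.
rewrite -!gibbs_meanZ -gibbs_meanD.
transitivity (M (bond_sin (x, y))); last first.
  apply: mean_odd => w; rewrite /bond_sin !ffunE -opprD; exact: spin_sinN.
rewrite /M /gibbs_mean; congr (_ / _).
rewrite [RHS](reindex_inj rotate_in_inj)/=; apply: eq_bigr => w _.
rewrite clock_energy_rotate_in expRD /bond_sin /bond_cos /= !ffunE xS (negbTE yS).
by rewrite [w x + r - w y]addrAC (spin_sinD (w x - w y) r) r_cos r_sin; ring.
Qed.

Lemma bond_sin_le1 e w : `|bond_sin e w| <= 1.
Proof. exact: spin_sin_le1. Qed.

(** The cosines of the cut drop out because their product with the sine of (x,
    y) is odd. *)
Lemma mean_sin_shift : M (fun w => bond_sin (x, y) w * energy_shift w) =
  - (sin phi * \sum_(i <- cut_bonds)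
    i.2 * M (fun w => bond_sin (x, y) w * bond_sin (outward i.1) w)).
Proof.
transitivity (M (fun w => \sum_(i <- cut_bonds)
    (i.2 * (cos phi - 1) * (bond_sin (x, y) w * bcos (outward i.1) w) +
     - (i.2 * sin phi) * (bond_sin (x, y) w * bond_sin (outward i.1) w)))).
  apply: eq_gibbs_mean => // w; rewrite mulr_sumr; apply: eq_bigr => i _; ring.
rewrite /M gibbs_mean_sum mulr_sumr -sumrN; apply: eq_bigr => i _.
rewrite gibbs_meanD !gibbs_meanZ (_ : gibbs_mean _ (fun w => _ * bcos _ _) = 0); last first.
  apply: mean_odd => w; rewrite /bond_sin /bond_cos !ffunE -!opprD.
  by rewrite spin_sinN spin_cosN mulNr.
ring.
Qed.

(** For an infinitesimal rotation the Ward identity expresses the correlation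
    of x and y as the sum over the cut bonds uv of K times the mean of sin
    (theta_x - theta_y) sin (theta_u - theta_v), to which [mean_sin_sin_le]
    applies. The finite angle [phi] leaves an error of order [phi]. *)
Lemma clock_corr_simon : phi * Kt <= 2^-1 ->
  clock_corr (n := n) l (x, y) <=
  \sum_(i <- cut_bonds) i.2 * (clock_corr (n := n) l (x, (outward i.1).1) *
    clock_corr (n := n) l ((outward i.1).2, y) / 2) + phi * (4 * Kt ^+ 2 + 2 * Kt).
Proof.
move=> phiK.
have Kt0 : 0 <= Kt.
  rewrite /Kt big_seq; apply: sumr_ge0 => i.
  by rewrite mem_filter => /andP[_ /l0].
have pK0 : 0 <= phi * Kt by rewrite mulr_ge0// ltW.
have D_le w : `|energy_shift w| <= 2^-1 := le_trans (energy_shift_le w) phiK.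
have D2_le w : energy_shift w ^+ 2 <= (phi * Kt) ^+ 2.
  by rewrite -[leLHS]ger0_norm ?sqr_ge0// normrX lerXn2r ?nnegrE// energy_shift_le.
(* Remainders of the exponential of the shift: of order phi^2 in front of the
   sine, of order phi in front of the cosine, which carries a factor sin phi. *)
pose E1 := M (fun w => bond_sin (x, y) w * (expR (energy_shift w) - 1 - energy_shift w)).
pose E2 := M (fun w => bcos (x, y) w * (expR (energy_shift w) - 1)).
have E1_le : `|E1| <= 2 * (phi * Kt) ^+ 2.
  apply: (gibbs_mean_norm_le w0) => w; rewrite normrM.
  have /andP[h1 h2] := expR_quadratic (D_le w).
  rewrite -[leRHS]mul1r ler_pM// ?bond_sin_le1// ger0_norm//.
  by apply: le_trans h2 _; rewrite ler_wpM2l.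
have E2_le : `|E2| <= 2 * (phi * Kt).
  apply: (gibbs_mean_norm_le w0) => w; rewrite normrM.
  rewrite -[leRHS]mul1r ler_pM// ?bond_cos_le1//.
  have /andP[h1 h2] := expR_quadratic (D_le w).
  have h3 := energy_shift_le w; have h4 := D_le w; have h5 := D2_le w.
  move: h3 h4; rewrite !ler_norml => /andP[h3 h3'] /andP[h4 h4'].
  by apply/andP; split; nra.
have id0 := rotation_identity.
have e1 : M (fun w => bond_sin (x, y) w * expR (energy_shift w)) =
    M (fun w => bond_sin (x, y) w * energy_shift w) + E1.
  transitivity (M (bond_sin (x, y)) + (M (fun w => bond_sin (x, y) w * energy_shift w) + E1)).
    rewrite -!gibbs_meanD; apply: eq_gibbs_mean => // w; ring.
  rewrite (_ : M (bond_sin _) = 0) ?add0r//.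
  by apply: mean_odd => w; rewrite /bond_sin !ffunE -opprD; exact: spin_sinN.
have e2 : M (fun w => bcos (x, y) w * expR (energy_shift w)) = clock_corr (n := n) l (x, y) + E2.
  rewrite -gibbs_meanD; apply: eq_gibbs_mean => // w; ring.
move: id0; rewrite e1 e2 mean_sin_shift.
set SS := \sum_(i <- _) i.2 * M _; set GG := \sum_(i <- _) _.
(* The order is even here: nonnegativity comes from the components. *)
have corr0 e : 0 <= clock_corr (n := n) l e.
  case: e => a b; have := gibbs_mean_comp_ge0 l0
    (pos_multM (pos_mult_comp false a) (pos_mult_comp false b)).
  by rewrite mean_comp_comp; lra.
have SG : SS <= GG.
  rewrite /SS /GG !big_seq; apply: ler_sum => i; rewrite mem_filter => /andP[_ /l0 i0].
  rewrite ler_wpM2l//; case: (outward i.1) => u v; exact: mean_sin_sin_le.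
have GG0 : 0 <= GG.
  rewrite /GG big_seq; apply: sumr_ge0 => i; rewrite mem_filter => /andP[_ /l0 i0].
  by rewrite mulr_ge0// divr_ge0// mulr_ge0.
have phi_in : 0 <= phi <= 2^-1 by rewrite ltW.
have b1 := cos_le1 phi; have b0 := cos_ge_half phi_in; have a0 := sin_ge_half phi_in.
move: (clock_corr _ _) E1_le E2_le => G; move: (cos phi) (sin phi) b1 b0 a0 => b a b1 b0 a0.
rewrite !ler_norml => /andP[E1a E1b] /andP[E2a E2b] id0.
have a_gt0 : 0 < a by apply: lt_le_trans a0; rewrite divr_gt0.
have h : a * G <= a * (b * SS + 4 * phi * Kt ^+ 2 + 2 * phi * Kt).
  have k1 : - (b * E1) <= 2 * (phi * Kt) ^+ 2 by nra.
  have k2 : 2 * (phi * Kt) ^+ 2 <= a * (4 * phi * Kt ^+ 2).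
    rewrite (_ : 2 * _ = phi / 2 * (4 * phi * Kt ^+ 2)); last by field.
    by rewrite ler_wpM2r// !mulr_ge0 ?sqr_ge0// ltW.
  nra.
rewrite ler_pM2l// in h; apply: (le_trans h).
rewrite (_ : phi * _ = 4 * phi * Kt ^+ 2 + 2 * phi * Kt); last by ring.
by rewrite addrA !lerD2r; nra.
Qed.

End Simon.

Section SingleBond.
Variables (x y : W) (K : R).
Hypothesis xy : x != y.
Hypothesis K0 : 0 <= K.

Let shift_at (k : 'I_n.+1) (w : cfg) : cfg := [ffun z => if z == x then w z + k else w z].

Let shift_at_inj k : injective (shift_at k).
Proof.
move=> a b /ffunP E; apply/ffunP => z; have := E z; rewrite !ffunE.
by case: (z == x) => // /addIr.
Qed.

Let bond_cos_shift k w : bcos (x, y) (shift_at k w) =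
  spin_cos (n := n) (w x - w y) * spin_cos (n := n) k -
  spin_sin (n := n) (w x - w y) * spin_sin (n := n) k.
Proof.
by rewrite /bond_cos /= !ffunE eqxx [y == x]eq_sym (negbTE xy) addrAC (spin_cosD (w x - w y) k).
Qed.

(** A half turn of the spin at x changes the sign of c, which replaces c exp
    (K c) by c sinh (K c) >= K c^2; a quarter turn exchanges cosine and sine,
    so that c^2 has mean 1 / 2. *)
Lemma clock_corr_single :
  K / 4 * expR (- K) <= clock_corr (n := n) [:: ((x, y), K)] (x, y).
Proof.
have EH w : clock_energy [:: ((x, y), K)] w = K * bcos (x, y) w.
  by rewrite /clock_energy big_seq1.
rewrite /clock_corr /gibbs_mean ler_pdivlMr ?(gibbs_sum_gt0 w0)//.
under eq_bigr do rewrite EH.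
under [X in _ <= X]eq_bigr do rewrite EH.
pose c w : R := bcos (x, y) w.
rewrite -/c.
have sq : \sum_w c w ^+ 2 = \sum_(w : cfg) 2^-1.
  have E : \sum_w c w ^+ 2 = \sum_(w : cfg) bond_sin (x, y) w ^+ 2.
    rewrite (reindex_inj (@shift_at_inj q))/=; apply: eq_bigr => w _.
    by rewrite /c bond_cos_shift q_cos q_sin /bond_sin mulr0 mulr1 sub0r sqrrN.
  have : \sum_w c w ^+ 2 + \sum_(w : cfg) bond_sin (x, y) w ^+ 2 = \sum_(w : cfg) (2^-1 + 2^-1).
    rewrite -big_split/=; apply: eq_bigr => w _.
    by rewrite /c /bond_sin /bond_cos spin_cos2Dsin2; field.
  by rewrite -E big_split/=; lra.
have odd_part : \sum_w c w * expR (K * c w) =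
    \sum_w c w * (expR (K * c w) - expR (- (K * c w))) / 2.
  have : \sum_w c w * expR (K * c w) = \sum_w - (c w * expR (- (K * c w))).
    rewrite (reindex_inj (@shift_at_inj (q + q)))/=; apply: eq_bigr => w _.
    rewrite /c bond_cos_shift (spin_cosD q q) (spin_sinD q q) q_cos q_sin /bond_cos /=.
    rewrite (_ : _ - _ = - spin_cos (n := n) (w x - w y)); last by ring.
    by rewrite mulrN mulNr.
  move=> E; have : \sum_w c w * expR (K * c w) + \sum_w c w * expR (K * c w) =
      \sum_w c w * (expR (K * c w) - expR (- (K * c w))).
    rewrite {2}E -big_split/=; apply: eq_bigr => w _; ring.
  rewrite -mulr_suml; lra.
have sinh_ge (z : R) : 0 <= z -> z <= expR z - expR (- z).
  move=> z0; have := expR_ge1Dx z; have : expR (- z) <= 1 by rewrite expR_le1 oppr_le0.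
  by lra.
rewrite odd_part.
have lower : \sum_(w : cfg) K / 4 <= \sum_w c w * (expR (K * c w) - expR (- (K * c w))) / 2.
  rewrite (_ : \sum_(w : cfg) K / 4 = \sum_w K / 2 * c w ^+ 2); last first.
    by rewrite -mulr_sumr sq mulr_sumr; apply: eq_bigr => w _; field.
  apply: ler_sum => w _; rewrite mulrAC ler_pM2r//.
  have [c0|/ltW c0] := leP 0 (c w).
    rewrite expr2 mulrCA ler_wpM2l//; exact/sinh_ge/mulr_ge0.
  have := sinh_ge (- (K * c w)); rewrite opprK => h.
  rewrite expr2 mulrCA ler_wnM2l//.
  have : 0 <= - (K * c w) by rewrite -mulrN mulr_ge0// oppr_ge0.
  by move=> /h; lra.
apply: le_trans lower; rewrite mulr_sumr; apply: ler_sum => w _.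
rewrite -[leLHS]mulrA -expRD ler_piMr ?divr_ge0// expR_le1 addrC subr_le0 ler_piMr//.
by have := @bond_cos_le1 R W n (x, y) w; rewrite ler_norml => /andP[].
Qed.

End SingleBond.

End ComponentInequalities.

(** * Clock approximation of integrals over the torus *)

Section RiemannSums.
Context {R : realType}.
Notation mu := (@lebesgue_measure R).
Implicit Types (g : R -> R) (a b c L : R).

Definition lipschitz_with L g : Prop := forall a b, `|g a - g b| <= L * `|a - b|.

Lemma lipschitz_with_continuous L g : lipschitz_with L g -> continuous g.
Proof.
move=> gL x; apply/cvgrPdist_lt => e e0.
have L1 : 0 < `|L| + 1 by rewrite ltr_wpDl.
near=> y; apply: le_lt_trans (gL _ _) _.
apply: le_lt_trans (_ : (`|L| + 1) * `|x - y| < _).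
  by rewrite ler_wpM2r// (le_trans (ler_norm L))// lerDl.
rewrite -ltr_pdivlMl//; near: y; apply: cvgr_dist_lt; first exact: cvg_id.
by rewrite mulr_gt0// invr_gt0.
Unshelve. all: by end_near. Qed.

Lemma segment_integrable g a b : continuous g ->
  mu.-integrable `[a, b] (EFin \o g).
Proof.
move=> gc; apply: continuous_compact_integrable; first exact: segment_compact.
exact: continuous_subspaceT.
Qed.

Lemma segment_measure a b : a <= b -> fine (mu `[a, b]) = b - a.
Proof.
move=> ab; rewrite lebesgue_measure_itv/= lte_fin.
by case: ltgtP ab => //= -> _; rewrite subrr.
Qed.

Lemma Rintegral_le_cst g a b c : continuous g -> a <= b ->
  (forall x, a <= x <= b -> g x <= c) -> \int[mu]_(x in `[a, b]) g x <= c * (b - a).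
Proof.
move=> gc ab h; rewrite -segment_measure// -Rintegral_cst//.
apply: le_Rintegral => //; first exact: segment_integrable.
  by apply: (segment_integrable (g := cst c)) => x; exact: cvg_cst.
Qed.

Lemma Rintegral_ge_cst g a b c : continuous g -> a <= b ->
  (forall x, a <= x <= b -> c <= g x) -> c * (b - a) <= \int[mu]_(x in `[a, b]) g x.
Proof.
move=> gc ab h; rewrite -segment_measure// -Rintegral_cst//.
apply: le_Rintegral => //.
  by apply: (segment_integrable (g := cst c)) => x; exact: cvg_cst.
exact: segment_integrable.
Qed.

Lemma Rintegral_split g a b c : continuous g -> a <= b -> b <= c ->
  \int[mu]_(x in `[a, c]) g x =
  \int[mu]_(x in `[a, b]) g x + \int[mu]_(x in `[b, c]) g x.
Proof.
move=> gc ab bc.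
have := @Rintegral_itvB R g (BLeft a) (BRight c) b (segment_integrable a c gc).
rewrite !bnd_simp => /(_ ab bc) /eqP; rewrite subr_eq => /eqP ->.
rewrite addrC; congr (_ + _); apply: Rintegral_itv_obnd_cbnd.
by apply: integrableS (segment_integrable b c gc) => //; exact: subset_itv_oc_cc.
Qed.

Lemma riemann_step L g a h : lipschitz_with L g -> 0 <= L -> 0 <= h ->
  `|\int[mu]_(x in `[a, a + h]) g x - h * g a| <= L * h ^+ 2.
Proof.
move=> gL L0 h0; have gc := lipschitz_with_continuous gL.
have ah : a <= a + h by rewrite lerDl.
have gx x : a <= x <= a + h -> `|g x - g a| <= L * h.
  move=> /andP[ax xh]; apply: le_trans (gL _ _) _.
  by rewrite ler_wpM2l// ger0_norm ?subr_ge0// lerBlDl.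
have up : \int[mu]_(x in `[a, a + h]) g x <= (g a + L * h) * (a + h - a).
  apply: Rintegral_le_cst => // x /gx; rewrite ler_norml => /andP[]; lra.
have lo : (g a - L * h) * (a + h - a) <= \int[mu]_(x in `[a, a + h]) g x.
  apply: Rintegral_ge_cst => // x /gx; rewrite ler_norml => /andP[]; lra.
have e : a + h - a = h by ring.
rewrite e in up lo; rewrite ler_norml; apply/andP; split; nra.
Qed.

Lemma riemann_sum_error L g h k : lipschitz_with L g -> 0 <= L -> 0 <= h ->
  `|\int[mu]_(x in `[0, h * k%:R]) g x - \sum_(i < k) h * g (h * i%:R)|
  <= L * h ^+ 2 * k%:R.
Proof.
move=> gL L0 h0; elim: k => [|k IH].
  by rewrite big_ord0 !mulr0 subr0 set_itv1 Rintegral_set1 normr0.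
have e : h * k.+1%:R = h * k%:R + h by rewrite -natr1; ring.
rewrite e (@Rintegral_split _ _ (h * k%:R)) ?lerDl ?mulr_ge0//; last first.
  exact: lipschitz_with_continuous gL.
rewrite big_ord_recr/= opprD addrACA (le_trans (ler_normD _ _))//.
by rewrite -natr1 mulrDr mulr1 lerD// riemann_step.
Qed.

Definition circle_mean g : R := (2 * pi)^-1 * \int[mu]_(t in `[0, 2 * pi]) g t.

Let pi2_gt0 : 0 < 2 * pi :> R.
Proof. by rewrite mulr_gt0// pi_gt0. Qed.

Lemma circle_mean_riemann L g n : lipschitz_with L g -> 0 <= L ->
  `|circle_mean g - n.+1%:R^-1 * \sum_(k < n.+1) g (spin_angle (n := n) k)| <=
  2 * pi * L / n.+1%:R.
Proof.
move=> gL L0; have n0 : n.+1%:R != 0 :> R by rewrite pnatr_eq0.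
pose h : R := 2 * pi / n.+1%:R; have h0 : 0 <= h by rewrite divr_ge0// ltW.
have := riemann_sum_error n.+1 gL L0 h0.
have -> : h * n.+1%:R = 2 * pi by rewrite divfK.
have -> : \sum_(i < n.+1) h * g (h * i%:R) =
   (2 * pi) * (n.+1%:R^-1 * \sum_(k < n.+1) g (spin_angle (n := n) k)).
  rewrite mulrA mulr_sumr; apply: eq_bigr => i _; congr (_ * g _).
  by rewrite /spin_angle /h mulrAC.
move=> H; rewrite -(ler_pM2l pi2_gt0) -{1}(gtr0_norm pi2_gt0) -normrM mulrBr.
rewrite /circle_mean mulVKf ?gt_eqF//; apply: le_trans H _.
rewrite le_eqVlt; apply/orP; left; apply/eqP; rewrite /h; by field.
Qed.

Lemma circle_mean_dist g1 g2 c : continuous g1 -> continuous g2 ->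
  (forall x, `|g1 x - g2 x| <= c) -> `|circle_mean g1 - circle_mean g2| <= c.
Proof.
move=> c1 c2 h; rewrite -mulrBr normrM gtr0_norm ?invr_gt0// mulrC ler_pdivrMr//.
rewrite -RintegralB//; [|exact: segment_integrable..].
have gc : continuous (fun x => g1 x - g2 x) by move=> x; apply: cvgB; [exact: c1|exact: c2].
have lo := Rintegral_ge_cst (c := - c) gc (ltW pi2_gt0).
have up := Rintegral_le_cst (c := c) gc (ltW pi2_gt0).
rewrite !subr0 in lo up; rewrite ler_norml -mulNr; apply/andP; split.
  by apply: lo => x _; have := h x; rewrite ler_norml => /andP[].
by apply: up => x _; have := h x; rewrite ler_norml => /andP[].
Qed.

End RiemannSums.

Section TorusIntegral.
Context {R : realType} {V : eqType}.
Implicit Types (vs : seq V) (f : (V -> R) -> R) (theta : V -> R).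

Notation update theta v t := ([eta theta with v |-> t] : V -> R).

(** Regularity in one coordinate at a time, as the integral is iterated. *)
Definition coord_lipschitz (L : R) f : Prop :=
  forall theta v s t,
    `|f (update theta v s) - f (update theta v t)| <= L * `|s - t|.

Lemma updateC theta u v s t : u != v ->
  update (update theta u s) v t = update (update theta v t) u s.
Proof.
move=> uv; apply/funext => x /=.
by case: (eqVneq x v) => // ->; rewrite eq_sym (negbTE uv).
Qed.

Lemma updateK theta v s t : update (update theta v s) v t = update theta v t.
Proof. by apply/funext => x /=; case: eqP. Qed.

Fixpoint riemann_mean (n : nat) vs f theta : R :=
  if vs is v :: vs' then
    n.+1%:R^-1 * \sum_(k < n.+1)
      riemann_mean n vs' f (update theta v (spin_angle (n := n) k))
  else f theta.

Lemma torus_integral_lipschitz L vs f : coord_lipschitz L f ->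
  coord_lipschitz L (torus_integral vs f).
Proof.
move=> fL; elim: vs => [//|u vs IH] theta v s t /=.
have c th : continuous (fun r => torus_integral vs f (update th u r)).
  apply: (@lipschitz_with_continuous _ L) => a b; exact: IH.
apply: circle_mean_dist => [||r]; [exact: c|exact: c|].
have [->|uv] := eqVneq v u.
  by rewrite !updateK subrr normr0; apply: le_trans (normr_ge0 _) (fL theta u s t).
by rewrite ![update (update _ v _) _ _]updateC//; exact: IH.
Qed.

Lemma riemann_mean_error L n vs f theta : coord_lipschitz L f -> 0 <= L ->
  `|torus_integral vs f theta - riemann_mean n vs f theta| <=
  (size vs)%:R * (2 * pi * L / n.+1%:R).
Proof.
move=> fL L0; elim: vs theta => [|v vs IH] theta; first by rewrite subrr normr0 mul0r.
rewrite [torus_integral _ _ _]/= [riemann_mean _ _ _ _]/= -/(circle_mean _).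
pose g r := torus_integral vs f (update theta v r).
have gL : lipschitz_with L g by move=> a b; exact: torus_integral_lipschitz.
have h1 := circle_mean_riemann n gL L0.
set A := circle_mean _; set B := _ * \sum_k _.
pose C : R := n.+1%:R^-1 * \sum_(k < n.+1) g (spin_angle (n := n) k).
rewrite (_ : A - B = (A - C) + (C - B)); last by ring.
apply: le_trans (ler_normD _ _) _.
rewrite [(size _)%:R]/= -natr1 mulrDl mul1r addrC lerD//.
rewrite /C /B -mulrBr -sumrB normrM ger0_norm ?invr_ge0//.
rewrite ler_pdivrMl; last by rewrite ltr0n.
apply: le_trans (ler_norm_sum _ _ _) _.
apply: le_trans (ler_sum _ (fun k _ => IH _)) _.
by rewrite sumr_const (_ : #|_| = n.+1) ?card_ord// [leRHS]mulr_natl.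
Qed.

Lemma riemann_mean_cvg L vs f theta : coord_lipschitz L f -> 0 <= L ->
  riemann_mean n vs f theta @[n --> \oo] --> torus_integral vs f theta.
Proof.
move=> fL L0; apply/cvgrPdist_lt => e e0.
have h : ((size vs)%:R * (2 * pi * L) * n.+1%:R^-1) @[n --> \oo] --> (0 : R).
  rewrite -[X in _ --> X](mulr0 ((size vs)%:R * (2 * pi * L))).
  by apply: cvgM; [exact: cvg_cst|exact: cvg_harmonic].
near=> n; apply: le_lt_trans (riemann_mean_error _ _ _ fL L0) _.
rewrite mulrA; apply: le_lt_trans (ler_norm _) _.
near: n; exact: cvgr0_norm_lt h _ e0.
Unshelve. all: by end_near. Qed.

End TorusIntegral.

Section RiemannMeanConfigurations.
Context {R : realType} {V : eqType} {W : finType} {n : nat}.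
Notation cfg := {ffun W -> 'I_n.+1}.
Variable p : V -> W.

Definition extend (vs : seq V) (w : cfg) (theta : V -> R) (x : V) : R :=
  if x \in vs then spin_angle (n := n) (w (p x)) else theta x.

Definition config_mean (h : cfg -> R) : R := (#|cfg|%:R)^-1 * \sum_w h w.

(** A uniform configuration stays uniform when one of its spins is
    resampled. *)
Lemma config_mean_resample z (h : cfg -> R) :
  n.+1%:R^-1 * \sum_(k < n.+1) config_mean (fun w => h [ffun y => if y == z then k else w y])
  = config_mean h.
Proof.
rewrite /config_mean -mulr_sumr mulrCA; congr (_ * _); rewrite exchange_big/=.
(* Adding [k] to the spin at [z] permutes the configurations, and so does adding
   the spin at [z] to [k]. *)
pose T k (w : cfg) : cfg := [ffun y => if y == z then k + w y else w y].
have Tinj k : injective (T k).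
  move=> a b /ffunP E; apply/ffunP => y; have := E y; rewrite !ffunE.
  by case: (y == z) => // /addrI.
transitivity (n.+1%:R^-1 * \sum_(w : cfg) \sum_(k < n.+1) h (T k w)).
  congr (_ * _); apply: eq_bigr => w _.
  rewrite (reindex_inj (@addIr _ (w z)))/=; apply: eq_bigr => k _; congr h.
  by apply/ffunP => y; rewrite !ffunE; case: eqP => // ->.
rewrite exchange_big/=.
rewrite (eq_bigr (fun=> \sum_w h w)) => [|k _]; last first.
  by rewrite [RHS](reindex_inj (Tinj k)).
by rewrite sumr_const card_ord -[X in _ * X]mulr_natl mulKf// pnatr_eq0.
Qed.

(** The bridge to the finite model: [p] names the coordinates in [vs] by
    elements of a finite type. *)
Lemma riemann_mean_config vs f theta : uniq vs -> {in vs &, injective p} ->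
  riemann_mean n vs f theta = config_mean (fun w => f (extend vs w theta)).
Proof.
elim: vs theta => [|v vs IH] theta.
  move=> _ _ /=; rewrite /config_mean (eq_bigr (fun=> f theta))//.
  rewrite sumr_const (_ : #|_| = #|cfg|)// -[X in _ * X]mulr_natl mulKf ?pnatr_eq0//.
  by rewrite card_ffun card_ord expn_eq0.
move=> /andP[v_vs uvs] p_inj /=.
rewrite -(config_mean_resample (p v)); congr (_ * _); apply: eq_bigr => k _.
rewrite IH//; last by move=> x y xv yv; apply: p_inj; rewrite inE ?xv ?yv orbT.
congr config_mean; apply/funext => w; congr f; apply/funext => x.
rewrite /extend inE ffunE /=; case: (eqVneq x v) => [->|xv] /=.
  by rewrite (negbTE v_vs) eqxx.
case: ifP => // x_vs; rewrite ifN//; apply: contra xv => /eqP E.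
by apply/eqP/p_inj => //; rewrite inE ?eqxx ?x_vs ?orbT.
Qed.

End RiemannMeanConfigurations.

Section BoundedLipschitz.
Context {R : realType} {V : eqType}.
Implicit Types (f g : (V -> R) -> R) (theta : V -> R).

(** A class that contains Gibbs weights, being closed under sums, products and
    the exponential. *)
Definition bounded_lipschitz f : Prop := exists B L : R,
  [/\ 0 <= L, forall theta, `|f theta| <= B & coord_lipschitz L f].

Lemma bounded_lipschitz_cst (c : R) : bounded_lipschitz (fun=> c).
Proof. by exists `|c|, 0; split => // theta v s t; rewrite subrr normr0 mul0r. Qed.

Lemma bounded_lipschitzD f g : bounded_lipschitz f -> bounded_lipschitz g ->
  bounded_lipschitz (fun theta => f theta + g theta).
Proof.
move=> [Bf [Lf [Lf0 fB fL]]] [Bg [Lg [Lg0 gB gL]]].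
exists (Bf + Bg), (Lf + Lg); split; first exact: addr_ge0.
  by move=> theta; rewrite (le_trans (ler_normD _ _))// lerD.
move=> theta v s t; rewrite opprD addrACA (le_trans (ler_normD _ _))//.
by rewrite mulrDl lerD.
Qed.

Lemma bounded_lipschitzM f g : bounded_lipschitz f -> bounded_lipschitz g ->
  bounded_lipschitz (fun theta => f theta * g theta).
Proof.
move=> [Bf [Lf [Lf0 fB fL]]] [Bg [Lg [Lg0 gB gL]]].
have Bf0 : 0 <= Bf := le_trans (normr_ge0 _) (fB (fun=> 0)).
have Bg0 : 0 <= Bg := le_trans (normr_ge0 _) (gB (fun=> 0)).
exists (Bf * Bg), (Bf * Lg + Bg * Lf); split.
- by rewrite addr_ge0// mulr_ge0.
- by move=> theta; rewrite normrM ler_pM.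
- move=> theta v s t; set a := [eta theta with v |-> s]; set b := [eta theta with v |-> t].
  rewrite (_ : _ - _ = f a * (g a - g b) + g b * (f a - f b)); last by ring.
  rewrite (le_trans (ler_normD _ _))// !normrM mulrDl -!mulrA.
  by rewrite lerD// ler_pM// ?fB ?gB ?gL ?fL.
Qed.

Lemma bounded_lipschitz_sum (I : Type) (s : seq I) (F : I -> (V -> R) -> R) :
  (forall i, bounded_lipschitz (F i)) ->
  bounded_lipschitz (fun theta => \sum_(i <- s) F i theta).
Proof.
move=> FP; elim: s => [|i s IH].
  rewrite (_ : (fun _ => _) = fun=> 0); first exact: bounded_lipschitz_cst.
  by apply/funext => theta; rewrite big_nil.
rewrite (_ : (fun _ => _) = fun theta => F i theta + \sum_(j <- s) F j theta).
  exact: bounded_lipschitzD.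
by apply/funext => theta; rewrite big_cons.
Qed.

Lemma bounded_lipschitz_exp f : bounded_lipschitz f ->
  bounded_lipschitz (fun theta => expR (f theta)).
Proof.
move=> [B [L [L0 fB fL]]]; exists (expR B), (expR B * L).
have fle theta : f theta <= B by have := fB theta; rewrite ler_norml => /andP[].
split=> [|theta|theta v s t].
- by rewrite mulr_ge0// expR_ge0.
- by rewrite ger0_norm ?expR_ge0// ler_expR.
have step a b : a <= B -> b <= B -> `|expR a - expR b| <= expR B * `|a - b|.
  wlog ba : a b / b <= a => [hw|aB bB].
    move=> aB bB; have [/hw->//|/ltW/hw] := leP b a.
    by rewrite distrC [`|b - a|]distrC; exact.
  have [c /andP[bc ca] ->] := derive_mean_value (@is_derive_expR R) ba.
  rewrite normrM ger0_norm ?expR_ge0// ler_wpM2r// ler_expR.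
  exact: le_trans ca aB.
apply: le_trans (step _ _ (fle _) (fle _)) _.
by rewrite -mulrA ler_wpM2l// expR_ge0.
Qed.

Lemma bounded_lipschitz_cos x y :
  bounded_lipschitz (fun theta : V -> R => cos (theta x - theta y)).
Proof.
exists 1, 2; split=> // [theta|theta v s t].
  by rewrite ler_norml cos_geN1 cos_le1.
apply: le_trans (cos_lipschitz _ _) _ => /=.
rewrite mulr2n mulrDl mul1r.
rewrite (_ : _ - _ - (_ - _) = (if x == v then s else theta x) - (if x == v then t else theta x)
  - ((if y == v then s else theta y) - (if y == v then t else theta y))); last by ring.
apply: le_trans (ler_normB _ _) _; rewrite lerD//.
  by case: ifP => // _; rewrite subrr normr0.
by case: ifP => // _; rewrite subrr normr0.
Qed.

Lemma torus_integral_cvg vs f theta : bounded_lipschitz f ->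
  riemann_mean n vs f theta @[n --> \oo] --> torus_integral vs f theta.
Proof. by move=> [B [L [L0 _ fL]]]; exact: riemann_mean_cvg fL L0. Qed.

End BoundedLipschitz.

Section ClockLimit.
Context {R : realType} {V : eqType} {E : Type} {W : finType}.
Variables (ends : E -> V * V) (vs : seq V) (p : V -> W).
Hypothesis vs_uniq : uniq vs.
Hypothesis p_inj : {in vs &, injective p}.

Definition clock_bonds (es : seq E) (K : E -> R) : seq ((W * W) * R) :=
  [seq ((p (ends e).1, p (ends e).2), K e) | e <- es].

Lemma extend_bond n (w : {ffun W -> 'I_n.+1}) theta x y : x \in vs -> y \in vs ->
  cos (extend p vs w theta x - extend p vs w theta y) = bond_cos (R := R) (p x, p y) w.
Proof.
move=> xv yv; rewrite /extend xv yv /bond_cos spin_cosB.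
by rewrite cosB.
Qed.

Variables (es : seq E) (K : E -> R).
Hypothesis es_ends : all (fun e => ((ends e).1 \in vs) && ((ends e).2 \in vs)) es.

Lemma xy_energy_extend n (w : {ffun W -> 'I_n.+1}) theta :
  xy_energy ends es K (extend p vs w theta) = clock_energy (clock_bonds es K) w.
Proof.
rewrite /clock_energy /clock_bonds big_map /xy_energy.
elim: es es_ends => [|e s IH] /=; first by rewrite !big_nil.
move=> /andP[/andP[e1 e2] /IH IHs].
by rewrite !big_cons IHs extend_bond.
Qed.

Lemma bounded_lipschitz_gibbs : bounded_lipschitz (fun theta : V -> R => expR (xy_energy ends es K theta)).
Proof.
apply/bounded_lipschitz_exp/bounded_lipschitz_sum => e.
by apply: bounded_lipschitzM; [exact: bounded_lipschitz_cst|exact: bounded_lipschitz_cos].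
Qed.

(** The energy is bounded below, hence so are the Riemann means, uniformly in
    the order. *)
Lemma xy_partition_gt0 : 0 < xy_partition ends vs es K.
Proof.
have h := torus_integral_cvg (vs := vs) (theta := fun=> 0) bounded_lipschitz_gibbs.
pose B := \sum_(e <- es) `|K e|.
apply: lt_le_trans (expR_gt0 (- B)) _.
apply: cvgr_to_ge h _; near=> n.
rewrite (riemann_mean_config (p := p))// /config_mean.
have N0 : 0 < #|{ffun W -> 'I_n.+1}|%:R :> R by rewrite ltr0n card_ffun card_ord expn_gt0.
rewrite ler_pdivlMl// mulr_natl -sumr_const; apply: ler_sum => w _.
rewrite ler_expR /B -sumrN; apply: ler_sum => e _.
rewrite lerNl (le_trans (ler_norm _))// normrN normrM ler_piMr//.
by rewrite ler_norml cos_geN1 cos_le1.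
Unshelve. all: by end_near. Qed.

(** The passage through which every inequality for clocks reaches the XY
    model. *)
Lemma xy_expectation_cvg x y : x \in vs -> y \in vs ->
  clock_corr (n := n) (clock_bonds es K) (p x, p y) @[n --> \oo] -->
  xy_expectation ends vs es K (fun theta => cos (theta x - theta y)).
Proof.
move=> xv yv.
have Z0 : xy_partition ends vs es K != 0 by rewrite gt_eqF// xy_partition_gt0.
have hZ := torus_integral_cvg (vs := vs) (theta := fun=> 0) bounded_lipschitz_gibbs.
have hN := torus_integral_cvg (vs := vs) (theta := fun=> 0) (bounded_lipschitzM (bounded_lipschitz_cos x y) bounded_lipschitz_gibbs).
apply: cvg_trans (cvgM hN (cvgV Z0 hZ)).
apply: near_eq_cvg; near=> n.
rewrite /= !(riemann_mean_config (p := p))// /config_mean.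
have N0 : #|{ffun W -> 'I_n.+1}|%:R != 0 :> R by rewrite pnatr_eq0 card_ffun card_ord expn_eq0.
rewrite /clock_corr /gibbs_mean invfM invrK mulrACA mulVf// mul1r.
congr (_ / _).
  by apply: eq_bigr => w _; rewrite extend_bond// xy_energy_extend.
by apply: eq_bigr => w _; rewrite xy_energy_extend.
Unshelve. all: by end_near. Qed.

End ClockLimit.

(** * The XY model in a box *)

Section SpinOrders.
Context {R : realType}.

Lemma odd_order_double_inj m : injective (fun k : 'I_(2 * m).+1 => k + k).
Proof.
move=> k l /(congr1 val) /= E; apply/val_inj => /=.
have kl := ltn_ord k; have ll := ltn_ord l.
have h (a b : nat) : (a < (2 * m).+1)%N -> (b <= a)%N ->
    (a + a = b + b %[mod (2 * m).+1])%N -> a = b.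
  move=> a_lt ba /eqP; rewrite eqn_mod_dvd ?leq_add// => /dvdnP[c Ec].
  have c2 : (c < 2)%N.
    by rewrite -(ltn_pmul2r (ltn0Sn (2 * m))) -Ec; lia.
  by case: c c2 Ec => [|[|c]] //; lia.
by have [lk|/ltnW lk] := leqP l k; [exact: h|symmetry; exact: h].
Qed.

Definition quarter m : 'I_(4 * m).+4 := inord m.+1.

Lemma quarterE m : spin_angle (R := R) (n := (4 * m).+3) (quarter m) = pi / 2.
Proof.
rewrite /spin_angle inordK; last by lia.
have -> : ((4 * m).+4 = 4 * m.+1)%N by lia.
by rewrite natrM; field; rewrite nat1r pnatr_eq0.
Qed.

Lemma quarter_cos m : spin_cos (R := R) (n := (4 * m).+3) (quarter m) = 0.
Proof. by rewrite /spin_cos quarterE cos_pihalf. Qed.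

Lemma quarter_sin m : spin_sin (R := R) (n := (4 * m).+3) (quarter m) = 1.
Proof. by rewrite /spin_sin quarterE sin_pihalf. Qed.

Definition step_angle m : R := 2 * pi / (4 * m).+4%:R.

Lemma spin_step m : spin_angle (R := R) (n := (4 * m).+3) (inord 1 : 'I_(4 * m).+4) = step_angle m.
Proof. by rewrite /spin_angle inordK// mulr1. Qed.

Lemma subseq_cvg (phi : nat -> nat) : (forall m, m <= phi m)%N ->
  phi m @[m --> \oo] --> \oo.
Proof.
by move=> h; apply/cvgnyPge => A; near=> m; apply: leq_trans (h m); near: m; exact: nbhs_infty_ge.
Unshelve. all: by end_near. Qed.

Lemma cvg_odd_orders (u : nat -> R) (a : R) : u n @[n --> \oo] --> a ->
  u (2 * m)%N @[m --> \oo] --> a.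
Proof. by move=> h; apply: cvg_comp h; apply: subseq_cvg => m; lia. Qed.

Lemma cvg_quarter_orders (u : nat -> R) (a : R) : u n @[n --> \oo] --> a ->
  u (4 * m).+3 @[m --> \oo] --> a.
Proof. by move=> h; apply: cvg_comp h; apply: subseq_cvg => m; lia. Qed.

Lemma step_angle_cvg0 : step_angle m @[m --> \oo] --> (0 : R).
Proof.
have h : (2 * pi * n.+1%:R^-1) @[n --> \oo] --> (0 : R).
  rewrite -[X in _ --> X](mulr0 (2 * pi)).
  by apply: cvgM; [exact: cvg_cst|exact: cvg_harmonic].
exact: (cvg_quarter_orders h).
Qed.

Lemma step_angle_gt0 m : 0 < step_angle m.
Proof. by rewrite divr_gt0// mulr_gt0// pi_gt0. Qed.

End SpinOrders.

Section Boxes.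

Lemma mem_box (n : nat) (x : site) :
  (x \in box n) = (`|x.1| <= n%:Z) && (`|x.2| <= n%:Z).
Proof.
have side (a : int) : (a \in [seq i%:Z - n%:Z | i <- iota 0 (2 * n).+1]) = (`|a| <= n%:Z).
  apply/mapP/idP => [[i]|an].
    by rewrite mem_iota => /andP[_ i_lt] ->; lia.
  exists (absz (a + n%:Z)%R); first by rewrite mem_iota; lia.
  by lia.
rewrite -!side; apply/allpairsP/andP => [[c [hc hd ->]]//|[ha hb]].
by exists x; split => //; case: x {ha hb}.
Qed.

Lemma box_uniq n : uniq (box n).
Proof.
have u : uniq [seq i%:Z - n%:Z | i <- iota 0 (2 * n).+1].
  by rewrite map_inj_uniq ?iota_uniq// => i j; lia.
by apply: allpairs_uniq => //; move=> [a b] [c d].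
Qed.

Lemma mem_box_bonds n (e : bond) :
  (e \in box_bonds n) = ((bond_ends e).1 \in box n) && ((bond_ends e).2 \in box n).
Proof.
rewrite mem_filter andbC; congr (_ && _); case: e => x b.
apply/allpairsP/idP => [[[y c] /= [hy _ [-> _]]]//|hx].
by exists (x, b); split => //; case: b {hx}.
Qed.

Lemma box_bonds_uniq n : uniq (box_bonds n).
Proof.
apply: filter_uniq; apply: allpairs_uniq => //; first exact: box_uniq.
by move=> [a b] [c d].
Qed.

Lemma box_bonds_ends n : all (fun e => ((bond_ends e).1 \in box n) && ((bond_ends e).2 \in box n))
  (box_bonds n).
Proof. by apply/allP => e; rewrite mem_box_bonds. Qed.

Lemma box_sub n m : (n <= m)%N -> {subset box n <= box m}.
Proof. by move=> nm x; rewrite !mem_box => /andP[]; lia. Qed.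

Lemma box0 n : ((0, 0) : site) \in box n.
Proof. by rewrite mem_box normr0 !lez_nat. Qed.

End Boxes.

Section FiniteVolume.
Context {R : realType}.
Notation corr := (@box_correlation R).

(** The default value, the origin, belongs to every box. *)
Definition box_point m (x : site) : seq_sub (box m) :=
  insubd (SeqSub (box0 m)) x.

Lemma box_point_inj m : {in box m &, injective (box_point m)}.
Proof.
move=> x y xm ym E.
by rewrite -(insubdK (SeqSub (box0 m)) xm) -(insubdK (SeqSub (box0 m)) ym) -/(box_point m x) E.
Qed.

(** The clock spins of [box n] are placed by [tau] inside [box m], so that the
    models of both boxes share a configuration space. *)
Lemma box_correlation_cvg n m (tau : site -> site) (K : bond -> R) x y :
  injective tau -> {homo tau : z / z \in box n >-> z \in box m} ->
  x \in box n -> y \in box n ->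
  clock_corr (n := N) (clock_bonds bond_ends (box_point m \o tau) (box_bonds n) K)
    (box_point m (tau x), box_point m (tau y)) @[N --> \oo] --> corr n K x y.
Proof.
move=> tau_inj tau_box xn yn.
apply: xy_expectation_cvg => //; first exact: box_uniq.
- by move=> a b an bn /= /box_point_inj E; apply: tau_inj; apply: E; exact: tau_box.
- exact: box_bonds_ends.
Qed.

Lemma box_correlation_cvg_id n (K : bond -> R) x y : x \in box n -> y \in box n ->
  clock_corr (n := N) (clock_bonds bond_ends (box_point n) (box_bonds n) K)
    (box_point n x, box_point n y) @[N --> \oo] --> corr n K x y.
Proof. exact: (@box_correlation_cvg n n id). Qed.

Lemma nonneg_clock_bonds (W : finType) (p : site -> W) (s : seq bond) (K : bond -> R) :
  (forall e, e \in s -> 0 <= K e) ->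
  nonneg_couplings (clock_bonds bond_ends p s K).
Proof. by move=> h i /mapP[e es ->]; exact: h. Qed.

Lemma box_correlation_ge0 n (K : bond -> R) x y : (forall e, e \in box_bonds n -> 0 <= K e) ->
  x \in box n -> y \in box n -> 0 <= corr n K x y.
Proof.
move=> K0 xn yn; have h := cvg_odd_orders (box_correlation_cvg_id (K := K) xn yn).
apply: cvgr_to_ge h _.
near=> N; apply: clock_corr_ge0; first exact: odd_order_double_inj.
exact: nonneg_clock_bonds.
Unshelve. all: by end_near. Qed.

Lemma box_correlation_norm_le1 n (K : bond -> R) x y : x \in box n -> y \in box n -> `|corr n K x y| <= 1.
Proof.
move=> xn yn; have h := cvg_norm (box_correlation_cvg_id (K := K) xn yn).
apply: cvgr_to_le (h _) _.
by near=> N; exact: clock_corr_norm_le1.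
Unshelve. all: by end_near. Qed.

Lemma box_correlationC n (K : bond -> R) x y : corr n K x y = corr n K y x.
Proof.
by congr xy_expectation; apply/funext => theta; rewrite -cosN opprB.
Qed.

Definition bond_embedding (tau : site -> site) (sigma : bond -> bond) : Prop :=
  forall e, bond_ends (sigma e) = (tau (bond_ends e).1, tau (bond_ends e).2) \/
    bond_ends (sigma e) = (tau (bond_ends e).2, tau (bond_ends e).1).

(** Adding couplings to the image of the first model produces the second one.
    This contains the monotonicity in the couplings and in the volume, and the
    comparison of a box with its image under a lattice symmetry. *)
Lemma box_correlation_embed n m tau sigma (K K' : bond -> R) x y :
  injective tau -> injective sigma -> bond_embedding tau sigma ->
  {homo tau : z / z \in box n >-> z \in box m} ->
  (forall e, e \in box_bonds n -> 0 <= K e <= K' (sigma e)) ->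
  (forall e, e \in box_bonds m -> 0 <= K' e) ->
  x \in box n -> y \in box n ->
  corr n K x y <= corr m K' (tau x) (tau y).
Proof.
move=> tau_inj sigma_inj ts tau_box KK' K'0 xn yn.
have h1 := cvg_odd_orders (box_correlation_cvg (K := K) tau_inj tau_box xn yn).
have h2 := cvg_odd_orders (box_correlation_cvg_id (K := K') (tau_box _ xn) (tau_box _ yn)).
apply: ler_cvg_to h1 h2 _; near=> N.
set l := clock_bonds _ _ _ K.
(* The couplings to add: the excess on the image of [box n], and everything on
   the remaining bonds. *)
pose rest := [seq e <- box_bonds m | e \notin map sigma (box_bonds n)].
pose l' := clock_bonds bond_ends (box_point m \o tau) (box_bonds n) (fun e => K' (sigma e) - K e)
  ++ clock_bonds bond_ends (box_point m) rest K'.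
have sub : {subset map sigma (box_bonds n) <= box_bonds m}.
  move=> _ /mapP[e en ->]; rewrite mem_box_bonds.
  move: en; rewrite mem_box_bonds => /andP[/tau_box e1 /tau_box e2].
  by case: (ts e) => ->; rewrite /= e1 e2.
rewrite [leRHS](@eq_clock_corr _ _ _ _ (l ++ l')); last first.
  move=> w; rewrite !clock_energy_cat addrA /l /clock_energy /clock_bonds !big_map.
  rewrite /bond_embedding in ts; move: bond_ends ts => be ts; rewrite -big_split/=.
  rewrite (bigID (mem (map sigma (box_bonds n))))/= -[X in _ + X]big_filter -/rest.
  congr (_ + _); rewrite -big_filter.
  have pe : perm_eq [seq e <- box_bonds m | e \in map sigma (box_bonds n)]
      (map sigma (box_bonds n)).
    apply: uniq_perm; first exact/filter_uniq/box_bonds_uniq.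
      by rewrite map_inj_uniq// box_bonds_uniq.
    by move=> e; rewrite mem_filter; apply: andb_idr; exact: sub.
  rewrite (perm_big _ pe)/=.
  rewrite big_map; apply: eq_bigr => e _ /=; rewrite -mulrDl subrKC.
  congr (_ * _); case: (ts e) => -> //=.
  exact: (bond_cosC (box_point m (tau (be e).1), box_point m (tau (be e).2)) w).
apply: clock_corr_mono; first exact: odd_order_double_inj.
  by apply: nonneg_clock_bonds => e /KK' /andP[].
move=> i; rewrite mem_cat => /orP[]; apply: nonneg_clock_bonds => e.
  by move=> /KK' /andP[_]; rewrite subr_ge0.
by rewrite mem_filter => /andP[_ /K'0].
Unshelve. all: by end_near. Qed.

Lemma box_correlation_mono n m (K K' : bond -> R) x y : (n <= m)%N ->
  (forall e, e \in box_bonds n -> 0 <= K e <= K' e) ->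
  (forall e, e \in box_bonds m -> 0 <= K' e) ->
  x \in box n -> y \in box n -> corr n K x y <= corr m K' x y.
Proof.
move=> nm; apply: (@box_correlation_embed n m id id) => //.
  by move=> e; left; case: (bond_ends e).
exact: box_sub.
Qed.

Lemma box_correlation_chain n (K : bond -> R) x y z : (forall e, e \in box_bonds n -> 0 <= K e) ->
  x \in box n -> y \in box n -> z \in box n ->
  corr n K x y * corr n K y z / 2 <= corr n K x z.
Proof.
move=> K0 xn yn zn.
have h a b (an : a \in box n) (bn : b \in box n) :=
  cvg_quarter_orders (box_correlation_cvg_id (K := K) an bn).
pose c N a b := clock_corr (n := (4 * N).+3)
  (clock_bonds bond_ends (box_point n) (box_bonds n) K) (box_point n a, box_point n b).
have h1 : (c N x y * c N y z / 2) @[N --> \oo] --> corr n K x y * corr n K y z / 2.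
  by apply: cvgM; [apply: cvgM; exact: h|exact: cvg_cst].
apply: ler_cvg_to h1 (h _ _ xn zn) _.
near=> N; apply: (clock_corr_chain (quarter_cos N) (quarter_sin N)).
exact: nonneg_clock_bonds.
Unshelve. all: by end_near. Qed.

Section BoxSimon.
Variables (beta : R) (k m : nat) (y : site).
Hypothesis beta0 : 0 <= beta.
Hypothesis ym : y \in box m.
Hypothesis yk : y \notin box k.

Definition box_cut (e : bond) : bool :=
  ((bond_ends e).1 \in box k) != ((bond_ends e).2 \in box k).

Definition box_outward (e : bond) : site * site :=
  if (bond_ends e).1 \in box k then bond_ends e
  else ((bond_ends e).2, (bond_ends e).1).

Let K : bond -> R := fun=> beta.
Let c N a b := clock_corr (n := (4 * N).+3)
  (clock_bonds bond_ends (box_point m) (box_bonds m) K) (box_point m a, box_point m b).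

Let c_cvg a b : a \in box m -> b \in box m -> c N a b @[N --> \oo] --> corr m K a b.
Proof. by move=> am bm; exact: cvg_quarter_orders (box_correlation_cvg_id am bm). Qed.

Let inside : pred (seq_sub (box m)) := fun w => val w \in box k.

Let insideE x : x \in box m -> inside (box_point m x) = (x \in box k).
Proof. by move=> xm; rewrite /inside /box_point val_insubd xm. Qed.

Lemma box_outward_mem e : e \in box_bonds m ->
  (box_outward e).1 \in box m /\ (box_outward e).2 \in box m.
Proof.
by rewrite mem_box_bonds /box_outward => /andP[e1 e2]; case: ifP.
Qed.

(** The error is proportional to the step of the clock. *)
Lemma box_correlation_simon :
  corr m K (0, 0) y <= \sum_(e <- box_bonds m | (e \in box_bonds m) && box_cut e)
    beta * (corr m K (0, 0) (box_outward e).1 * corr m K (box_outward e).2 y / 2).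
Proof.
pose l := clock_bonds bond_ends (box_point m) (box_bonds m) K.
pose Kt := \sum_(i <- cut_bonds l inside) i.2.
have Kt0 : 0 <= Kt.
  rewrite /Kt big_seq; apply: sumr_ge0 => i; rewrite mem_filter => /andP[_].
  by apply: nonneg_clock_bonds.
have hR : (\sum_(e <- box_bonds m | (e \in box_bonds m) && box_cut e)
    beta * (c N (0, 0) (box_outward e).1 * c N (box_outward e).2 y / 2) +
    step_angle N * (4 * Kt ^+ 2 + 2 * Kt)) @[N --> \oo] -->
  \sum_(e <- box_bonds m | (e \in box_bonds m) && box_cut e)
    beta * (corr m K (0, 0) (box_outward e).1 * corr m K (box_outward e).2 y / 2).
  rewrite -[X in _ --> X]addr0; apply: cvgD.
    apply: cvg_big => [|e /andP[/box_outward_mem[e1 e2] _]]; first exact: add_continuous.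
    apply: cvgM; first exact: cvg_cst.
    apply: cvgM; last exact: cvg_cst.
    by apply: cvgM; apply: c_cvg => //; exact: box0.
  rewrite -[X in _ --> X](mul0r (4 * Kt ^+ 2 + 2 * Kt)).
  by apply: cvgM; [exact: step_angle_cvg0|exact: cvg_cst].
apply: ler_cvg_to (c_cvg (box0 m) ym) hR _.
near=> N.
have h1 : step_angle N <= 2^-1 :> R.
  apply/ltW/(le_lt_trans (ler_norm _)); near: N.
  by apply: cvgr0_norm_lt step_angle_cvg0 _ _; rewrite invr_gt0.
have h2 : step_angle N * Kt <= 2^-1 :> R.
  have : step_angle N < (2 * (Kt + 1))^-1 :> R.
    apply/(le_lt_trans (ler_norm _)); near: N.
    by apply: cvgr0_norm_lt step_angle_cvg0 _ _; rewrite invr_gt0 mulr_gt0// ltr_wpDl.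
  move=> h3; apply: (@le_trans _ _ ((2 * (Kt + 1))^-1 * (Kt + 1))).
    by rewrite ler_pM ?(ltW h3) ?(ltW (step_angle_gt0 _))// lerDl.
  by rewrite invfM mulfVK// gt_eqF// ltr_wpDl.
have := @clock_corr_simon R _ _ (quarter N) (quarter_cos N) (quarter_sin N) l inside
  (box_point m (0, 0)) (box_point m y) _ _ _ (inord 1) (step_angle N).
rewrite !insideE ?box0// => /(_ (nonneg_clock_bonds _) isT yk).
rewrite /spin_cos /spin_sin spin_step => /(_ _ erefl erefl (step_angle_gt0 N) h1 h2).
move=> /(_ (fun _ _ => beta0)) h; apply: le_trans h _; rewrite lerD2r.
rewrite /cut_bonds big_filter big_map big_seq_cond.
rewrite le_eqVlt; apply/orP; left; apply/eqP.
apply: eq_big => [e|e /andP[em _]].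
  case em : (e \in box_bonds m) => //=; move: em; rewrite mem_box_bonds => /andP[e1 e2].
  by rewrite !insideE.
move: em; rewrite mem_box_bonds => /andP[e1 e2].
rewrite /outward /= !insideE// /box_outward; by case: ifP.
Unshelve. all: by end_near. Qed.

End BoxSimon.

(** Delete all the bonds but one. *)
Lemma box_correlation_bond n (beta : R) : 0 <= beta -> (0 < n)%N ->
  beta / 4 * expR (- beta) <= corr n (fun=> beta) (0, 0) (1, 0).
Proof.
move=> beta0 n0.
have e1 : ((1, 0) : site) \in box n by rewrite mem_box /=; lia.
pose e0 : bond := ((0, 0), false).
have e0n : e0 \in box_bonds n by rewrite mem_box_bonds box0.
pose K (e : bond) : R := if e == e0 then beta else 0.
apply: (@le_trans _ _ (corr n K (0, 0) (1, 0))); last first.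
  apply: box_correlation_mono => //; last exact: box0.
  by move=> e _; rewrite /K; case: ifP => _; rewrite ?lexx ?beta0.
have h := cvg_quarter_orders (box_correlation_cvg_id (K := K) (box0 n) e1).
apply: cvgr_to_ge h _; near=> N.
rewrite (@eq_clock_corr _ _ _ _ [:: ((box_point n (0, 0), box_point n (1, 0)), beta)]).
  apply: (clock_corr_single (quarter_cos N) (quarter_sin N)) => //.
  by apply/eqP => /(box_point_inj (box0 n) e1).
move=> w; rewrite /clock_energy big_map big_seq1 (bigD1_seq e0) ?box_bonds_uniq//=.
rewrite /K eqxx /= big1 ?addr0// => e /negbTE ->.
by rewrite mul0r.
Unshelve. all: by end_near. Qed.

End FiniteVolume.

(** * The clean model in infinite volume *)

Section EventuallyMonotone.
Context {R : realType}.
Variables (u : nat -> R) (N : nat) (B : R).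
Hypothesis u_mono : forall n m, (N <= n)%N -> (n <= m)%N -> u n <= u m.
Hypothesis u_le : forall n, (N <= n)%N -> u n <= B.

(** Meant for box correlations, monotone from the first box that contains both
    sites. *)
Lemma eventually_monotone_cvg : cvgn u.
Proof.
have : cvgn (fun n => u (n + N)%N).
  apply: nondecreasing_is_cvgn => [n m nm|]; first by apply: u_mono; lia.
  by exists B => _ [n _ <-]; apply: u_le; lia.
by move=> /cvg_ex[l]; rewrite cvg_shiftn => h; apply/cvg_ex; exists l.
Qed.

Lemma eventually_monotone_le_lim n : (N <= n)%N -> u n <= limn u.
Proof.
move=> Nn; apply: limr_ge; first exact: eventually_monotone_cvg.
by near=> m; apply: u_mono => //; near: m; exact: nbhs_infty_ge.
Unshelve. all: by end_near. Qed.

End EventuallyMonotone.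

Section LatticeSymmetries.

Definition site_radius (x : site) : nat := (absz x.1 + absz x.2)%N.

Lemma site_radius_box x n : (site_radius x <= n)%N -> x \in box n.
Proof. by rewrite mem_box /site_radius; lia. Qed.

Definition shift_site (a x : site) : site := (x.1 + a.1, x.2 + a.2).
Definition shift_bond (a : site) (e : bond) : bond := (shift_site a e.1, e.2).

Lemma shift_site_inj a : injective (shift_site a).
Proof. by move=> [i j] [i' j'] [] /addIr -> /addIr ->. Qed.

Lemma shift_siteK a x : shift_site (- a.1, - a.2) (shift_site a x) = x.
Proof. by case: x => i j; congr pair; exact: addrK. Qed.

Lemma shift_bond_inj a : injective (shift_bond a).
Proof. by move=> [x b] [x' b'] [] /addIr h1 /addIr h2 ->; case: x x' h1 h2 => ? ? [? ?] /= -> ->. Qed.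

Lemma shift_embedding a : bond_embedding (shift_site a) (shift_bond a).
Proof.
move=> [[i j] b]; left; rewrite /bond_ends /shift_site /=.
by case: b => /=; rewrite addrAC.
Qed.

Lemma shift_box a n : {homo shift_site a : z / z \in box n >-> z \in box (n + site_radius a)}.
Proof. by move=> x; rewrite !mem_box /site_radius /shift_site /=; lia. Qed.

Definition reflect_site (x : site) : site := (x.1, - x.2).
Definition reflect_bond (e : bond) : bond :=
  ((e.1.1, if e.2 then - (e.1.2 + 1) else - e.1.2), e.2).

Lemma reflect_site_inj : injective reflect_site.
Proof. by move=> [i j] [i' j'] [] -> /oppr_inj ->. Qed.

Lemma reflect_siteK x : reflect_site (reflect_site x) = x.
Proof. by case: x => i j; congr pair; exact: opprK. Qed.

Lemma reflect_bond_inj : injective reflect_bond.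
Proof.
move=> [[i j] b] [[i' j'] b'] E; have /= Eb := congr1 snd E; subst b'.
have /= Ei := congr1 (fun e : bond => e.1.1) E; have /= Ej := congr1 (fun e : bond => e.1.2) E.
by congr (_, _, _) => //; case: b {E} Ej; lia.
Qed.

Lemma reflect_embedding : bond_embedding reflect_site reflect_bond.
Proof.
move=> [[i j] [|]]; [right|left]; rewrite /bond_ends /reflect_site /=//.
by congr (_, (_, _)); lia.
Qed.

Lemma reflect_box n : {homo reflect_site : z / z \in box n >-> z \in box n}.
Proof. by move=> x; rewrite !mem_box /=; lia. Qed.

Definition swap_site (x : site) : site := (x.2, x.1).
Definition swap_bond (e : bond) : bond := (swap_site e.1, ~~ e.2).

Lemma swap_site_inj : injective swap_site.
Proof. by move=> [i j] [i' j'] [] -> ->. Qed.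

Lemma swap_siteK x : swap_site (swap_site x) = x.
Proof. by case: x. Qed.

Lemma swap_bond_inj : injective swap_bond.
Proof. by move=> [[i j] b] [[i' j'] b'] [] -> -> /negb_inj ->. Qed.

Lemma swap_embedding : bond_embedding swap_site swap_bond.
Proof. by move=> [[i j] [|]]; left. Qed.

Lemma swap_box n : {homo swap_site : z / z \in box n >-> z \in box n}.
Proof. by move=> x; rewrite !mem_box andbC. Qed.

End LatticeSymmetries.

Lemma box_cut_boundary k e : box_cut k e ->
  [/\ (box_outward k e).1 \in box k,
    (`|(box_outward k e).1.1| == k%:Z) || (`|(box_outward k e).1.2| == k%:Z) &
    (box_outward k e).2 \in box k.+1].
Proof.
rewrite /box_cut /box_outward.
case e1 : ((bond_ends e).1 \in box k); case e2 : ((bond_ends e).2 \in box k) => // _ /=.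
  split; rewrite ?e1//; move: e1 e2; rewrite !mem_box; case: e => [[i j] b];
  by rewrite /bond_ends; case: b => /=; lia.
split; rewrite ?e2//; move: e1 e2; rewrite !mem_box; case: e => [[i j] b];
by rewrite /bond_ends; case: b => /=; lia.
Qed.

Section InfiniteVolume.
Context {R : realType}.
Variable beta : R.
Hypothesis beta0 : 0 <= beta.
Notation corr n := (@box_correlation R n (fun=> beta)).
Notation G := (@clean_correlation R beta).

Let box_mono n m x y : x \in box n -> y \in box n -> (n <= m)%N ->
  corr n x y <= corr m x y.
Proof.
by move=> xn yn nm; apply: box_correlation_mono => // e _; rewrite beta0 lexx.
Qed.

Let in_box x y n : (maxn (site_radius x) (site_radius y) <= n)%N ->
  x \in box n /\ y \in box n.
Proof. by rewrite geq_max => /andP[/site_radius_box -> /site_radius_box ->]. Qed.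

Lemma box_correlation_le1 n x y : x \in box n -> y \in box n -> corr n x y <= 1.
Proof.
by move=> xn yn; have := @box_correlation_norm_le1 R n (fun=> beta) x y xn yn;
  rewrite ler_norml => /andP[].
Qed.

Lemma clean_correlation_cvg x y : corr n x y @[n --> \oo] --> G x y.
Proof.
apply: (@eventually_monotone_cvg _ _ (maxn (site_radius x) (site_radius y)) 1).
  by move=> n m /in_box[xn yn]; exact: box_mono.
by move=> n /in_box[xn yn]; exact: box_correlation_le1.
Qed.

Lemma box_correlation_le_clean n x y : x \in box n -> y \in box n ->
  corr n x y <= G x y.
Proof.
move=> xn yn; apply: (@eventually_monotone_le_lim _ _ n 1) => //.
  move=> n' m nn' n'm; apply: box_mono => //; exact: box_sub nn' _ _.
by move=> n' nn'; apply: box_correlation_le1; exact: box_sub nn' _ _.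
Qed.

Lemma clean_correlation_ge0 x y : 0 <= G x y.
Proof.
have [xn yn] := in_box (leqnn (maxn (site_radius x) (site_radius y))).
by apply: le_trans (box_correlation_le_clean xn yn); apply: box_correlation_ge0.
Qed.

Lemma clean_correlation_le1 x y : G x y <= 1.
Proof.
apply: cvgr_to_le (@clean_correlation_cvg x y) _; near=> n.
have [] := @in_box x y n; first by near: n; exact: nbhs_infty_ge.
exact: box_correlation_le1.
Unshelve. all: by end_near. Qed.

Lemma clean_correlationC x y : G x y = G y x.
Proof.
by congr (lim (_ @ \oo)); apply/funext => n; exact: box_correlationC.
Qed.

(** An inequality is enough for invariance, as it also applies to the inverse
    symmetry. *)
Lemma clean_correlation_embed tau sigma x y :
  injective tau -> injective sigma -> bond_embedding tau sigma ->
  (forall n, exists m, {homo tau : z / z \in box n >-> z \in box m}) ->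
  G x y <= G (tau x) (tau y).
Proof.
move=> tau_inj sigma_inj ts tau_box.
apply: cvgr_to_le (@clean_correlation_cvg x y) _; near=> n.
have [] := @in_box x y n; first by near: n; exact: nbhs_infty_ge.
move=> xn yn; have [m tm] := tau_box n.
apply: le_trans (@box_correlation_le_clean m _ _ (tm _ xn) (tm _ yn)).
by apply: (@box_correlation_embed _ n m tau sigma) => // e _; rewrite beta0 lexx.
Unshelve. all: by end_near. Qed.

Lemma clean_correlation_shift a x y : G (shift_site a x) (shift_site a y) = G x y.
Proof.
have h b z w : G z w <= G (shift_site b z) (shift_site b w).
  apply: (clean_correlation_embed (sigma := shift_bond b)).
  - exact: shift_site_inj.
  - exact: shift_bond_inj.
  - exact: shift_embedding.
  - by move=> n; exists (n + site_radius b)%N; exact: shift_box.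
apply: le_anti; rewrite (h a x y) andbT.
have := h (- a.1, - a.2) (shift_site a x) (shift_site a y).
by rewrite !shift_siteK.
Qed.

Lemma clean_correlation_reflect x y : G (reflect_site x) (reflect_site y) = G x y.
Proof.
have h z w : G z w <= G (reflect_site z) (reflect_site w).
  apply: (clean_correlation_embed (sigma := reflect_bond)).
  - exact: reflect_site_inj.
  - exact: reflect_bond_inj.
  - exact: reflect_embedding.
  - by move=> n; exists n; exact: reflect_box.
apply: le_anti; rewrite (h x y) andbT.
by have := h (reflect_site x) (reflect_site y); rewrite !reflect_siteK.
Qed.

Lemma clean_correlation_swap x y : G (swap_site x) (swap_site y) = G x y.
Proof.
have h z w : G z w <= G (swap_site z) (swap_site w).
  apply: (clean_correlation_embed (sigma := swap_bond)).
  - exact: swap_site_inj.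
  - exact: swap_bond_inj.
  - exact: swap_embedding.
  - by move=> n; exists n; exact: swap_box.
apply: le_anti; rewrite (h x y) andbT.
by have := h (swap_site x) (swap_site y); rewrite !swap_siteK.
Qed.

Lemma clean_correlation_chain x y z : G x y * G y z / 2 <= G x z.
Proof.
have h1 : (corr n x y * corr n y z / 2) @[n --> \oo] --> G x y * G y z / 2.
  by apply: cvgM; [apply: cvgM; exact: clean_correlation_cvg|exact: cvg_cst].
apply: ler_cvg_to h1 (@clean_correlation_cvg x z) _; near=> n.
have [] := @in_box x y n; first by near: n; exact: nbhs_infty_ge.
have [] := @in_box y z n; first by near: n; exact: nbhs_infty_ge.
by move=> yn zn xn _; exact: box_correlation_chain.
Unshelve. all: by end_near. Qed.

Notation g := (G (0, 0)).

Lemma clean_correlation_diff x y : G x y = g (y.1 - x.1, y.2 - x.2).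
Proof.
rewrite -(clean_correlation_shift (- x.1, - x.2) x y) /shift_site /=.
by rewrite !subrr.
Qed.

Lemma two_point_neg (i j : int) : g (- i, - j) = g (i, j).
Proof. by rewrite [RHS]clean_correlationC [RHS]clean_correlation_diff /= !sub0r. Qed.

Lemma two_point_negr (i j : int) : g (i, - j) = g (i, j).
Proof. by have := clean_correlation_reflect (0, 0) (i, j); rewrite /reflect_site /= oppr0. Qed.

Lemma two_point_negl (i j : int) : g (- i, j) = g (i, j).
Proof. by rewrite -[RHS]two_point_neg two_point_negr. Qed.

Lemma two_point_swap (i j : int) : g (j, i) = g (i, j).
Proof. exact: (clean_correlation_swap (0, 0) (i, j)). Qed.

Lemma two_point_absl (i j : int) : g (`|i|, j) = g (i, j).
Proof. by case: (ger0P i) => // _; rewrite two_point_negl. Qed.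

Lemma two_point_add (i j i' j' : int) :
  g (i, j) * g (i', j') / 2 <= g (i + i', j + j').
Proof.
have := clean_correlation_chain (0, 0) (i, j) (i + i', j + j').
by rewrite [G (i, j) _]clean_correlation_diff /= ![_ + _ - _]addrAC !subrr !add0r.
Qed.

(** The number of bonds that start in [box k.+1], which include those leaving
    [box k]. *)
Definition cut_capacity k : R := (2 * (2 * k + 3) ^ 2)%:R.

(** The number of bonds in the cut does not depend on the volume. *)
Lemma clean_correlation_simon k (delta e : R) y : y \notin box k ->
  0 <= delta -> 0 <= e ->
  (forall u, u \in box k -> (`|u.1| == k%:Z) || (`|u.2| == k%:Z) -> g u <= delta) ->
  (forall v, v \in box k.+1 -> G v y <= e) ->
  g y <= cut_capacity k * (beta * (delta * e / 2)).
Proof.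
move=> yk delta0 e0 hu hv.
apply: cvgr_to_le (@clean_correlation_cvg (0, 0) y) _; near=> m.
have [] := @in_box (0, 0) y m; first by near: m; exact: nbhs_infty_ge.
move=> om ym.
apply: le_trans (box_correlation_simon beta0 ym yk) _.
pose s := [seq e <- box_bonds m | (e \in box_bonds m) && box_cut k e].
rewrite -big_filter -/s.
have s_sub : {subset s <= [seq (x, b) | x <- box k.+1, b <- [:: false; true]]}.
  move=> [x b]; rewrite mem_filter => /andP[/andP[_ cut] _].
  apply/allpairsP; exists (x, b); split => //=; last by case: b {cut}.
  by move: cut; rewrite /box_cut /bond_ends !mem_box; case: b => /=; lia.
have s_size : (size s <= 2 * (2 * k + 3) ^ 2)%N.
  have := uniq_leq_size (filter_uniq _ (box_bonds_uniq m)) s_sub.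
  move=> h; apply: leq_trans h _.
  rewrite size_allpairs /box size_allpairs !size_map !size_iota /=.
  lia.
apply: (@le_trans _ _ (\sum_(e' <- s) beta * (delta * e / 2))); last first.
  rewrite big_const_seq count_predT iter_addr_0 -[leLHS]mulr_natl.
  by rewrite ler_wpM2r ?ler_nat// mulr_ge0// divr_ge0// mulr_ge0.
rewrite !big_seq; apply: ler_sum => e'; rewrite mem_filter => /andP[/andP[em cut] _].
have [hu1 hv1] := box_outward_mem k em; have [uk ub vk] := box_cut_boundary cut.
rewrite ler_wpM2l// ler_pM2r// ler_pM//; try exact: box_correlation_ge0.
  by apply: le_trans (box_correlation_le_clean om hu1) _; exact: hu.
by apply: le_trans (box_correlation_le_clean hv1 ym) _; exact: hv.
Unshelve. all: by end_near. Qed.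

End InfiniteVolume.

(** * Dichotomy between exponential and algebraic decay *)

Section SiteNorm.
Context {R : realType}.
Notation norm := (@site_norm R).

Lemma site_norm_ge0 x : 0 <= norm x.
Proof. exact: sqrtr_ge0. Qed.

Lemma site_norm_ge (x : site) : (absz x.1)%:R <= norm x /\ (absz x.2)%:R <= norm x.
Proof.
have h (a b : int) : (absz a)%:R <= Num.sqrt (a%:~R ^+ 2 + b%:~R ^+ 2) :> R.
  rewrite natr_absz intr_norm -sqrtr_sqr ler_sqrt ?addr_ge0 ?sqr_ge0//.
  by rewrite lerDl sqr_ge0.
by split; [exact: h|rewrite /site_norm addrC; exact: h].
Qed.

Lemma site_norm_le (x : site) (M : nat) : x \in box M -> norm x <= 2 * M%:R.
Proof.
rewrite mem_box => /andP[h1 h2].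
have h (a : int) : `|a| <= M%:Z -> a%:~R ^+ 2 <= M%:R ^+ 2 :> R.
  move=> aM; rewrite -[leLHS]ger0_norm ?sqr_ge0// normrX lerXn2r ?nnegrE//.
  by rewrite -intr_norm -[M%:R]/(M%:Z%:~R) ler_int.
have M2 : 2 * M%:R = Num.sqrt ((2 * M%:R) ^+ 2) :> R.
  by rewrite sqrtr_sqr ger0_norm// mulr_ge0.
rewrite M2 ler_sqrt ?sqr_ge0// exprMn.
by have := h _ h1; have := h _ h2; have := sqr_ge0 (M%:R : R); lra.
Qed.

End SiteNorm.

Section Dichotomy.
Context {R : realType}.
Variable beta : R.
Hypothesis beta_gt0 : 0 < beta.
Let beta0 : 0 <= beta := ltW beta_gt0.
Notation G := (@clean_correlation R beta).
Notation g := (G (0, 0)).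

Lemma cut_capacity_gt0 k : 0 < cut_capacity k :> R.
Proof. by rewrite ltr0n; lia. Qed.

Section Decay.
Variables (k : nat) (delta : R).
Hypothesis delta0 : 0 <= delta.
Hypothesis small : cut_capacity k * beta * delta <= expR (- 1).
Hypothesis g_le : forall u : site, u \in box k ->
  (`|u.1| == k%:Z) || (`|u.2| == k%:Z) -> g u <= delta.

(** Each use of the Simon inequality crosses one box and gains a factor 1 /
    e. *)
Lemma two_point_iterate (j : nat) (y : site) : y \notin box (j * k.+1) ->
  g y <= expR (- j%:R).
Proof.
elim: j y => [|j IH] y yj; first by rewrite oppr0 expR0 clean_correlation_le1.
have yk : y \notin box k by apply: contra yj; apply: box_sub; lia.
have hv v : v \in box k.+1 -> G v y <= expR (- j%:R).
  move=> vk; rewrite clean_correlation_diff//; apply: IH.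
  by move: vk yj; rewrite !mem_box /=; lia.
apply: le_trans (clean_correlation_simon beta0 yk delta0 (expR_ge0 _) g_le hv) _.
rewrite (_ : - j.+1%:R = - 1 - j%:R :> R) ?expRD; last by rewrite -natr1; ring.
apply: le_trans (_ : (cut_capacity k * beta * delta) * expR (- j%:R) <= _).
  rewrite [leLHS](_ : _ = cut_capacity k * beta * delta * expR (- j%:R) / 2); last by ring.
  rewrite ler_piMr ?invf_le1 ?ler1n//.
  by rewrite !mulr_ge0 ?expR_ge0// ltW// cut_capacity_gt0.
by rewrite ler_wpM2r// expR_ge0.
Qed.

Lemma two_point_exponential_decay : exponential_decay g.
Proof.
exists (expR 1), (2 * k.+1%:R)^-1; split; first by rewrite invr_gt0 mulr_gt0.
move=> x; rewrite ger0_norm ?clean_correlation_ge0//.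
pose M := maxn (absz x.1) (absz x.2).
have xM : x \in box M by rewrite mem_box /M; lia.
pose j := (M.-1 %/ k.+1)%N.
have jM : (M <= j.+1 * k.+1)%N.
  by have := ltn_ceil M.-1 (ltn0Sn k); rewrite -/j; lia.
have gj : g x <= expR (- j%:R).
  have [j0|j0] := posnP j; first by rewrite j0 oppr0 expR0 clean_correlation_le1.
  apply: two_point_iterate.
  have h1 : (j * k.+1 <= M.-1)%N by exact: leq_trunc_div.
  have M0 : (0 < M)%N by rewrite lt0n; apply/eqP => M0; move: j0; rewrite /j M0 div0n.
  by rewrite mem_box; move: h1 M0; rewrite /M; lia.
apply: le_trans gj _; rewrite -expRD ler_expR.
have h2 := site_norm_le (R := R) xM.
have h3 : M%:R <= (j%:R + 1) * k.+1%:R :> R by rewrite natr1 -natrM ler_nat.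
have h4 : (2 * k.+1%:R)^-1 * site_norm x <= j%:R + 1 :> R by rewrite ler_pdivrMl ?mulr_gt0//; nra.
rewrite mulNr; move: h4; set z := _^-1 * _ => h4; move: (j%:R : R) h4 => jr; lra.
Qed.

End Decay.

Hypothesis not_decay : ~ exponential_decay g.

Lemma two_point_boundary_large (k : nat) : exists u : site,
  [/\ u \in box k, (`|u.1| == k%:Z) || (`|u.2| == k%:Z) &
    expR (- 1) / (cut_capacity k * beta) < g u].
Proof.
apply: contrapT => h; apply: not_decay.
have cb : 0 < cut_capacity k * beta by rewrite mulr_gt0// cut_capacity_gt0.
apply: (@two_point_exponential_decay k (expR (- 1) / (cut_capacity k * beta))).
- by rewrite divr_ge0 ?expR_ge0// ltW.
- by rewrite mulrC divfK// gt_eqF.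
- move=> u uk ub; rewrite leNgt; apply/negP => gu.
  by apply: h; exists u.
Qed.

(* The bound of [two_point_boundary_large] for 2 k <= a, up to the common
   factor. *)
Let D (a : nat) : R := expR (- 1) / (2 * beta) / (a%:R + 3) ^+ 2.

(** A site (k, j) of the boundary and its mirror image (k, - j) add up to (2
    k, 0). *)
Lemma two_point_axis_even (k a : nat) : (2 * k <= a)%N ->
  D a ^+ 2 / 2 <= g ((2 * k)%N%:Z, 0).
Proof.
move=> ka; have [[i j] [uk ub gu]] := two_point_boundary_large k.
have DE : D a <= expR (- 1) / (cut_capacity k * beta).
  rewrite /D /cut_capacity -mulrA -invfM ler_pM2l ?expR_gt0// lef_pV2 ?posrE; last 2 first.
  - by rewrite !mulr_gt0// exprn_gt0// ltr_wpDl.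
  - by rewrite mulr_gt0// cut_capacity_gt0.
  rewrite natrM natrX mulrAC ler_pM2l ?mulr_gt0// lerXn2r ?nnegrE//.
  by rewrite natrD lerD2r ler_nat.
have D0 : 0 <= D a.
  by rewrite !divr_ge0 ?expR_ge0 ?exprn_ge0 ?addr_ge0// mulr_ge0.
have [j' gj] : exists j' : int, D a < g (k%:Z, j').
  have gu' := le_lt_trans DE gu; move: ub => /= /orP[/eqP ik|/eqP jk].
    by exists j; rewrite -ik (two_point_absl beta0 i j).
  by exists i; rewrite -jk (two_point_absl beta0 j i) (two_point_swap beta0 i j).
have h := two_point_add beta0 k%:Z j' k%:Z (- j').
have e1 : (k%:Z + k%:Z, j' - j') = ((2 * k)%N%:Z, 0) by congr pair; lia.
rewrite e1 (two_point_negr beta0 k%:Z j') in h.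
apply: le_trans h; move: (g (k%:Z, j')) gj => z zD.
by rewrite ler_pM2r// expr2 ler_pM// ltW.
Qed.

Let c0 : R := beta / 4 * expR (- beta).

Lemma two_point_unit : c0 <= g (1, 0).
Proof.
apply: le_trans (box_correlation_bond beta0 (ltn0Sn 0)) _.
by apply: box_correlation_le_clean => //; exact: box0.
Qed.

Let c1 : R := Num.min 1 (c0 / 2) / 2.

(** An odd point is one bond away from an even one; [c1] covers both
    parities. *)
Lemma two_point_axis (a : nat) : c1 * D a ^+ 2 <= g (a%:Z, 0).
Proof.
have D20 : 0 <= D a ^+ 2 := sqr_ge0 _.
have c00 : 0 <= c0 by rewrite mulr_ge0 ?expR_ge0// divr_ge0.
have m1 : c1 <= 2^-1 by rewrite /c1 ler_pdivrMr// mulVf// ge_min lexx.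
have m2 : c1 <= c0 / 4.
  rewrite /c1 ler_pdivrMr//.
  have -> : c0 / 4 * 2 = c0 / 2 by field.
  by rewrite ge_min lexx orbT.
have := odd_double_half a; case: (odd a) => ha.
  have h1 := @two_point_axis_even a./2 a _; have h2 := two_point_unit.
  have h3 := two_point_add beta0 ((2 * a./2)%N%:Z) 0 1 0.
  have ea : (2 * a./2)%N%:Z + 1 = a%:Z :> int by lia.
  rewrite ea addr0 in h3; apply: le_trans h3.
  have h4 : D a ^+ 2 / 2 <= g ((2 * a./2)%N%:Z, 0) by apply: h1; lia.
  apply: le_trans (_ : D a ^+ 2 / 2 * c0 / 2 <= _).
    by nra.
  by rewrite ler_pM2r// ler_pM// divr_ge0.
have -> : a%:Z = (2 * a./2)%N%:Z by lia.
have h4 : D a ^+ 2 / 2 <= g ((2 * a./2)%N%:Z, 0) by apply: two_point_axis_even; lia.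
by apply: le_trans h4; nra.
Qed.

(** A site is reached along the two axes. The boundary correlation, of order
    |x|^-2, enters squared on the axis and squared again here, hence the
    exponent 8. *)
Lemma clean_algebraic_lower_bound : algebraic_lower_bound g.
Proof.
have c0_gt0 : 0 < c0 by rewrite mulr_gt0 ?expR_gt0// divr_gt0.
have c1_gt0 : 0 < c1 by rewrite divr_gt0// lt_min ltr01 divr_gt0.
pose e := expR (- 1) / (2 * beta).
have e_gt0 : 0 < e by rewrite divr_gt0 ?expR_gt0// mulr_gt0.
exists ((c1 * e ^+ 2) ^+ 2 / 2 / 3 ^+ 8), 8; split => //.
  by rewrite !divr_gt0// !exprn_gt0// mulr_gt0// exprn_gt0.
move=> [i j] _.
have := two_point_add beta0 i 0 0 j; rewrite addr0 add0r.
rewrite -[g (i, 0)]two_point_absl// -[g (0, j)]two_point_swap// -[g (j, 0)]two_point_absl//.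
apply: le_trans.
have [h1 h2] := site_norm_ge (R := R) (i, j).
have r0 := site_norm_ge0 (R := R) (i, j).
set r := site_norm (i, j) in h1 h2 r0 *.
rewrite /= in h1 h2.
have axis (a : int) : (absz a)%:R <= r -> c1 * e ^+ 2 / (3 * (1 + r)) ^+ 4 <= g (`|a|, 0).
  move=> ar; have := two_point_axis (absz a); rewrite abszE; apply: le_trans.
  have z0 : 0 <= (absz a)%:R :> R by [].
  have -> : D (absz a) ^+ 2 = e ^+ 2 / ((absz a)%:R + 3) ^+ 4.
    by rewrite /D -/e; field; lra.
  have c1e : 0 < c1 * e ^+ 2 by apply: mulr_gt0 => //; exact: exprn_gt0.
  rewrite mulrA (ler_pM2l c1e).
  rewrite lef_pV2 ?posrE; [|by rewrite exprn_gt0//; lra..].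
  by rewrite lerXn2r ?nnegrE; lra.
have p8 : (1 + r) `^ (- 8) = ((1 + r) ^+ 8)^-1.
  by rewrite powRN powR_mulrn//; lra.
rewrite p8.
apply: le_trans (_ : c1 * e ^+ 2 / (3 * (1 + r)) ^+ 4 * (c1 * e ^+ 2 / (3 * (1 + r)) ^+ 4) / 2 <= _).
  rewrite le_eqVlt; apply/orP; left; apply/eqP; field.
  by lra.
have q0 : 0 <= c1 * e ^+ 2 / (3 * (1 + r)) ^+ 4.
  apply: divr_ge0; first by apply: mulr_ge0; [exact: ltW|exact: sqr_ge0].
  by apply: exprn_ge0; lra.
by rewrite ler_pM2r// ler_pM ?axis.
Qed.

End Dichotomy.

(** * Jensen inequality in independent couplings *)

Section BoxJensen.
Context {R : realType} {L : finType}.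
Variables (n : nat) (x y : site).
Hypothesis xn : x \in box n.
Hypothesis yn : y \in box n.
Variables (p a : L -> R) (b : R).
Hypothesis p_ge0 : forall j, 0 <= p j.
Hypothesis p_sum : \sum_j p j = 1.
Hypothesis a_ge0 : forall j, 0 <= a j.
Hypothesis b_ge0 : 0 <= b.
Hypothesis p_exp : \sum_j p j * expR (- a j *+ 2) <= expR (- b *+ 2).
Implicit Types (K : bond -> R) (s : seq bond) (e : bond).

Definition set_bond K e t : bond -> R := fun e' => if e' == e then t else K e'.

Lemma set_bond_ge0 K e t : (forall e', 0 <= K e') -> 0 <= t ->
  forall e', 0 <= set_bond K e t e'.
Proof. by move=> K0 t0 e'; rewrite /set_bond; case: ifP. Qed.

Lemma box_correlation_jensen1 K e : e \in box_bonds n -> (forall e', 0 <= K e') ->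
  box_correlation n (set_bond K e b) x y <=
  \sum_j p j * box_correlation n (set_bond K e (a j)) x y.
Proof.
move=> en K0.
pose c N K' := clock_corr (n := (2 * N)%N)
  (clock_bonds bond_ends (box_point n) (box_bonds n) K') (box_point n x, box_point n y).
have c_cvg K' : c N K' @[N --> \oo] --> box_correlation n K' x y.
  exact: cvg_odd_orders (box_correlation_cvg_id (K := K') xn yn).
have h2 : (\sum_j p j * c N (set_bond K e (a j))) @[N --> \oo] -->
    \sum_j p j * box_correlation n (set_bond K e (a j)) x y.
  apply: cvg_big => [|j _]; first exact: add_continuous.
  by apply: cvgM; [exact: cvg_cst|exact: c_cvg].
apply: ler_cvg_to (c_cvg _) h2 _; near=> N.
pose l := clock_bonds bond_ends (box_point n) (rem e (box_bonds n)) K.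
pose e0 := (box_point n (bond_ends e).1, box_point n (bond_ends e).2).
have E t : c N (set_bond K e t) = clock_corr (n := (2 * N)%N) ((e0, t) :: l) (box_point n x, box_point n y).
  apply: eq_clock_corr => w; rewrite /clock_energy !big_cons !big_map.
  rewrite (perm_big _ (perm_to_rem en)) big_cons /set_bond eqxx; congr (_ + _).
  apply: eq_big_seq => e'; rewrite mem_rem_uniq ?box_bonds_uniq// inE => /andP[/negbTE -> _].
  by [].
rewrite E; under eq_bigr do rewrite E.
apply: clock_corr_jensen => //; first exact: odd_order_double_inj.
exact: nonneg_clock_bonds.
Unshelve. all: by end_near. Qed.

(** The expectation of [g] under independent couplings on [s] with values [a
    j], written as an iterated finite sum. *)
Fixpoint cell_mean (g : (bond -> R) -> R) s K : R :=
  if s is e :: s' then \sum_j p j * cell_mean g s' (set_bond K e (a j)) else g K.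

(** Convexity holds in one coupling at a time, the others being fixed:
    independence lets the couplings be replaced successively. *)
Lemma box_correlation_jensen s K : uniq s -> {subset s <= box_bonds n} ->
  (forall e, 0 <= K e) ->
  box_correlation n (fun e => if e \in s then b else K e) x y <=
  cell_mean (fun K' => box_correlation n K' x y) s K.
Proof.
elim: s K => [|e s IH] K /=; first by [].
move=> /andP[es us] sub K0.
have sub' : {subset s <= box_bonds n} by move=> e' e's; apply: sub; rewrite inE e's orbT.
pose K' e' := if e' \in s then b else K e'.
have K'0 e' : 0 <= K' e' by rewrite /K'; case: ifP.
rewrite (_ : (fun _ => _) = set_bond K' e b); last first.
  apply/funext => e'; rewrite /set_bond /K' inE.
  by case: eqP.
have := @box_correlation_jensen1 K' e _ K'0; rewrite sub ?mem_head// => /(_ isT) h.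
apply: le_trans h _; apply: ler_sum => j _; rewrite ler_wpM2l//.
have -> : set_bond K' e (a j) = fun e' => if e' \in s then b else set_bond K e (a j) e'.
  apply/funext => e'; rewrite /set_bond /K'; case: eqP => // ->.
  by rewrite (negbTE es).
exact: IH us sub' (set_bond_ge0 _ K0 (a_ge0 j)).
Qed.

End BoxJensen.

Section CellExpectation.
Context {R : realType} {L : finType} d (T : measurableType d) (Q : probability T R).
Variables (Xe : bond -> {RV Q >-> R}) (B : L -> set R) (p a : L -> R).
Hypothesis indep : mutually_independent Xe.
Hypothesis B_meas : forall j, measurable (B j).
Hypothesis p_law : forall e j, Q (Xe e @^-1` B j) = (p j)%:E.
Hypothesis p_ge0 : forall j, 0 <= p j.
Hypothesis a_ge0 : forall j, 0 <= a j.
Variable g : (bond -> R) -> R.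
Hypothesis g_ge0 : forall K, (forall e, 0 <= K e) -> 0 <= g K.
Implicit Types (K : bond -> R) (s : seq bond) (e : bond).

Definition cell_indic e j (w : T) : R := \1_(Xe e @^-1` B j) w.

(** The value of [g] after the coupling of each bond of [s] is rounded to the
    level of the cell in which its disorder variable falls. *)
Fixpoint cell_function s K (w : T) : R :=
  if s is e :: s' then
    \sum_j cell_indic e j w * cell_function s' (set_bond K e (a j)) w
  else g K.

Lemma preimage_measurable e (A : set R) : measurable A -> measurable (Xe e @^-1` A).
Proof. by move=> mA; rewrite -[X in measurable X]setTI; exact: measurable_funPT. Qed.

Lemma cell_indic_ge0 e j w : 0 <= cell_indic e j w.
Proof. by rewrite /cell_indic indicE. Qed.

Lemma cell_indic_measurable e j : measurable_fun setT (cell_indic e j).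
Proof. by apply: measurable_indic; exact: preimage_measurable. Qed.

Lemma cell_function_ge0 s K w : (forall e, 0 <= K e) -> 0 <= cell_function s K w.
Proof.
elim: s K => [|e s IH] K K0 /=; first exact: g_ge0.
apply: sumr_ge0 => j _; rewrite mulr_ge0 ?cell_indic_ge0//.
by apply: IH; exact: set_bond_ge0.
Qed.

Lemma cell_function_measurable s K : measurable_fun setT (cell_function s K).
Proof.
elim: s K => [|e s IH] K /=; first exact: measurable_cst.
by apply: measurable_sum => j; apply: measurable_funM => //; exact: cell_indic_measurable.
Qed.

Lemma cylinder_measurable (pre : seq bond) (C : bond -> set R) :
  (forall e, measurable (C e)) -> measurable (\bigcap_(i in [set` pre]) (Xe i @^-1` C i)).
Proof.
by move=> mC; apply: fin_bigcap_measurable => // i _; exact: preimage_measurable.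
Qed.

(** Independence is a product rule for finite families of events; the cylinder
    over [pre] keeps track of the cells already chosen, so that the rule can
    be used inside an induction on [s]. *)
Lemma cell_function_integral s (pre : seq bond) (C : bond -> set R) K :
  uniq (pre ++ s) -> (forall e, measurable (C e)) -> (forall e, 0 <= K e) ->
  (\int[Q]_w ((\1_(\bigcap_(i in [set` pre]) (Xe i @^-1` C i)) w * cell_function s K w)%:E) =
   Q (\bigcap_(i in [set` pre]) (Xe i @^-1` C i)) * (cell_mean p a g s K)%:E)%E.
Proof.
elim: s pre C K => [|e s IH] pre C K us mC K0 /=.
  have mA := cylinder_measurable pre mC.
  under eq_integral do rewrite mulrC EFinM.
  rewrite ge0_integralZl_EFin ?g_ge0//; last by apply/measurable_EFinP/measurable_indic.
  by rewrite integral_indic// setIT muleC.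
have e_pre : e \notin pre.
  by move: us; rewrite cat_uniq => /and3P[_ /hasPn h _]; apply: h; rewrite mem_head.
have us' : uniq ((e :: pre) ++ s).
  by rewrite -(perm_uniq (s1 := pre ++ e :: s))// -cat_rcons -cats1 -catA perm_catCA.
have upre : uniq (e :: pre).
  by move: us'; rewrite cat_uniq => /and3P[].
pose C' j i := if i == e then B j else C i.
have mC' j i : measurable (C' j i) by rewrite /C'; case: ifP.
have E j : \bigcap_(i in [set` e :: pre]) (Xe i @^-1` C' j i) =
    (Xe e @^-1` B j) `&` \bigcap_(i in [set` pre]) (Xe i @^-1` C i).
  apply/seteqP; split => w /=.
    move=> h; split; first by have := h e; rewrite /= mem_head /C' eqxx; exact.
    move=> i /= ipre; have := h i; rewrite /= inE ipre orbT /C' => /(_ isT).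
    by case: eqP => // ie; rewrite ie in ipre; rewrite ipre in e_pre.
  move=> [he h] i /=; rewrite inE /C' => /orP[/eqP ->|ipre]; first by rewrite eqxx.
  case: eqP => [ie|_]; first by rewrite ie in ipre; rewrite ipre in e_pre.
  exact: h.
have QE j : Q (\bigcap_(i in [set` e :: pre]) (Xe i @^-1` C' j i)) =
    ((p j)%:E * Q (\bigcap_(i in [set` pre]) (Xe i @^-1` C i)))%E.
  rewrite indep// indep//; last by move: upre => /= /andP[].
  rewrite big_cons {1}/C' eqxx p_law; congr (_ * _)%E.
  apply: eq_big_seq => i ipre; rewrite /C'; case: eqP => // ie.
  by rewrite ie in ipre; rewrite ipre in e_pre.
transitivity (\int[Q]_w (\sum_j
   (\1_(\bigcap_(i in [set` e :: pre]) (Xe i @^-1` C' j i)) w *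
    cell_function s (set_bond K e (a j)) w)%:E))%E.
  apply: eq_integral => w _; rewrite mulr_sumr sumEFin; congr EFin.
  apply: eq_bigr => j _; rewrite E indicI /cell_indic /=; ring.
rewrite ge0_integral_sum//=.
- under eq_bigr => j _ do
    rewrite (IH (e :: pre) (C' j) _ us' (mC' j) (set_bond_ge0 _ K0 (a_ge0 j))) QE.
  have -> : Q (\bigcap_(i in [set` pre]) (Xe i @^-1` C i)) =
      (fine (Q (\bigcap_(i in [set` pre]) (Xe i @^-1` C i))))%:E.
    by rewrite fineK// fin_num_measure//; exact: cylinder_measurable.
  rewrite -EFinM mulr_sumr -sumEFin; apply: eq_bigr => j _.
  by rewrite -!EFinM; congr EFin; ring.
- move=> j; apply/measurable_EFinP/measurable_funM; last exact: cell_function_measurable.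
  by apply: measurable_indic; exact: cylinder_measurable.
- move=> j w _; rewrite lee_fin mulr_ge0//.
  by apply: cell_function_ge0; exact: set_bond_ge0.
Qed.

Lemma cell_function_expectation s K : uniq s -> (forall e, 0 <= K e) ->
  (\int[Q]_w (cell_function s K w)%:E = (cell_mean p a g s K)%:E)%E.
Proof.
move=> us K0.
have := cell_function_integral (pre := [::]) (C := fun=> setT) us (fun=> measurableT) K0.
rewrite (_ : [set` [::]] = set0); last by apply/seteqP; split.
rewrite bigcap_set0 probability_setT mul1e => <-.
by apply: eq_integral => w _; rewrite indicT mul1r.
Qed.

Hypothesis g_mono : forall K K', (forall e, 0 <= K e) ->
  (forall e, K e <= K' e) -> g K <= g K'.
Hypothesis B_disj : forall j j', j != j' -> B j `&` B j' = set0.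

(** Couplings are rounded down and [g] is nondecreasing. *)
Lemma cell_function_le s K K' w : (forall e, 0 <= K e) -> (forall e, 0 <= K' e) ->
  (forall e, e \notin s -> K e <= K' e) ->
  (forall e j, e \in s -> B j (Xe e w) -> a j <= K' e) ->
  cell_function s K w <= g K'.
Proof.
elim: s K => [|e s IH] K K0 K'0 KK' aK' /=.
  by apply: g_mono => // e; exact: KK'.
have [[j Bj]|noB] := pselect (exists j, B j (Xe e w)).
  rewrite (bigD1 j)//= big1 ?addr0 => [|j' j'j]; last first.
    rewrite /cell_indic indicE memNset ?mul0r// => Bj'.
    by have := B_disj j'j; rewrite -subset0 => /(_ (Xe e w)); exact.
  rewrite /cell_indic indicE mem_set// mul1r; apply: IH => //.
  - exact: set_bond_ge0.
  - move=> e' e's; rewrite /set_bond; case: eqP => [->|/eqP e'e].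
      by apply: aK' => //; exact: mem_head.
    by apply: KK'; rewrite inE negb_or e'e.
  - by move=> e' j' e's; apply: aK'; rewrite inE e's orbT.
rewrite big1 ?g_ge0// => j _.
by rewrite /cell_indic indicE memNset ?mul0r// => Bj; apply: noB; exists j.
Qed.

End CellExpectation.

Section RandomCouplings.
Context {R : realType} d (T : measurableType d) (Q : probability T R).
Variable Kw : bond -> T -> R.
Hypothesis Kw_meas : forall e, measurable_fun setT (Kw e).
Hypothesis Kw_ge0 : forall e, {ae Q, forall w, 0 <= Kw e w}.

Lemma ae_all_seq (I : eqType) (s : seq I) (A : I -> T -> Prop) :
  (forall i, {ae Q, forall w, A i w}) ->
  {ae Q, forall w, forall i, i \in s -> A i w}.
Proof.
move=> h; elim: s => [|i s IH].
  by apply: (@filterS _ _ _ setT) filterT => w _ i.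
apply: filterS2 (h i) IH => w iw sw j.
by rewrite inE => /orP[/eqP ->|/sw].
Qed.

Definition corr_rv n x y (w : T) : R := box_correlation n (Kw ^~ w) x y.

Lemma measurable_fun_ratio (f1 f2 : T -> R) : (forall w, 0 < f2 w) ->
  measurable_fun setT f1 -> measurable_fun setT f2 ->
  measurable_fun setT (fun w => f1 w / f2 w).
Proof.
move=> f20 m1 m2.
rewrite (_ : (fun _ => _) = fun w => f1 w * expR (- ln (f2 w))).
  apply: measurable_funM => //; apply: measurableT_comp => //.
  by apply: measurable_funN; apply: measurableT_comp.
by apply/funext => w; rewrite expRN lnK// posrE.
Qed.

(** A limit of clock correlations, which are explicit in finitely many
    couplings. *)
Lemma corr_rv_measurable n x y : x \in box n -> y \in box n ->
  measurable_fun setT (corr_rv n x y).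
Proof.
move=> xn yn.
apply: (@measurable_fun_cvg _ _ _ _ (fun N w => clock_corr (n := N)
  (clock_bonds bond_ends (box_point n) (box_bonds n) (Kw ^~ w))
  (box_point n x, box_point n y))); last first.
  by move=> w _; exact: box_correlation_cvg_id.
move=> N.
have mH v : measurable_fun setT (fun w => expR (clock_energy (n := N)
    (clock_bonds bond_ends (box_point n) (box_bonds n) (Kw ^~ w)) v)).
  apply: measurableT_comp => //; rewrite /clock_energy /clock_bonds.
  under eq_fun do rewrite big_map.
  by apply: measurable_sum => e /=; apply: measurable_funM.
apply: measurable_fun_ratio.
- by move=> w; exact: (gibbs_sum_gt0 [ffun=> ord0]).
- by apply: measurable_sum => v; apply: measurable_funM.
- exact: measurable_sum.
Qed.

Definition mean_corr n x y : R :=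
  fine 'E_Q[fun w => box_correlation n (fun e => Kw e w) x y].

(** Equal to the correlation almost surely, and nonnegative everywhere. *)
Definition pos_corr n x y w : \bar R := (Num.max (corr_rv n x y w) 0)%:E.

Lemma corr_rv_ge0 n x y : x \in box n -> y \in box n ->
  {ae Q, forall w, 0 <= corr_rv n x y w}.
Proof.
move=> xn yn; apply: filterS (ae_all_seq (box_bonds n) Kw_ge0) => w h.
exact: box_correlation_ge0.
Qed.

Lemma pos_corr_measurable n x y : x \in box n -> y \in box n ->
  measurable_fun setT (pos_corr n x y).
Proof.
move=> xn yn; apply/measurable_EFinP/measurable_maxr => //.
exact: corr_rv_measurable.
Qed.

Lemma pos_corr_ge0 n x y w : (0 <= pos_corr n x y w)%E.
Proof. by rewrite lee_fin le_max lexx orbT. Qed.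

Lemma expectation_pos_corr n x y : x \in box n -> y \in box n ->
  ('E_Q[fun w => box_correlation n (fun e => Kw e w) x y] =
   \int[Q]_w pos_corr n x y w)%E.
Proof.
move=> xn yn; rewrite unlock; apply: ae_eq_integral => //.
- by apply/measurable_EFinP; exact: corr_rv_measurable.
- exact: pos_corr_measurable.
- apply: filterS (corr_rv_ge0 xn yn) => w w0 _.
  by rewrite /pos_corr max_l.
Qed.

Lemma pos_corr_integral_le1 n x y : x \in box n -> y \in box n ->
  (\int[Q]_w pos_corr n x y w <= 1)%E.
Proof.
move=> xn yn; apply: (@le_trans _ _ (\int[Q]_w (cst 1 w))%E); last first.
  by rewrite integral_cst// mul1e; exact: probability_le1.
apply: ge0_le_integral => //.
- by move=> w _; exact: pos_corr_ge0.
- exact: pos_corr_measurable.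
- move=> w _; rewrite lee_fin ge_max ler01 andbT.
  have := @box_correlation_norm_le1 R n (Kw ^~ w) x y xn yn.
  by rewrite ler_norml => /andP[].
Qed.

Lemma pos_corr_fin_num n x y : x \in box n -> y \in box n ->
  (\int[Q]_w pos_corr n x y w)%E \is a fin_num.
Proof.
move=> xn yn; rewrite ge0_fin_numE; last by apply: integral_ge0 => w _; exact: pos_corr_ge0.
by apply: le_lt_trans (pos_corr_integral_le1 xn yn) _; rewrite ltry.
Qed.

Lemma mean_corrE n x y : x \in box n -> y \in box n ->
  (mean_corr n x y)%:E = (\int[Q]_w pos_corr n x y w)%E.
Proof. by move=> xn yn; rewrite /mean_corr expectation_pos_corr// fineK// pos_corr_fin_num. Qed.

Lemma mean_corr_le1 n x y : x \in box n -> y \in box n -> mean_corr n x y <= 1.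
Proof. by move=> xn yn; rewrite -lee_fin mean_corrE// pos_corr_integral_le1. Qed.

Lemma mean_corr_mono n m x y : x \in box n -> y \in box n -> (n <= m)%N ->
  mean_corr n x y <= mean_corr m x y.
Proof.
move=> xn yn nm.
have xm := box_sub nm xn; have ym := box_sub nm yn.
rewrite -lee_fin !mean_corrE//; apply: ae_ge0_le_integral => //.
- by move=> w _; exact: pos_corr_ge0.
- exact: pos_corr_measurable.
- by move=> w _; exact: pos_corr_ge0.
- exact: pos_corr_measurable.
- apply: filterS2 (ae_all_seq (box_bonds n) Kw_ge0) (ae_all_seq (box_bonds m) Kw_ge0) => w hn hm _.
  rewrite lee_fin le_max2// /corr_rv; apply: box_correlation_mono => // e en.
  by rewrite hn//= lexx.
Qed.

Section Cells.
Context {L : finType}.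
Variables (Xe : bond -> {RV Q >-> R}) (B : L -> set R) (p a : L -> R) (b : R).
Hypothesis indep : mutually_independent Xe.
Hypothesis B_meas : forall j, measurable (B j).
Hypothesis B_disj : forall j j', j != j' -> B j `&` B j' = set0.
Hypothesis p_law : forall e j, Q (Xe e @^-1` B j) = (p j)%:E.
Hypothesis p_sum : \sum_j p j = 1.
Hypothesis a_ge0 : forall j, 0 <= a j.
Hypothesis b_ge0 : 0 <= b.
Hypothesis p_exp : \sum_j p j * expR (- a j *+ 2) <= expR (- b *+ 2).
Hypothesis Kw_cell : forall e j w, B j (Xe e w) -> a j <= Kw e w.

(** Rounding the disorder down to finitely many levels decreases the
    correlation, and turns the expectation into a finite sum to which Jensen's
    inequality applies. *)
Lemma mean_corr_ge n x y : x \in box n -> y \in box n ->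
  box_correlation n (fun=> b) x y <= mean_corr n x y.
Proof.
move=> xn yn.
have p_ge0 j : 0 <= p j.
  by rewrite -lee_fin -(p_law ((0, 0), false)) measure_ge0.
pose g (K : bond -> R) := box_correlation n K x y.
have g_ge0 K : (forall e, 0 <= K e) -> 0 <= g K.
  by move=> K0; apply: box_correlation_ge0.
have g_mono K K' : (forall e, 0 <= K e) -> (forall e, K e <= K' e) -> g K <= g K'.
  move=> K0 KK'; apply: box_correlation_mono => // e _; first by rewrite K0 KK'.
  exact: le_trans (KK' e).
pose s := box_bonds n; have us : uniq s := box_bonds_uniq n.
apply: (@le_trans _ _ (cell_mean p a g s (fun=> 0))).
  apply: le_trans (_ : box_correlation n (fun e => if e \in s then b else 0) x y <= _).
    by apply: box_correlation_mono => // e es; rewrite ?es ?lexx ?b_ge0.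
  exact: box_correlation_jensen.
rewrite -lee_fin mean_corrE// -(cell_function_expectation (g := g) indep B_meas p_law a_ge0 g_ge0 us (fun=> lexx 0)).
apply: ae_ge0_le_integral => //.
- by move=> w _; rewrite lee_fin cell_function_ge0.
- by apply/measurable_EFinP; exact: cell_function_measurable.
- by move=> w _; exact: pos_corr_ge0.
- exact: pos_corr_measurable.
apply: filterS (ae_all_seq s Kw_ge0) => w hw _; rewrite lee_fin le_max; apply/orP; left.
apply: le_trans (_ : g (fun e => if e \in s then Kw e w else 0) <= _).
  apply: (cell_function_le (L := L) (B := B) (a := a)) => //.
  - by move=> e; case: ifP => // /hw.
  - by move=> e /negbTE ->.
  - by move=> e j es; rewrite es; exact: Kw_cell.
by apply: box_correlation_mono => // e es; rewrite ?es ?lexx hw.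
Qed.

End Cells.

Lemma limn_mean_corr_ge x y (c : R) :
  (forall n, x \in box n -> y \in box n -> box_correlation n (fun=> c) x y <= mean_corr n x y) ->
  0 <= c -> clean_correlation c x y <= limn (fun n => mean_corr n x y).
Proof.
move=> h c0; pose N := maxn (site_radius x) (site_radius y).
have hN n : (N <= n)%N -> x \in box n /\ y \in box n.
  by rewrite geq_max => /andP[/site_radius_box -> /site_radius_box ->].
have cv : cvgn (fun n => mean_corr n x y).
  apply: (@eventually_monotone_cvg _ _ N 1) => [n m /hN[xn yn] nm|n /hN[xn yn]].
    exact: mean_corr_mono.
  exact: mean_corr_le1.
have h1 := @clean_correlation_cvg R c c0 x y.
apply: ler_cvg_to h1 cv _; near=> n.
have [] := hN n; first by near: n; exact: nbhs_infty_ge.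
exact: h.
Unshelve. all: by end_near. Qed.

End RandomCouplings.

(** * Discretization of the disorder *)

Section ExpCubic.
Context {R : realType}.
Implicit Types z : R.

Lemma expR_cubic z : `|z| <= 2^-1 -> expR z <= 1 + z + z ^+ 2 / 2 + `|z| ^+ 3.
Proof.
have [z0|/ltW z0] := leP 0 z.
  rewrite (ger0_norm z0) => z1.
  pose F (y : R) := 1 + y + y ^+ 2 / 2 + y ^+ 3 - expR y.
  have dF (y : R) : is_derive y 1 F (1 + y + 3 * y ^+ 2 - expR y).
    by rewrite /F; apply: is_derive_eq; rewrite /GRing.scale/=; field.
  have := derive_nondecreasing dF (a := 0) (b := z) _ z0.
  rewrite {1}/F expR0 !expr0n /= mul0r !addr0 subrr /F => h.
  rewrite -subr_ge0; apply: h => y /andP[y0 yz].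
  have /expR_quadratic/andP[_] : `|y| <= 2^-1 by rewrite ger0_norm// (le_trans yz).
  by have := sqr_ge0 y; lra.
rewrite (ler0_norm z0) => z1.
pose F (y : R) := 1 - y + y ^+ 2 / 2 + y ^+ 3 - expR (- y).
have dF (y : R) : is_derive y 1 F (- 1 + y + 3 * y ^+ 2 + expR (- y)).
  rewrite /F (_ : (fun y : R => _) = (fun y => 1 - y + y ^+ 2 / 2 + y ^+ 3) - (expR \o -%R)) //.
  by apply: is_derive_eq; rewrite /GRing.scale/=; field.
have nz0 : 0 <= - z by rewrite oppr_ge0.
have := derive_nondecreasing dF (a := 0) (b := - z) _ nz0.
rewrite {1}/F oppr0 expR0 !expr0n /= mul0r !addr0 subrr /F opprK sqrrN => h.
rewrite -subr_ge0; apply: h => y /andP[y0 yz].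
by have := expR_ge1Dx (- y); have := sqr_ge0 y; lra.
Qed.

End ExpCubic.

Section BoundedVariable.
Context {R : realType} d (T : measurableType d) (P : probability T R).
Variables (X : {RV P >-> R}) (M v : R).
Hypothesis X_le : {ae P, forall w, `|X w| <= M}.
Hypothesis X_mean : ('E_P[X] = 0)%E.
Hypothesis X_var : ('V_P[X] = v%:E)%E.

Let Xm : measurable_fun setT X := measurable_funPT X.

Lemma ae_bounded_integrable (f : T -> R) (B : R) : measurable_fun setT f ->
  {ae P, forall w, `|f w| <= B} -> P.-integrable setT (EFin \o f).
Proof.
move=> fm fB; apply/integrableP; split; first exact/measurable_EFinP.
apply: (@le_lt_trans _ _ (\int[P]_w (cst `|B|%:E w))%E).
  apply: ae_ge0_le_integral => //.
  - by apply: measurableT_comp => //; exact/measurable_EFinP.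
  - by move=> w _; rewrite lee_fin.
  - by move: fB; apply: filterS => w h _; rewrite /= lee_fin (le_trans h)// ler_norm.
rewrite integral_cst//; apply: (@le_lt_trans _ _ (`|B|%:E * 1)%E).
  by apply: lee_wpmul2l => //; exact: probability_le1.
by rewrite mule1 ltry.
Qed.

Let X1 : P.-integrable setT (EFin \o X).
Proof. exact: ae_bounded_integrable X_le. Qed.

Let X2m : measurable_fun setT (fun w => X w ^+ 2).
Proof. exact: measurable_funX. Qed.

Let X2 : P.-integrable setT (EFin \o (fun w => X w ^+ 2)).
Proof.
apply: (@ae_bounded_integrable _ (M ^+ 2)) => //.
move: X_le; apply: filterS => w h; rewrite normrX lerXn2r ?nnegrE//.
exact: le_trans h.
Qed.

Lemma second_moment : (\int[P]_w (X w ^+ 2)%:E = v%:E)%E.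
Proof.
move: X_var; rewrite /variance covariance.unlock X_mean /= expectation.unlock => <-.
by apply: eq_integral => w _; rewrite fctE /= subr0 expr2.
Qed.

Lemma variance_v_ge0 : 0 <= v.
Proof. by rewrite -lee_fin -X_var variance_ge0. Qed.

Lemma ae_cst_integral (c : R) : (\int[P]_w (EFin \o (fun=> c)) w = c%:E)%E.
Proof.
rewrite integral_cst// -[RHS]mule1; congr (_ * _)%E; exact: probability_setT.
Qed.

Lemma quadratic_mean (c0 c1 c2 : R) :
  (\int[P]_w (c0 + c1 * X w + c2 * X w ^+ 2)%:E = (c0 + c2 * v)%:E)%E.
Proof.
have i0 : P.-integrable setT (EFin \o (fun=> c0)).
  by apply: (@ae_bounded_integrable _ `|c0|) => //; move: X_le; apply: filterS.
have i1 : P.-integrable setT (EFin \o (fun w => c1 * X w)).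
  exact: (integrableZl measurableT c1 X1).
have i2 : P.-integrable setT (EFin \o (fun w => c2 * X w ^+ 2)).
  exact: (integrableZl measurableT c2 X2).
have i01 : P.-integrable setT (EFin \o (fun w => c0 + c1 * X w)).
  exact: (integrableD measurableT i0 i1).
have -> := integralD_EFin measurableT i01 i2.
have -> := integralD_EFin measurableT i0 i1.
have -> := integralZl measurableT X1 c1.
have -> := integralZl measurableT X2 c2.
rewrite second_moment ae_cst_integral.
have -> : (\int[P]_x (EFin \o X) x = 0)%E by rewrite -X_mean expectation.unlock.
by rewrite mule0 adde0 -EFinM -EFinD.
Qed.

End BoundedVariable.

Section Discretization.
Context {R : realType} d (T : measurableType d) (P : probability T R).
Variables (X : {RV P >-> R}) (M v J0 eps beta eta : R).
Hypothesis X_le : {ae P, forall w, `|X w| <= M}.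
Hypothesis X_mean : ('E_P[X] = 0)%E.
Hypothesis X_var : ('V_P[X] = v%:E)%E.
Hypothesis J_ge : {ae P, forall w, J0 / 2 <= J0 + eps * X w}.
Hypothesis M_ge0 : 0 <= M.
Hypothesis J0_gt0 : 0 < J0.
Hypothesis beta_gt0 : 0 < beta.
Hypothesis eta_gt0 : 0 < eta.
Hypothesis eps_small : 2 * beta * `|eps| * M <= 2^-1.

Definition cell_number : nat := (Num.truncn ((J0 / 2 + `|eps| * M) / eta)).+1.

(** Cells of width [eta] for the strength J0 + eps x, starting at its lower
    bound J0 / 2. *)
Definition cell (j : 'I_cell_number) : set R :=
  [set x | J0 / 2 + eta * j%:R <= J0 + eps * x < J0 / 2 + eta * j.+1%:R].

Definition cell_level (j : 'I_cell_number) : R := beta * (J0 / 2 + eta * j%:R).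

Definition cell_prob (j : 'I_cell_number) : R := fine (P (X @^-1` cell j)).

Lemma cell_measurable j : measurable (cell j).
Proof.
have m : measurable_fun setT (fun x : R => J0 + eps * x).
  by apply: measurable_funD => //; apply: measurable_funM.
rewrite (_ : cell j = setT `&` (fun x : R => J0 + eps * x) @^-1`
   `[J0 / 2 + eta * j%:R, J0 / 2 + eta * j.+1%:R[).
  by apply: m => //; exact: measurable_itv.
by rewrite setTI; apply/seteqP; split => x /=; rewrite in_itv.
Qed.

Lemma cell_disjoint j j' : j != j' -> cell j `&` cell j' = set0.
Proof.
move=> jj'; apply/seteqP; split => // x [/= /andP[h1 h2] /andP[h3 h4]].
have h5 := le_lt_trans h1 h4; have h6 := le_lt_trans h3 h2.
rewrite ltrD2l ltr_pM2l// ltr_nat ltnS in h5; rewrite ltrD2l ltr_pM2l// ltr_nat ltnS in h6.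
by move: jj'; rewrite -val_eqE /= eqn_leq h5 h6.
Qed.

Lemma cell_level_ge0 j : 0 <= cell_level j.
Proof. by rewrite mulr_ge0 ?(ltW beta_gt0)// addr_ge0 ?divr_ge0 ?mulr_ge0// ltW. Qed.

Lemma cell_level_le j x : cell j x -> cell_level j <= beta * (J0 + eps * x).
Proof. by move=> /andP[h _]; rewrite ler_pM2l. Qed.

Lemma cell_cover x : `|x| <= M -> J0 / 2 <= J0 + eps * x -> exists j, cell j x.
Proof.
move=> xM Jx.
(* The cell of [x] is the integer part of the distance of its strength to J0 /
   2, in units of [eta]. *)
pose t := (J0 / 2 + eps * x) / eta.
have t0 : 0 <= t by rewrite divr_ge0 ?(ltW eta_gt0)//; lra.
have /andP[t1 t2] := truncn_itv t0.
have le_t : t <= (J0 / 2 + `|eps| * M) / eta.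
  rewrite ler_pM2r ?invr_gt0// lerD2l (le_trans (ler_norm _))// normrM.
  by rewrite ler_wpM2l.
have jn : (Num.truncn t < cell_number)%N.
  by rewrite ltnS; apply: le_truncn.
exists (Ordinal jn) => /=.
have e : eta * t = J0 / 2 + eps * x by rewrite /t mulrC divfK// gt_eqF.
have s1 : eta * (Num.truncn t)%:R <= eta * t by rewrite ler_pM2l.
have s2 : eta * t < eta * (Num.truncn t).+1%:R by rewrite ltr_pM2l.
by apply/andP; split; lra.
Qed.

Lemma cell_probE j : P (X @^-1` cell j) = (cell_prob j)%:E.
Proof.
rewrite fineK// fin_num_measure// -[X in measurable X]setTI.
by apply: measurable_funPT => //; exact: cell_measurable.
Qed.

Lemma cell_step_integral (c : 'I_cell_number -> R) : (forall j, 0 <= c j) ->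
  (\int[P]_w (\sum_j c j * \1_(X @^-1` cell j) w)%:E = (\sum_j cell_prob j * c j)%:E)%E.
Proof.
move=> c0.
have mA j : measurable (X @^-1` cell j).
  by rewrite -[X in measurable X]setTI; apply: measurable_funPT => //; exact: cell_measurable.
transitivity (\int[P]_w (\sum_j (c j * \1_(X @^-1` cell j) w)%:E))%E.
  by apply: eq_integral => w _; rewrite sumEFin.
rewrite ge0_integral_sum//=.
- rewrite -sumEFin; apply: eq_bigr => j _.
  under eq_integral do rewrite EFinM.
  rewrite ge0_integralZl_EFin//; last by apply/measurable_EFinP/measurable_indic.
  rewrite integral_indic// setIT [in RHS]mulrC EFinM; congr (_ * _)%E.
  exact: cell_probE.
- by move=> j; apply/measurable_EFinP/measurable_funM => //; exact: measurable_indic.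
- by move=> j w _; rewrite lee_fin mulr_ge0// indicE.
Qed.

Lemma cell_step_measurable (c : 'I_cell_number -> R) :
  measurable_fun setT (fun w => (\sum_j c j * \1_(X @^-1` cell j) w)%:E).
Proof.
apply/measurable_EFinP/measurable_sum => j; apply: measurable_funM => //.
apply: measurable_indic; rewrite -[X in measurable X]setTI.
by apply: measurable_funPT => //; exact: cell_measurable.
Qed.

Lemma cell_stepE (c : 'I_cell_number -> R) w j : cell j (X w) ->
  \sum_j c j * \1_(X @^-1` cell j) w = c j.
Proof.
move=> wj; rewrite (bigD1 j)//= big1 ?addr0 => [|j' j'j].
  by rewrite indicE mem_set// mulr1.
rewrite indicE memNset ?mulr0// => wj'.
by have := cell_disjoint j'j; rewrite -subset0 => /(_ (X w)); exact.
Qed.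

Lemma cell_prob_sum : \sum_j cell_prob j = 1.
Proof.
apply: EFin_inj; under eq_bigr do rewrite -[cell_prob _]mulr1.
rewrite -cell_step_integral// -[RHS](ae_cst_integral P).
apply: ae_eq_integral => //; [exact: cell_step_measurable|exact/measurable_EFinP|].
apply: filterS2 X_le J_ge => w wM wJ _ /=.
by have [j wj] := cell_cover wM wJ; rewrite (cell_stepE _ wj).
Qed.

(** Bound for E exp (- 2 beta eps X) - 1. *)
Definition cubic_error : R := 2 * beta ^+ 2 * eps ^+ 2 * v + 8 * beta ^+ 3 * M ^+ 3 * `|eps| ^+ 3.

(** Rounding costs at most a factor exp (2 beta eta). The linear term of the
    exponential disappears because X is centered, the quadratic one gives the
    variance. *)
Lemma cell_exp_moment : \sum_j cell_prob j * expR (- cell_level j *+ 2) <=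
  expR (2 * beta * eta - 2 * beta * J0) * (1 + cubic_error).
Proof.
pose C := expR (2 * beta * eta - 2 * beta * J0).
have C0 : 0 <= C := expR_ge0 _.
pose k := 8 * beta ^+ 3 * M ^+ 3 * `|eps| ^+ 3.
have e : C * (1 + cubic_error) = C * (1 + k) + C * (2 * beta ^+ 2 * eps ^+ 2) * v.
  by rewrite /cubic_error /k; ring.
rewrite -lee_fin -/C e -(quadratic_mean X_le X_mean X_var _ (C * (- 2 * beta * eps))).
rewrite -cell_step_integral; last by move=> j; exact: expR_ge0.
have k0 : 0 <= k by rewrite !mulr_ge0 ?exprn_ge0// ltW.
have UE x : C * (1 + k) + C * (- 2 * beta * eps) * x + C * (2 * beta ^+ 2 * eps ^+ 2) * x ^+ 2 =
    C * (1 + (- 2 * beta * eps * x) + (- 2 * beta * eps * x) ^+ 2 / 2 + k) by field.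
apply: ae_ge0_le_integral => //.
- by move=> w _; rewrite lee_fin sumr_ge0// => j _; rewrite mulr_ge0 ?expR_ge0// indicE.
- exact: cell_step_measurable.
- move=> w _; rewrite lee_fin UE mulr_ge0//; move: (_ * X w) => z.
  by have := sqr_ge0 (1 + z); nra.
- apply/measurable_EFinP; have Xm : measurable_fun setT X := measurable_funPT X.
  apply: measurable_funD; first by apply: measurable_funD => //; exact: measurable_funM.
  by apply: measurable_funM => //; exact: measurable_funX.
- apply: filterS2 X_le J_ge => w wM wJ _ /=.
  have [j wj] := cell_cover wM wJ; rewrite (cell_stepE _ wj) lee_fin UE.
  set z := - 2 * beta * eps * X w.
  have z_le : `|z| <= 2 * beta * `|eps| * M.
    have b2 : 0 < 2 * beta by rewrite mulr_gt0.
    rewrite (_ : z = - (2 * beta * (eps * X w))); last by rewrite /z; ring.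
    rewrite normrN normrM (gtr0_norm b2) normrM mulrA.
    by rewrite ler_wpM2l// mulr_ge0// ltW.
  have z3 : `|z| ^+ 3 <= k.
    have -> : k = (2 * beta * `|eps| * M) ^+ 3 by rewrite /k; ring.
    by rewrite lerXn2r ?nnegrE// (le_trans _ z_le).
  apply: (@le_trans _ _ (C * expR z)); last first.
    rewrite ler_wpM2l//; apply: le_trans (expR_cubic (le_trans z_le eps_small)) _.
    by rewrite lerD2l.
  rewrite -expRD ler_expR /cell_level mulr2n /z.
  move: wj => /andP[_]; rewrite -[j.+1%:R]natr1 => wj.
  have : beta * (J0 + eps * X w) < beta * (J0 / 2 + eta * (j%:R + 1)) by rewrite ltr_pM2l.
  by lra.
Qed.

End Discretization.

(** * The averaged model and its threshold *)

Section AveragedModel.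
Context {R : realType} {d d' : measure_display} {T : measurableType d} {Omega : measurableType d'}.
Context {P : probability T R} {Q : probability Omega R}.
Variables (X : {RV P >-> R}) (Xe : bond -> {RV Q >-> R}) (M v J0 eps : R).
Hypothesis copies : iid_copies X Xe.
Hypothesis X_le : {ae P, forall w, `|X w| <= M}.
Hypothesis X_mean : ('E_P[X] = 0)%E.
Hypothesis X_var : ('V_P[X] = v%:E)%E.
Hypothesis J_ge : {ae P, forall w, J0 / 2 <= J0 + eps * X w}.
Hypothesis M_ge0 : 0 <= M.
Hypothesis J0_gt0 : 0 < J0.

Lemma same_law_preimage e (B : set R) : measurable B ->
  Q (Xe e @^-1` B) = P (X @^-1` B).
Proof. by move=> mB; have [_ h] := copies; exact: (esym (h e B mB)). Qed.

Lemma strength_ge e : {ae Q, forall w, J0 / 2 <= J0 + eps * Xe e w}.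
Proof.
pose B := [set x : R | ~ (J0 / 2 <= J0 + eps * x)].
have mB : measurable B.
  have m : measurable_fun setT (fun x : R => J0 + eps * x).
    by apply: measurable_funD => //; apply: measurable_funM.
  rewrite (_ : B = setT `&` (fun x : R => J0 + eps * x) @^-1` `]-oo, J0 / 2[).
    by apply: m => //; exact: measurable_itv.
  rewrite setTI; apply/seteqP; split => x /=; rewrite in_itv/= ltNge; first by move/negP.
  by move=> /negP.
have PB : P (X @^-1` B) = 0%E.
  have mX : measurable (X @^-1` B) by rewrite -[X in measurable X]setTI; exact: measurable_funPT.
  exact: (negligibleP P mX).1 J_ge.
have QB : Q (Xe e @^-1` B) = 0%E by rewrite same_law_preimage.
exists (Xe e @^-1` B); split => //.
by rewrite -[X in measurable X]setTI; exact: measurable_funPT.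
Qed.

Section EffectiveCoupling.
Variables (beta eta : R).
Hypothesis beta_gt0 : 0 < beta.
Hypothesis eta_gt0 : 0 < eta.
Hypothesis eps_small : 2 * beta * `|eps| * M <= 2^-1.

(** The number [b] is the effective coupling: exp (- 2 b) dominates the
    exponential moment of the discretized disorder. *)
Lemma averaged_correlation_ge (b : R) x y : 0 <= b ->
  expR (2 * beta * eta - 2 * beta * J0) * (1 + cubic_error M v eps beta) <= expR (- b *+ 2) ->
  clean_correlation b x y <=
  averaged_correlation Q (fun e w => J0 + eps * Xe e w) beta x y.
Proof.
move=> b0 hb.
pose Kw (e : bond) (w : Omega) : R := beta * (J0 + eps * Xe e w).
have Kw_meas e : measurable_fun setT (Kw e).
  apply: measurable_funM => //; apply: measurable_funD => //.
  by apply: measurable_funM => //; exact: measurable_funPT.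
have Kw_ge0 e : {ae Q, forall w, 0 <= Kw e w}.
  apply: filterS (strength_ge e) => w h; rewrite /Kw mulr_ge0 ?(ltW beta_gt0)//.
  by apply: le_trans h; rewrite divr_ge0// ltW.
apply: (limn_mean_corr_ge Kw_meas Kw_ge0 _ b0) => n xn yn.
have [indep _] := copies.
apply: (mean_corr_ge Kw_meas Kw_ge0 (Xe := Xe) (B := @cell R M J0 eps eta) (p := @cell_prob R d T P X M J0 eps eta)
  (a := @cell_level R M J0 eps beta eta)) => //.
- by move=> j; exact: cell_measurable.
- by move=> j j'; exact: cell_disjoint.
- by move=> e j; rewrite same_law_preimage ?cell_probE//; exact: cell_measurable.
- exact: cell_prob_sum.
- by move=> j; exact: cell_level_ge0.
- by apply: le_trans hb; exact: cell_exp_moment.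
- by move=> e j w; exact: cell_level_le.
Qed.

End EffectiveCoupling.

Lemma not_exponential_decay (r b : R) : beta_BKT = r%:E -> 0 <= b -> r < b ->
  ~ exponential_decay (clean_correlation b (0, 0)).
Proof.
move=> rE b0 rb hb; have : (b%:E <= beta_BKT)%E.
  by apply: ereal_sup_ubound; exists b.
by rewrite rE lee_fin leNgt rb.
Qed.

(** The slack in the last hypothesis is shared between the effective coupling,
    which must exceed the clean threshold [r] strictly, and the width of the
    cells. *)
Lemma beta_alg_le (r beta : R) : beta_BKT = r%:E -> 0 <= r -> 0 < beta ->
  2 * beta * `|eps| * M <= 2^-1 ->
  r < beta * J0 - beta ^+ 2 * eps ^+ 2 * v - 4 * beta ^+ 3 * M ^+ 3 * `|eps| ^+ 3 ->
  (beta_alg Q (fun e w => (J0 + eps * Xe e w)%R) <= beta%:E)%E.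
Proof.
move=> rE r0 beta0 small rlt.
pose s := beta * J0 - beta ^+ 2 * eps ^+ 2 * v - 4 * beta ^+ 3 * M ^+ 3 * `|eps| ^+ 3 - r.
have s0 : 0 < s by rewrite subr_gt0.
pose b := r + s / 2; pose eta := s / (2 * beta).
have eta0 : 0 < eta by rewrite divr_gt0// mulr_gt0.
have b0 : 0 < b by rewrite ltr_wpDl// divr_gt0.
apply: ereal_inf_lbound; exists beta => //; split; first exact: ltW.
have [|c [k [c0 k0 h]]] := clean_algebraic_lower_bound b0 (not_exponential_decay rE (ltW b0) _).
  by rewrite ltrDl divr_gt0.
exists c, k; split => // x x0; apply: le_trans (h x x0) _.
apply: (averaged_correlation_ge (eta := eta)) => //; first exact: ltW.
apply: le_trans (_ : expR (2 * beta * eta - 2 * beta * J0 + cubic_error M v eps beta) <= _).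
  by rewrite [leRHS]expRD ler_wpM2l ?expR_ge0// expR_ge1Dx.
rewrite ler_expR mulr2n.
have -> : 2 * beta * eta = s by rewrite /eta; field; rewrite gt_eqF.
by rewrite /b /s /cubic_error; lra.
Qed.

End AveragedModel.

Section Threshold.
Context {R : realType}.

Lemma beta_alg_ge0 d (T : measurableType d) (P : probability T R) (J : bond -> T -> R) :
  (0 <= beta_alg P J)%E.
Proof. by apply/ereal_infP => _ [b [b0 _] <-]; rewrite lee_fin. Qed.

Lemma T_alg_ge0 d (T : measurableType d) (P : probability T R) (J : bond -> T -> R) :
  (0 <= T_alg P J)%E.
Proof. by rewrite inve_ge0 beta_alg_ge0. Qed.

(** With t = 1 / beta, T0 = J0 / r and D = T0 - t, the last condition
    multiplied by t^2 reads v eps^2 + O (|eps|^3) < J0 D - r D^2. It holds for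
    D > v eps^2 / J0 + C |eps|^3 with C large, the term r D^2 being of order
    eps^4 at the smallest such D. Keeping t above T0 / 2 bounds 1 / t and
    keeps D in the range where the right-hand side increases. *)
Lemma threshold_expansion (J0 r v M : R) : 0 < J0 -> 0 < r -> 0 <= v -> 0 <= M ->
  exists C eps0 : R, 0 < eps0 /\ forall eps, `|eps| < eps0 ->
    let D0 := v / J0 * eps ^+ 2 + C * `|eps| ^+ 3 in
    D0 < J0 / r / 2 /\
    forall t, J0 / r / 2 < t -> t < J0 / r - D0 ->
      2 * t^-1 * `|eps| * M <= 2^-1 /\
      r < t^-1 * J0 - t^-1 ^+ 2 * eps ^+ 2 * v - 4 * t^-1 ^+ 3 * M ^+ 3 * `|eps| ^+ 3.
Proof.
move=> J00 r0 v0 M0.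
pose T0 := J0 / r; have T00 : 0 < T0 by rewrite divr_gt0.
pose A := 8 * r * M ^+ 3 / J0.
have A0 : 0 <= A by rewrite divr_ge0 ?(ltW J00)// !mulr_ge0 ?exprn_ge0// ltW.
pose C := (A + 1) / J0.
have C0 : 0 < C by rewrite divr_gt0// ltr_wpDl.
pose S := v / J0 + C.
have S0 : 0 < S by rewrite ltr_wpDl// divr_ge0// ltW.
pose e1 := (r * S ^+ 2 + 1)^-1; pose e2 := T0 / (2 * S); pose e3 := T0 / (8 * (M + 1)).
have e10 : 0 < e1 by rewrite invr_gt0 ltr_wpDl// mulr_ge0 ?sqr_ge0// ltW.
have e20 : 0 < e2 by rewrite divr_gt0// mulr_gt0.
have e30 : 0 < e3 by rewrite divr_gt0// mulr_gt0// ltr_wpDl.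
exists C, (Num.min 1 (Num.min e1 (Num.min e2 e3))); split.
  by rewrite !lt_min ltr01 e10 e20 e30.
move=> eps; rewrite !lt_min => /and4P[l1 l2 l3 l4].
set a := `|eps| in l1 l2 l3 l4 *; have a0 : 0 <= a := normr_ge0 _.
have -> : eps ^+ 2 = a ^+ 2 by rewrite -normrX ger0_norm ?sqr_ge0.
move=> D0.
have D00 : 0 <= D0.
  rewrite /D0; apply: addr_ge0; apply: mulr_ge0; rewrite ?exprn_ge0//; last exact: ltW.
  by rewrite divr_ge0// ltW.
have a32 : a ^+ 3 <= a ^+ 2 by rewrite exprSr ler_piMr ?sqr_ge0// ltW.
have a21 : a ^+ 2 <= a by rewrite expr2 ler_piMr// ltW.
have D0S : D0 <= S * a ^+ 2.
  rewrite /D0 /S mulrDl lerD2l ler_wpM2l// ltW//.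
have D0T : D0 < T0 / 2.
  apply: (le_lt_trans D0S); apply: (@le_lt_trans _ _ (S * a)); first by rewrite ler_wpM2l// ltW.
  by move: l3; rewrite /e2 ltr_pdivlMr ?mulr_gt0//; lra.
split; first exact: D0T.
move=> t; rewrite -/T0 => t1 t2; have t0 : 0 < t by apply: lt_trans t1; rewrite divr_gt0.
have tV : t^-1 <= 2 / T0.
  rewrite -[leRHS]invrK invf_div lef_pV2 ?posrE ?divr_gt0//; exact: ltW.
have tV0 : 0 < t^-1 by rewrite invr_gt0.
split.
  have h : a * (8 * (M + 1)) <= T0 by move: l4; rewrite /e3 ltr_pdivlMr ?mulr_gt0 ?ltr_wpDl// => /ltW.
  apply: (@le_trans _ _ (2 * (2 / T0) * a * M)).
    by rewrite !ler_wpM2r// ler_wpM2l.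
  rewrite (_ : _ * M = 4 * a * M / T0); last by field; rewrite gt_eqF.
  by rewrite ler_pdivrMr//; nra.
pose D := T0 - t.
have DD0 : D0 < D by rewrite /D ltrBrDr addrC -ltrBrDr.
have DT : D < T0 / 2 by rewrite /D; lra.
have key : v * a ^+ 2 + A * a ^+ 3 < J0 * D - r * D ^+ 2.
  have J0E : J0 = r * T0 by rewrite /T0; field; rewrite gt_eqF.
  (* D |-> J0 D - r D^2 increases up to T0 / 2, so only D0 has to be checked. *)
  have h1 : J0 * D0 - r * D0 ^+ 2 < J0 * D - r * D ^+ 2.
    rewrite -subr_gt0 (_ : _ - _ = r * (D - D0) * (T0 - D - D0)); last by rewrite J0E; ring.
    by rewrite !mulr_gt0// ?subr_gt0//; lra.
  apply: le_lt_trans h1.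
  have h2 : r * D0 ^+ 2 <= a ^+ 3.
    have : D0 ^+ 2 <= (S * a ^+ 2) ^+ 2 by rewrite lerXn2r ?nnegrE// mulr_ge0 ?sqr_ge0// ltW.
    have : r * S ^+ 2 * a <= 1.
      move: l2; rewrite /e1 -[_^-1]mul1r ltr_pdivlMr; last by rewrite ltr_wpDl// mulr_ge0 ?sqr_ge0// ltW.
      by lra.
    move=> k1 k2; apply: le_trans (_ : r * (S * a ^+ 2) ^+ 2 <= _); first by rewrite ler_wpM2l// ltW.
    rewrite (_ : r * _ = (r * S ^+ 2 * a) * a ^+ 3); last by ring.
    by rewrite ler_piMl// exprn_ge0.
  have -> : J0 * D0 = v * a ^+ 2 + (A + 1) * a ^+ 3.
    by rewrite /D0 /C; field; rewrite gt_eqF.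
  by lra.
have t2V : t^-1 ^+ 2 * (J0 * t - r * t ^+ 2) = t^-1 * J0 - r by field; rewrite gt_eqF.
have Dt : J0 * t - r * t ^+ 2 = J0 * D - r * D ^+ 2.
  by rewrite /D /T0; field; rewrite gt_eqF.
have h3 : 4 * t^-1 ^+ 3 * M ^+ 3 * a ^+ 3 <= t^-1 ^+ 2 * (A * a ^+ 3).
  rewrite (_ : 4 * _ * _ * _ = t^-1 ^+ 2 * (4 * t^-1 * M ^+ 3 * a ^+ 3)); last by ring.
  rewrite ler_wpM2l ?sqr_ge0// ler_wpM2r ?exprn_ge0//.
  rewrite (_ : A = 4 * (2 / T0) * M ^+ 3); last by rewrite /A /T0; field; rewrite !gt_eqF.
  by rewrite ler_wpM2r ?exprn_ge0// ler_wpM2l.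
have h4 : t^-1 ^+ 2 * (v * a ^+ 2 + A * a ^+ 3) < t^-1 * J0 - r.
  by rewrite -t2V ltr_pM2l ?exprn_gt0// Dt.
have : t^-1 ^+ 2 * (v * a ^+ 2 + A * a ^+ 3) = t^-1 ^+ 2 * a ^+ 2 * v + t^-1 ^+ 2 * (A * a ^+ 3) by ring.
lra.
Qed.

End Threshold.

Unset Implicit Arguments.

Theorem corollary5p2 (R : realType) (J0 : R) (d : measure_display)
    (T : measurableType d) (P : probability T R) (X : {RV P >-> R}) (v : R) :
  0 < J0 ->
  (exists M : R, {ae P, forall w, `|X w| <= M}) ->
  ('E_P[X] = 0)%E ->
  ('V_P[X] = v%:E)%E ->
  exists C eps0 : R, 0 < eps0 /\
    forall eps : R, `|eps| < eps0 ->
      {ae P, forall w, J0 / 2 <= J0 + eps * X w} ->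
      forall (d' : measure_display) (Omega : measurableType d')
        (Q : probability Omega R) (Xe : bond -> {RV Q >-> R}),
        iid_copies X Xe ->
        (T_clean J0 - (v / J0 * eps ^+ 2 + C * `|eps| ^+ 3)%:E <=
          T_alg Q (fun e w => J0 + eps * Xe e w)%R)%E.
Proof.
move=> J00 [M0 XM0] X0 Xv.
have v0 : 0 <= v := variance_v_ge0 Xv.
pose M := `|M0|; have M_ge0 : 0 <= M := normr_ge0 _.
have XM : {ae P, forall w, `|X w| <= M}.
  by move: XM0; apply: filterS => w h; rewrite (le_trans h)// ler_norm.
have trivial_case : ((T_clean J0 : \bar R) <= 0)%E ->
  exists C eps0 : R, 0 < eps0 /\ forall eps : R, `|eps| < eps0 ->
      {ae P, forall w, J0 / 2 <= J0 + eps * X w} ->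
      forall (d' : measure_display) (Omega : measurableType d')
        (Q : probability Omega R) (Xe : bond -> {RV Q >-> R}),
        iid_copies X Xe ->
        (T_clean J0 - (v / J0 * eps ^+ 2 + C * `|eps| ^+ 3)%:E <=
          T_alg Q (fun e w => J0 + eps * Xe e w)%R)%E.
  move=> Tle; exists 0, 1; split => // eps _ _ d' Omega Q Xe _.
  apply: (@le_trans _ _ 0%E); last exact: T_alg_ge0.
  rewrite leeBlDr// add0e; apply: (le_trans Tle).
  by rewrite lee_fin mul0r addr0 mulr_ge0 ?sqr_ge0// divr_ge0// ltW.
(* Only when the clean threshold is a nonnegative real is the clean temperature
   positive; when it is zero, both temperatures are infinite. *)
case E : (@beta_BKT R) => [r| |]; last 2 first.
- by apply: trivial_case; rewrite /T_clean E invey mule0.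
- by apply: trivial_case; rewrite /T_clean E inveNy mulrNy gtr0_sg// mul1e.
have [r0|r0|r0] := ltrgtP r 0.
- apply: trivial_case; rewrite /T_clean E inver lt_eqF// -EFinM lee_fin.
  by rewrite mulr_ge0_le0 ?(ltW J00)// invr_le0 ltW.
- have [C [eps0 [eps00 H]]] := threshold_expansion J00 r0 v0 M_ge0.
  exists C, eps0; split => // eps eps_lt Jge d' Omega Q Xe copies.
  have [D0T Ht] := H eps eps_lt.
  set D0 := v / J0 * _ + _ in D0T Ht *.
  have bound t : J0 / r / 2 < t -> t < J0 / r - D0 ->
      (t%:E <= T_alg Q (fun e w => J0 + eps * Xe e w)%R)%E.
    move=> t1 t2; have [h1 h2] := Ht t t1 t2.
    have t0 : 0 < t by apply: lt_trans t1; rewrite !divr_gt0.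
    have := beta_alg_le copies XM X0 Xv Jge M_ge0 J00 E (ltW r0) _ h1 h2.
    rewrite invr_gt0 => /(_ t0) hb; rewrite /T_alg inve_pge ?inE ?lee_fin ?beta_alg_ge0 ?(ltW t0)//.
    by rewrite inver gt_eqF.
  rewrite /T_clean E inver gt_eqF// -EFinM -EFinB.
  apply/lee_subgt0Pr => e e0; rewrite -EFinB.
  (* Temperatures approach the bound from below, staying above T0 / 2. *)
  pose m := J0 / r - D0; pose t := Num.max (m - e) ((m + J0 / r / 2) / 2).
  have mT : J0 / r / 2 < m by rewrite /m; lra.
  apply: (@le_trans _ _ t%:E); first by rewrite lee_fin le_max lexx.
  by apply: bound; rewrite ?lt_max ?gt_max -/m; [apply/orP; right; lra|apply/andP; split; lra].
- exists 0, 1; split => // eps _ Jge d' Omega Q Xe copies.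
  suff -> : T_alg Q (fun e w => J0 + eps * Xe e w)%R = +oo%E by rewrite leey.
  rewrite /T_alg; apply/eqP; rewrite inve_eqy eq_le beta_alg_ge0 andbT.
  rewrite r0 in E.
  pose a := `|eps|; have a0 : 0 <= a := normr_ge0 _.
  pose K := a ^+ 2 * v + 4 * M ^+ 3 * a ^+ 3.
  (* At zero threshold every small coupling is admissible, by positivity of the
     term linear in [b]. *)
  pose B := 4 * (a * M + 1) + K / J0 + 1.
  have K0 : 0 <= K by rewrite addr_ge0 ?mulr_ge0 ?exprn_ge0.
  have aM : 0 <= a * M by rewrite mulr_ge0.
  have k1 : 0 <= K / J0 by rewrite divr_ge0// ltW.
  have B0 : 1 <= B by rewrite /B; lra.
  have small b : 0 < b -> b * B <= 1 -> (beta_alg Q (fun e w => J0 + eps * Xe e w)%R <= b%:E)%E.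
    move=> b0 bB.
    have baM : 0 <= b * (a * M) by rewrite mulr_ge0// ltW.
    have bk : 0 <= b * (K / J0) by rewrite mulr_ge0// ltW.
    have bBE : 4 * (b * (a * M)) + 5 * b + b * (K / J0) <= 1 by move: bB; rewrite /B; lra.
    apply: (beta_alg_le copies XM X0 Xv Jge M_ge0 J00 E) => //.
      by rewrite -/a (_ : 2 * b * a * M = 2 * (b * (a * M))); [lra|ring].
    rewrite -/a (_ : eps ^+ 2 = a ^+ 2); last by rewrite -normrX ger0_norm ?sqr_ge0.
    have b1 : b < 1 by lra.
    have bK : b * K < J0.
      by rewrite -[ltRHS]mul1r -ltr_pdivrMr// -mulrA; lra.
    have b32 : b ^+ 3 <= b ^+ 2 by rewrite exprSr ler_piMr ?sqr_ge0// ltW.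
    have w0 : 0 <= 4 * M ^+ 3 * a ^+ 3 by rewrite !mulr_ge0 ?exprn_ge0.
    rewrite (_ : _ - _ - _ = b * (J0 - b * K) + (b ^+ 2 - b ^+ 3) * (4 * M ^+ 3 * a ^+ 3)); last by rewrite /K; ring.
    by rewrite ltr_wpDr ?mulr_ge0 ?mulr_gt0 ?subr_gt0 ?subr_ge0.
  apply/lee_addgt0Pr => e e0; rewrite add0e.
  apply: (@le_trans _ _ (Num.min e B^-1)%:E); last by rewrite lee_fin ge_min lexx.
  have B00 : 0 < B by apply: lt_le_trans B0.
  apply: small; first by rewrite lt_min e0 invr_gt0.
  by rewrite -ler_pdivlMr// mul1r ge_min lexx orbT.
Qed.
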